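(* Let $v:\mathbb{T}\to\mathbb{R}$ be continuous, let $\alpha\in\mathbb{T}$ be irrational, and let $p_n/q_n\to\alpha$ with $(p_n,q_n)=1$. Let $H_{\alpha,\theta}$ be the quasi-periodic Schrödinger operator with potential $v$, and assume its Lyapunov exponent satisfies $L(\alpha,E)=0$ for every $E$ in its spectrum $\Sigma(\alpha)$. Then $$\mu_{S_+(p_n/q_n)}\to\mu_{\Sigma(\alpha)}$$ in the weak* topology as $p_n/q_n\to\alpha$, where $\mu_K$ is the equilibrium measure of the compact set $K$.
   Context: $\mathbb{T}=\mathbb{R}/\mathbb{Z}$. For $\alpha,\theta\in\mathbb{T}$, $H_{\alpha,\theta}$ acts on $\ell^2(\mathbb{Z})$ by $(H_{\alpha,\theta}\psi)_n=\psi_{n-1}+\psi_{n+1}+v(\alpha n+\theta)\psi_n$; its spectrum is $\sigma(\alpha,\theta)$. For irrational $\alpha$, $\sigma(\alpha,\theta)$ is independent of $\theta$ and denoted $\Sigma(\alpha)$. For rational $p/q$, $S_+(p/q)=\bigcup_{\theta\in\mathbb{T}}\sigma(p/q,\theta)$. Lyapunov exponent: with $A^E(\theta)=\begin{pmatrix}E-v(\theta)&-1\\1&0\end{pmatrix}$, $$L(\alpha,E)=\inf_{n\ge1}\frac1n\int_{\mathbb{T}}\log\big\|A^E(\theta+(n-1)\alpha)\cdots A^E(\theta+\alpha)A^E(\theta)\big\|\,d\theta.$$ Equilibrium measure: for a compact set $K\subset\mathbb{C}$ of positive logarithmic capacity, $\mu_K$ is the unique Borel probability measure on $K$ minimizing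 $I(\mu)=\iint\log\frac1{|z-w|}\,d\mu(w)\,d\mu(z)$. Weak* convergence $\mu_n\to\mu$ means $\int f\,d\mu_n\to\int f\,d\mu$ for every continuous compactly supported $f$ on $\mathbb{C}$. *)

(* Defs.v *)
From HB Require Import structures.
From mathcomp Require Import all_boot all_order all_algebra.
From mathcomp Require Import complex.
From mathcomp Require Import all_classical all_reals all_analysis.
Set Implicit Arguments.
Unset Strict Implicit.
Unset Printing Implicit Defensive.
Import Order.TTheory GRing.Theory Num.Theory.
Import numFieldNormedType.Exports.
Import ComplexField.Normc.
Local Open Scope classical_set_scope.
Local Open Scope ring_scope.
Local Open Scope complex_scope.

(* Functions on T = R/Z are 1-periodic functions on the real line, and points
   of T are given by arbitrary real representatives. *)

Definition circle_dist (R : realType) (x y : R) : R :=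
  inf [set `|x - y - m%:~R| | m in [set: int]].

Definition circle_continuous (R : realType) (v : R -> R) : Prop :=
  continuous v /\ forall x, v (x + 1) = v x.

Definition l2_mass (R : realType) (psi : int -> R[i]) : \bar R :=
  (\esum_(n in [set: int]) ((normc (psi n)) ^+ 2)%:E)%E.

Definition l2 (R : realType) (psi : int -> R[i]) : Prop :=
  (l2_mass psi < +oo)%E.

Definition l2_norm (R : realType) (psi : int -> R[i]) : R :=
  Num.sqrt (fine (l2_mass psi)).

(* Operators on l^2(Z) are maps on all sequences, considered only on l2. *)
Definition bounded_l2_operator (R : realType)
    (B : (int -> R[i]) -> (int -> R[i])) : Prop :=
  [/\ forall psi, l2 psi -> l2 (B psi),
      forall (a : R[i]) phi psi, l2 phi -> l2 psi ->
        B (fun n => a * phi n + psi n) = (fun n => a * B phi n + B psi n)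
    & exists M : R, forall psi, l2 psi -> l2_norm (B psi) <= M * l2_norm psi].

Definition schrodinger (R : realType) (v : R -> R) (alpha theta : R)
    (psi : int -> R[i]) : int -> R[i] :=
  fun n => psi (n - 1) + psi (n + 1)
           + (v (alpha * n%:~R + theta))%:C * psi n.

Definition l2_spectrum (R : realType)
    (H : (int -> R[i]) -> (int -> R[i])) : set R[i] :=
  [set E | ~ exists B : (int -> R[i]) -> (int -> R[i]),
     bounded_l2_operator B /\
     forall psi, l2 psi ->
       (fun n => H (B psi) n - E * B psi n) = psi /\
       B (fun n => H psi n - E * psi n) = psi].

Definition sigma (R : realType) (v : R -> R) (alpha theta : R) : set R[i] :=
  l2_spectrum (schrodinger v alpha theta).

(* For irrational alpha the spectrum does not depend on theta; phase 0 serves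
   as the representative. *)
Definition Sigma (R : realType) (v : R -> R) (alpha : R) : set R[i] :=
  sigma v alpha 0.

Definition Splus (R : realType) (v : R -> R) (alpha : R) : set R[i] :=
  \bigcup_(theta in [set: R]) sigma v alpha theta.

Definition vec_norm (R : realType) (x : 'cV[R[i]]_2) : R :=
  Num.sqrt (\sum_i (normc (x i 0)) ^+ 2).

(* Euclidean operator norm; the norm that the library puts on matrices is the
   maximum of the entries, which is not submultiplicative. *)
Definition op_norm (R : realType) (A : 'M[R[i]]_2) : R :=
  sup [set vec_norm (A *m x) | x in [set x | vec_norm x <= 1]].

Definition transfer (R : realType) (v : R -> R) (E : R[i]) (theta : R) :
    'M[R[i]]_2 :=
  \matrix_(i, j)
    (if i == 0 then (if j == 0 then E - (v theta)%:C else -1)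
     else (if j == 0 then 1 else 0)).

Fixpoint cocycle (R : realType) (v : R -> R) (alpha : R) (E : R[i]) (n : nat)
    (theta : R) : 'M[R[i]]_2 :=
  if n is m.+1
  then transfer v E (theta + m%:R * alpha) *m cocycle v alpha E m theta
  else 1%:M.

Definition lyapunov (R : realType) (v : R -> R) (alpha : R) (E : R[i]) : R :=
  inf [set n%:R^-1 * \int[lebesgue_measure]_(theta in `[0%R, 1%R])
                       ln (op_norm (cocycle v alpha E n theta))
      | n in [set n : nat | (0 < n)%N]].

(* The complex plane with its Borel sigma-algebra. *)
Notation borelC R := (g_sigma_algebraType (@open (R[i])^o)).

Definition log_energy (R : realType) (mu : probability (borelC R) R) : \bar R :=
  (\int[mu]_z \int[mu]_w - lne (normc ((z : R[i]) - (w : R[i])))%:E)%E.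

Definition is_equilibrium (R : realType) (K : set R[i])
    (mu : probability (borelC R) R) : Prop :=
  mu K = 1%E /\
  forall nu : probability (borelC R) R,
    nu K = 1%E -> (log_energy mu <= log_energy nu)%E.

(* Meaningful for compact K of positive logarithmic capacity, for which the
   minimizer exists and is unique. *)
Definition equilibrium_measure (R : realType) (K : set R[i]) :
    probability (borelC R) R :=
  get (@is_equilibrium R K).

Definition weak_star_cvg (R : realType)
    (mu_ : nat -> probability (borelC R) R) (mu : probability (borelC R) R) :
    Prop :=
  forall f : (R[i])^o -> R,
    continuous f -> compact (closure [set z | f z != 0]) ->
    (fun n => \int[mu_ n]_z f z) @ \oo --> \int[mu]_z f z.

(* Main.v *)
(* All spectra lie on the real line, in a common interval [-M, M].  Two facts are needed.
   First, each of the spectra has capacity at least 1: H is tridiagonal with off-diagonal entries 1,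
   so for a monic polynomial p the norm of p(H) is at least 1 and |p| reaches 1 on the spectrum; Leja
   points then produce measures of nonpositive energy.
   Second, if L = 0 on Sigma(alpha), then for every e > 0 there is a monic Q of degree n with
   |Q| <= exp(n e) on Sigma(alpha): Q is a product of upper left entries of transfer matrices over
   equidistributed phases, and the Riemann sums of log |A_n| approximate n L = 0.  By continuity
   |Q| <= exp(2 n e) on a neighbourhood of Sigma(alpha), and it contains S_+(p_n/q_n) for large n,
   because truncated approximate eigenvectors transfer between nearby frequencies.  Such a Q forces
   every measure on the neighbourhood to have energy at least -2e (greedy points and a Vandermonde
   determinant).  Hence mu_n, mu and (mu_n + mu)/2 all have energy close to 0, so by the parallelogram
   law the energy of mu_n - mu tends to 0, and this energy dominates the square of the integral of a
   Lipschitz function.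

   Measures enter this argument only as positive linear functionals on Lipschitz functions, with
   the logarithmic kernel truncated near the diagonal. *)

Require Import Defs.
From mathcomp Require Import all_boot all_order all_algebra.
From mathcomp Require Import perm complex.
From mathcomp Require Import all_classical all_reals all_analysis.
From mathcomp Require Import measurable_realfun ring lra zify.
Set Implicit Arguments.
Unset Strict Implicit.
Unset Printing Implicit Defensive.
Import Order.TTheory GRing.Theory Num.Theory.
Import numFieldNormedType.Exports.
Import ComplexField.Normc.
Local Open Scope classical_set_scope.
Local Open Scope ring_scope.
Local Open Scope complex_scope.

(** * Spectra of Jacobi operators *)

(** The kernel is normalized as [ln (D / r)] with [D = 2 * M], a bound for all distances: it is then
    nonnegative, energies increase as the truncation shrinks, and [log_energy] at most 0 becomes
    truncated energy at most [ln D]. Truncating by a tangent line, not by a cut-off value, keeps the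
    kernel Lipschitz, convex and decreasing in the distance; on a grid this gives positive
    definiteness (as in Polya's criterion), which takes the place of Fourier analysis when an
    integral is bounded by an energy. The equilibrium measure is defined by choice, so a minimizer
    must be produced before anything is known about it. Measures on the line are represented as
    images of Lebesgue measure under monotone functions: these have pointwise limits along an
    ultrafilter and uniformly accurate Riemann sums. The spectrum is defined by the absence of a
    bounded inverse on complex sequences. The resolvent at [a + ib] is built from the real operator
    [(H - a)^2 + b^2], after which only finitely supported real sequences occur. *)

Definition window (R : realType) (N : nat) (f : int -> R) : R :=
  \sum_(i < N.*2.+1) f (i%:Z - N%:Z).

Definition supported (V : nmodType) (N : nat) (f : int -> V) : Prop :=
  forall n : int, (N%:Z < `|n|)%R -> f n = 0.

Definition finsupp (V : nmodType) (f : int -> V) : Prop :=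
  exists N, supported N f.

(** The sum over all integers of a finitely supported sequence: [xget] picks some radius of the
    support, and by [totE] every radius gives the same sum. Without finite support the default
    radius 0 makes this just [f 0]. *)
Definition tot (R : realType) (f : int -> R) : R :=
  window (xget 0%N [set N | supported N f]) f.

Definition jacobi (F : pzRingType) (V : int -> F) (psi : int -> F) : int -> F :=
  fun n => psi (n - 1) + psi (n + 1) + V n * psi n.

Section Windows.
Variable R : realType.
Implicit Types f g : int -> R.

Lemma windowS N f :
  window N.+1 f = f (- (N.+1)%:Z) + window N f + f (N.+1)%:Z.
Proof.
rewrite /window doubleS big_ord_recr big_ord_recl /=.
congr (f _ + _ + f _); first by rewrite add0r.
  by apply: eq_bigr => i _; congr (f _); rewrite /bump /=; lia.
by lia.
Qed.

Lemma window_supported N N' f : supported N f -> (N <= N')%N ->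
  window N' f = window N f.
Proof.
move=> sf; elim: N' => [|N' IH]; first by rewrite leqn0 => /eqP ->.
rewrite leq_eqVlt => /predU1P[->//|]; rewrite ltnS => le.
by rewrite windowS IH// !sf ?add0r ?addr0//; lia.
Qed.

Lemma supportedW (V : nmodType) N N' (f : int -> V) :
  supported N f -> (N <= N')%N -> supported N' f.
Proof. by move=> sf le n hn; apply: sf; lia. Qed.

Lemma totE N f : supported N f -> tot f = window N f.
Proof.
move=> sf; rewrite /tot; set N' := xget _ _.
have sf' : supported N' f by apply: (@xgetPex _ 0%N [set N | supported N f]); exists N.
case: (leqP N N') => h; first exact: (window_supported sf h).
by rewrite (window_supported sf') // ltnW.
Qed.

Lemma windowD N f g : window N (fun n => f n + g n) = window N f + window N g.
Proof. exact: big_split. Qed.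

Lemma windowZ N c f : window N (fun n => c * f n) = c * window N f.
Proof. by rewrite /window mulr_sumr. Qed.

Lemma window_le N f g : (forall n, f n <= g n) -> window N f <= window N g.
Proof. by move=> h; apply: ler_sum. Qed.

Lemma window_ge0 N f : (forall n, 0 <= f n) -> 0 <= window N f.
Proof. by move=> h; apply: sumr_ge0. Qed.

Lemma window_shift N f :
  window N (fun n => f (n + 1)) = window N f + f (N%:Z + 1) - f (- N%:Z).
Proof.
rewrite /window big_ord_recr [in RHS]big_ord_recl /= add0r.
rewrite [_ + (\sum_(i < _) _)]addrC -[in RHS]addrA [f _ + _ in RHS]addrC addrA addrK.
congr (_ + f _); last by lia.
by apply: eq_bigr => i _; congr f; rewrite /bump /=; lia.
Qed.

Lemma window_term N f (n : int) : (forall n, 0 <= f n) -> (`|n| <= N%:Z)%R ->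
  f n <= window N f.
Proof.
move=> f0 hn.
have hi : (absz (n + N%:Z)%R < N.*2.+1)%N by lia.
rewrite /window (bigD1 (Ordinal hi))//=.
have -> : (absz (n + N%:Z))%:Z - N%:Z = n by lia.
by rewrite lerDl sumr_ge0.
Qed.

Lemma window_nondecr N N' f : (forall n, 0 <= f n) -> (N <= N')%N ->
  window N f <= window N' f.
Proof.
move=> f0; elim: N' => [|N' IH]; first by rewrite leqn0 => /eqP ->.
rewrite leq_eqVlt => /predU1P[->//|]; rewrite ltnS => le.
rewrite windowS; apply: (le_trans (IH le)).
by rewrite -addrA addrCA lerDl addr_ge0.
Qed.

Lemma finsupp2 (V1 V2 : nmodType) (f : int -> V1) (g : int -> V2) :
  finsupp f -> finsupp g ->
  exists N, supported N f /\ supported N g.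
Proof.
move=> [N sf] [N' sg]; exists (maxn N N').
by split; [apply: supportedW sf _|apply: supportedW sg _]; lia.
Qed.

Lemma finsupp_comp (V1 V2 : nmodType) (f : int -> V1) (h : int -> V1 -> V2) :
  (forall n, h n 0 = 0) -> finsupp f -> finsupp (fun n => h n (f n)).
Proof. by move=> h0 [N sf]; exists N => n hn; rewrite sf. Qed.

Lemma finsuppD (V : nmodType) (f g : int -> V) :
  finsupp f -> finsupp g -> finsupp (fun n => f n + g n).
Proof.
move=> ff fg; have [N [sf sg]] := finsupp2 ff fg.
by exists N => n hn; rewrite sf// sg// addr0.
Qed.

Lemma finsuppZ (F : pzRingType) (c : int -> F) (f : int -> F) :
  finsupp f -> finsupp (fun n => c n * f n).
Proof. by move=> ff; apply: (finsupp_comp (h := fun n x => c n * x)) => // n; rewrite mulr0. Qed.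

Lemma finsuppB (V : zmodType) (f g : int -> V) :
  finsupp f -> finsupp g -> finsupp (fun n => f n - g n).
Proof.
move=> ff fg; apply: finsuppD => //.
by apply: (finsupp_comp (h := fun _ x => - x)) => // n; rewrite oppr0.
Qed.

Lemma finsupp_shift (V : nmodType) (f : int -> V) (a : int) :
  finsupp f -> finsupp (fun n => f (n + a)).
Proof. by move=> [N sf]; exists (N + `|a|)%N => n hn; apply: sf; lia. Qed.

Lemma finsupp_jacobi (F : pzRingType) (V psi : int -> F) :
  finsupp psi -> finsupp (jacobi V psi).
Proof.
move=> fp; apply: finsuppD; last exact: finsuppZ.
by apply: finsuppD; exact: finsupp_shift.
Qed.

Lemma totD f g : finsupp f -> finsupp g ->
  tot (fun n => f n + g n) = tot f + tot g.
Proof.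
move=> ff fg; have [N [sf sg]] := finsupp2 ff fg.
rewrite (totE sf) (totE sg) -windowD; apply: totE => n hn.
by rewrite sf// sg// addr0.
Qed.

Lemma totZ c f : finsupp f -> tot (fun n => c * f n) = c * tot f.
Proof.
by move=> [N sf]; rewrite (totE sf) -windowZ; apply: totE => n hn; rewrite sf ?mulr0.
Qed.

Lemma totB f g : finsupp f -> finsupp g ->
  tot (fun n => f n - g n) = tot f - tot g.
Proof.
move=> ff fg; rewrite -[- tot g]mulN1r -totZ// -totD//.
  by congr tot; apply: funext => n; rewrite mulN1r.
exact: finsuppZ.
Qed.

Lemma tot_le f g : finsupp f -> finsupp g -> (forall n, f n <= g n) ->
  tot f <= tot g.
Proof.
move=> ff fg h; have [N [sf sg]] := finsupp2 ff fg.
by rewrite (totE sf) (totE sg) window_le.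
Qed.

Lemma tot_ge0 f : (forall n, 0 <= f n) -> 0 <= tot f.
Proof. by move=> h; apply: window_ge0. Qed.

Lemma tot_term f (n : int) : finsupp f -> (forall n, 0 <= f n) -> f n <= tot f.
Proof.
move=> [N sf] f0; have sf' := supportedW sf (leq_maxl N `|n|%N).
by rewrite (totE sf'); apply: window_term => //; lia.
Qed.

Lemma tot_succ f : finsupp f -> tot (fun n => f (n + 1)) = tot f.
Proof.
move=> [N sf].
have sf' : supported N.+1 f by apply: supportedW sf _.
rewrite (totE sf') (@totE N.+1); last by move=> n hn; apply: sf; lia.
by rewrite window_shift (sf (N.+1%:Z + 1)) ?(sf (- N.+1%:Z)) ?subr0 ?addr0//; lia.
Qed.

Lemma tot_shift f (a : int) : finsupp f -> tot (fun n => f (n + a)) = tot f.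
Proof.
have pos (k : nat) g : finsupp g -> tot (fun n => g (n + k%:Z)) = tot g.
  elim: k g => [|k IH] g fg; first by congr tot; apply: funext => n; rewrite addr0.
  rewrite -[RHS](IH g)// -(@tot_succ (fun n => g (n + k%:Z))); last exact: finsupp_shift.
  by congr tot; apply: funext => n; congr g; lia.
move=> ff; case: a => k; first exact: pos.
rewrite -(@pos k.+1 (fun n => f (n + Negz k))); last exact: finsupp_shift.
by congr tot; apply: funext => n; congr f; lia.
Qed.

Lemma finsupp_sum (V : nmodType) (I : Type) (r : seq I) (F : I -> int -> V) :
  (forall i, finsupp (F i)) -> finsupp (fun n => \sum_(i <- r) F i n).
Proof.
move=> fF; elim: r => [|i r IH]; first by exists 0%N => n _; rewrite big_nil.
rewrite (_ : (fun n => _) = (fun n => F i n + \sum_(j <- r) F j n)); first exact: finsuppD.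
by apply: funext => n; rewrite big_cons.
Qed.

Lemma tot_sum (I : Type) (r : seq I) (F : I -> int -> R) :
  (forall i, finsupp (F i)) ->
  tot (fun n => \sum_(i <- r) F i n) = \sum_(i <- r) tot (F i).
Proof.
move=> fF; elim: r => [|i r IH].
  rewrite big_nil; under [X in tot X]eq_fun do rewrite big_nil.
  by rewrite (@totE 0%N) // /window big1.
rewrite big_cons -IH -totD//; last exact: finsupp_sum.
by congr tot; apply: funext => n; rewrite big_cons.
Qed.

End Windows.

(** * Jacobi operators on finitely supported real sequences *)

Section RealJacobi.
Variables (R : realType) (V : int -> R).
Implicit Types phi psi : int -> R.

Definition n2 phi : R := tot (fun n => phi n ^+ 2).
Definition ip phi psi : R := tot (fun n => phi n * psi n).

Lemma finsupp_sqr phi : finsupp phi -> finsupp (fun n => phi n ^+ 2).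
Proof.
by apply: (finsupp_comp (h := fun _ x => x ^+ 2)) => n; rewrite expr0n.
Qed.

Lemma n2_ge0 phi : 0 <= n2 phi.
Proof. by apply: tot_ge0 => n; exact: sqr_ge0. Qed.

Lemma n2E phi : n2 phi = ip phi phi.
Proof. by congr tot; apply: funext => n; rewrite expr2. Qed.

Lemma ip_jacobi phi psi : finsupp phi -> finsupp psi ->
  ip (jacobi V phi) psi = ip phi (jacobi V psi).
Proof.
move=> ff fp; rewrite /ip /jacobi.
have fs (a b : int) : finsupp (fun n => phi (n + a) * psi (n + b)).
  by apply: (@finsuppZ _ (fun n => phi (n + a)) (fun n => psi (n + b))); exact: finsupp_shift.
have fV : finsupp (fun n => V n * phi n * psi n).
  exact: (@finsuppZ _ (fun n => V n * phi n)).
have -> : (fun n => (phi (n - 1) + phi (n + 1) + V n * phi n) * psi n) =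
   fun n => (phi (n - 1) * psi (n + 0) + phi (n + 1) * psi (n + 0)) + V n * phi n * psi n.
  by apply: funext => n; rewrite addr0; ring.
have -> : (fun n => phi n * (psi (n - 1) + psi (n + 1) + V n * psi n)) =
   fun n => (phi (n + 0) * psi (n - 1) + phi (n + 0) * psi (n + 1)) + V n * phi n * psi n.
  by apply: funext => n; rewrite addr0; ring.
rewrite totD//; last by apply: finsuppD.
rewrite [RHS]totD//; last by apply: finsuppD.
rewrite !totD//; congr (_ + _).
rewrite addrC; congr (_ + _).
  rewrite -(@tot_shift _ (fun n => phi (n + 0) * psi (n - 1)) 1)//.
  by congr tot; apply: funext => n; congr (phi _ * psi _); lia.
rewrite -(@tot_shift _ (fun n => phi (n - 1) * psi (n + 0)) 1)//.
by congr tot; apply: funext => n; congr (phi _ * psi _); lia.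
Qed.

Lemma n2_term phi n : finsupp phi -> phi n ^+ 2 <= n2 phi.
Proof.
by move=> fp; apply: (@tot_term _ (fun n => phi n ^+ 2)); [exact: finsupp_sqr|move=> m; exact: sqr_ge0].
Qed.

Lemma n2Z c phi : finsupp phi -> n2 (fun n => c * phi n) = c ^+ 2 * n2 phi.
Proof.
move=> fp; rewrite /n2 -totZ; last exact: finsupp_sqr.
by congr tot; apply: funext => n; rewrite exprMn.
Qed.

Lemma n2BZ c phi psi : finsupp phi -> finsupp psi ->
  n2 (fun n => phi n - c * psi n) = n2 phi - 2 * c * ip phi psi + c ^+ 2 * n2 psi.
Proof.
move=> fp fs; have h1 := finsupp_sqr fp; have h2 := finsupp_sqr fs.
have h3 : finsupp (fun n => phi n * psi n) by apply: (finsuppZ phi).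
have h4 := finsuppZ (fun=> 2 * c) h3; have h5 := finsuppZ (fun=> c ^+ 2) h2.
rewrite /n2 /ip -(totZ _ h3) -(totZ _ h2) -totB// -totD//; last exact: finsuppB.
by congr tot; apply: funext => n; ring.
Qed.

Lemma n2D_le phi psi : finsupp phi -> finsupp psi ->
  n2 (fun n => phi n + psi n) <= 2 * n2 phi + 2 * n2 psi.
Proof.
move=> fp fs; have h1 := finsupp_sqr fp; have h2 := finsupp_sqr fs.
have h3 := finsuppZ (fun=> 2) h1; have h4 := finsuppZ (fun=> 2) h2.
rewrite /n2 -(totZ _ h1) -(totZ _ h2) -totD//.
apply: tot_le.
- by apply: finsupp_sqr; apply: finsuppD.
- by apply: finsuppD; exact: (finsuppZ (fun=> 2)).
- by move=> n; have := sqr_ge0 (phi n - psi n); rewrite !expr2; lra.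
Qed.

Lemma n2_shift phi (a : int) : finsupp phi -> n2 (fun n => phi (n + a)) = n2 phi.
Proof.
by move=> fp; apply: (@tot_shift _ (fun n => phi n ^+ 2)); exact: finsupp_sqr.
Qed.

(** The square of a sum of three terms is at most three times the sum of their squares; the two
    shifts preserve the norm and give 6, the potential gives [3 * M ^+ 2]. *)
Lemma n2_jacobi M phi : (forall n, `|V n| <= M) -> finsupp phi ->
  n2 (jacobi V phi) <= (6 + 3 * M ^+ 2) * n2 phi.
Proof.
move=> hV fp; have h := finsupp_sqr fp.
have fs (a : int) : finsupp (fun n => phi (n + a) ^+ 2).
  by apply: (@finsupp_shift _ (fun n => phi n ^+ 2)).
have h1 := finsuppZ (fun=> 3) (fs (- 1)); have h2 := finsuppZ (fun=> 3) (fs 1).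
have h3 := finsuppZ (fun=> 3 * M ^+ 2) h.
have -> : (6 + 3 * M ^+ 2) * n2 phi =
   (3 * n2 phi + 3 * n2 phi) + (3 * M ^+ 2) * n2 phi by ring.
rewrite -{1}(n2_shift (- 1) fp) -{1}(n2_shift 1 fp) /n2.
rewrite -(totZ _ (fs (- 1))) -(totZ _ (fs 1)) -(totZ _ h) -totD// -totD//; last exact: finsuppD.
apply: tot_le.
- by apply: finsupp_sqr; apply: finsupp_jacobi.
- apply: finsuppD; last exact: (finsuppZ (fun=> 3 * M ^+ 2)).
  by apply: finsuppD; exact: (finsuppZ (fun=> 3)).
- move=> n; rewrite /jacobi.
  have hVn : V n ^+ 2 <= M ^+ 2.
    rewrite -(real_normK (num_real (V n))) lerXn2r// ?nnegrE//.
    exact: le_trans (hV n).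
  apply: (@le_trans _ _ (3 * phi (n - 1) ^+ 2 + 3 * phi (n + 1) ^+ 2 + 3 * (V n * phi n) ^+ 2)).
    have := sqr_ge0 (phi (n - 1) - phi (n + 1)).
    have := sqr_ge0 (phi (n - 1) - V n * phi n).
    have := sqr_ge0 (phi (n + 1) - V n * phi n).
    by rewrite !expr2; lra.
  by rewrite lerD2l exprMn mulrA ler_wpM2r ?sqr_ge0// ler_wpM2l.
Qed.

End RealJacobi.

Definition winseq (N : nat) : seq int := [seq i%:Z - N%:Z | i <- iota 0 N.*2.+1].

(** * Finite windows and square-summable complex sequences *)

Section Mass.
Variable R : realType.
Implicit Types (a : int -> R) (psi : int -> R[i]).

Lemma window_seq N a :
  window N a = \sum_(n <- winseq N) a n.
Proof.
by rewrite /winseq big_map /window -(big_mkord xpredT (fun i => a (i%:Z - N%:Z))) /index_iota subn0.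
Qed.

Lemma uniq_window N : uniq (winseq N).
Proof. by rewrite /winseq map_inj_uniq ?iota_uniq// => i j /= h; lia. Qed.

Lemma mem_window N (n : int) : (absz n <= N)%N ->
  n \in winseq N.
Proof.
move=> h; apply/mapP; exists (absz (n + N%:Z)); last by lia.
by rewrite mem_iota; lia.
Qed.

Lemma window_fsbig N a :
  (window N a)%:E =
  (\sum_(n \in [set` winseq N]) (a n)%:E)%E.
Proof. by rewrite window_seq -fsbig_seq ?uniq_window// sumEFin. Qed.

Lemma window_le_esum N a : ((window N a)%:E <= \esum_(n in [set: int]) (a n)%:E)%E.
Proof.
apply: esum_ge; exists [set` winseq N].
  by split => //; exact: finite_seq.
by rewrite window_fsbig.
Qed.

Lemma esum_le_window C a : (forall n, 0 <= a n) ->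
  (forall N, window N a <= C) -> (\esum_(n in [set: int]) (a n)%:E <= C%:E)%E.
Proof.
move=> a0 h; apply: ge_ereal_sup => _ [X [finX _] <-].
have [N hN] : exists N, X `<=` [set` winseq N].
  have /finite_seqP[s ->] := finX.
  exists (\max_(n <- s) absz n)%N => n /= ns; apply: mem_window.
  exact: (@leq_bigmax_seq _ _ predT (fun n => absz n)).
apply: (le_trans _ (_ : (window N a)%:E <= C%:E)%E); last by rewrite lee_fin.
rewrite window_fsbig; apply: lee_fsum_nneg_subset => //.
- exact: finite_seq.
- by move=> n; rewrite !inE => /hN.
- by move=> n _; rewrite lee_fin.
Qed.

Definition msq psi : int -> R := fun n => normc (psi n) ^+ 2.

Lemma msq_ge0 psi n : 0 <= msq psi n. Proof. exact: sqr_ge0. Qed.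

Lemma l2_mass_ge0 psi : (0 <= l2_mass psi)%E.
Proof. by apply: esum_ge0 => n _; rewrite lee_fin sqr_ge0. Qed.

Lemma l2_mass_finE psi : l2 psi -> l2_mass psi = (fine (l2_mass psi))%:E.
Proof. by move=> h; rewrite fineK// ge0_fin_numE// l2_mass_ge0. Qed.

Lemma window_le_mass N psi : l2 psi -> window N (msq psi) <= fine (l2_mass psi).
Proof. by move=> h; rewrite -lee_fin -l2_mass_finE//; exact: window_le_esum. Qed.

Lemma mass_le_window C psi : (forall N, window N (msq psi) <= C) ->
  l2 psi /\ fine (l2_mass psi) <= C.
Proof.
move=> h; have h1 : (l2_mass psi <= C%:E)%E.
  by apply: esum_le_window h => n; exact: sqr_ge0.
have h2 : l2 psi by apply: le_lt_trans h1 _; rewrite ltry.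
by split => //; rewrite -lee_fin -l2_mass_finE.
Qed.

Definition n2c psi : R := tot (msq psi).

Lemma finsupp_msq psi : finsupp psi -> finsupp (msq psi).
Proof.
by apply: (finsupp_comp (h := fun _ x => normc x ^+ 2)) => n; rewrite normc0 expr0n.
Qed.

Lemma finsupp_l2 psi : finsupp psi -> l2 psi /\ fine (l2_mass psi) = n2c psi.
Proof.
move=> fp; have [N sN] := finsupp_msq fp.
have h N' : window N' (msq psi) <= n2c psi.
  rewrite /n2c (totE sN); case: (leqP N N') => h; first by rewrite (window_supported sN).
  by apply: window_nondecr; [exact: msq_ge0|exact: ltnW].
have [h1 h2] := mass_le_window h; split => //.
by apply/eqP; rewrite eq_le h2 /= /n2c (totE sN) window_le_mass.
Qed.

Lemma normc_real (x : R) : normc x%:C ^+ 2 = x ^+ 2.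
Proof. by rewrite /normc /= expr0n /= addr0 sqr_sqrtr// sqr_ge0. Qed.

Lemma n2c_real (phi : int -> R) : n2c (fun n => (phi n)%:C) = n2 phi.
Proof. by congr tot; apply: funext => n; rewrite /msq normc_real. Qed.

(* A bounded inverse of [H - E] bounds [H - E] from below, already on finitely supported sequences. *)
Lemma notin_spectrum_bound (V : int -> R[i]) E : ~ l2_spectrum (jacobi V) E ->
  exists2 c, 0 < c & forall psi, finsupp psi ->
    c * n2c psi <= n2c (fun n => jacobi V psi n - E * psi n).
Proof.
move=> /contrapT [B [[_ _ [M hM]] hB]].
exists (1 + M ^+ 2)^-1; first by rewrite invr_gt0; have := sqr_ge0 M; lra.
move=> psi fp; set T := fun n => _.
have fT : finsupp T by apply: finsuppB; [exact: finsupp_jacobi|exact: finsuppZ].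
have [l2p Ep] := finsupp_l2 fp; have [l2T ET] := finsupp_l2 fT.
have [_ BT] := hB _ l2p.
have := hM _ l2T; rewrite -/T in BT; rewrite BT /l2_norm Ep ET => h.
have n0 (phi : int -> R[i]) : 0 <= n2c phi by apply: tot_ge0 => n; exact: sqr_ge0.
have h' : n2c psi <= M ^+ 2 * n2c T.
  rewrite -[leLHS]sqr_sqrtr// -[n2c T]sqr_sqrtr// -exprMn lerXn2r// nnegrE ?sqrtr_ge0//.
  exact: le_trans (sqrtr_ge0 _) h.
rewrite ler_pdivrMl; last by have := sqr_ge0 M; lra.
by rewrite mulrDl mul1r; have := n0 T; lra.
Qed.

End Mass.

(** Square-summability with total at most [C], expressed by finite windows so that cut-offs and
    entrywise limits reduce to finite sums. *)
Definition bounded_mass (R : realType) (C : R) (y : int -> R) : Prop :=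
  forall N, window N (fun n => y n ^+ 2) <= C.

Section BoundedMass.
Variable R : realType.
Implicit Types y x : int -> R.

Lemma eq_window N (f g : int -> R) :
  (forall n, (`|n| <= N%:Z)%R -> f n = g n) -> window N f = window N g.
Proof. by move=> h; apply: eq_bigr => i _; apply: h; have := ltn_ord i; lia. Qed.

Lemma window_le_tot N (f : int -> R) : finsupp f -> (forall n, 0 <= f n) ->
  window N f <= tot f.
Proof.
move=> [N' sf] f0; rewrite (totE sf); case: (leqP N N') => h.
  exact: window_nondecr.
by rewrite (window_supported sf)// ltnW.
Qed.

(** By locality [y] can be cut off outside the window of radius [N + d] without changing [A y] on
    the window of radius [N]; the bound for finitely supported sequences then applies. *)
Lemma bounded_mass_local (A : (int -> R) -> int -> R) (d : nat) kappa C y :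
  (forall y y' n, (forall m, (`|m - n| <= d%:Z)%R -> y m = y' m) -> A y n = A y' n) ->
  (forall phi, finsupp phi -> finsupp (A phi)) ->
  (forall phi, finsupp phi -> n2 (A phi) <= kappa * n2 phi) ->
  0 <= kappa -> bounded_mass C y -> bounded_mass (kappa * C) (A y).
Proof.
move=> loc fA nA k0 hy N.
pose y' n := if (`|n| <= (N + d)%N%:Z)%R then y n else 0.
have sy' : supported (N + d) y' by move=> n hn; rewrite /y' leNgt hn.
have fy' : finsupp y' by exists (N + d)%N.
have -> : window N (fun n => A y n ^+ 2) = window N (fun n => A y' n ^+ 2).
  apply: eq_window => n hn; congr (_ ^+ 2); apply: loc => m hm.
  by rewrite /y'; case: ifP => //; lia.
apply: (le_trans (window_le_tot N _ _)).
- by apply: finsupp_sqr; exact: fA.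
- by move=> n; exact: sqr_ge0.
apply: (le_trans (nA _ fy')); apply: ler_wpM2l => //.
rewrite /n2 (@totE _ (N + d)); last by move=> n hn; rewrite sy'// expr0n.
rewrite (eq_window (g := fun n => y n ^+ 2)) => [|n hn]; first exact: hy.
by rewrite /y' hn.
Qed.

Lemma bounded_mass_term C y n : bounded_mass C y -> y n ^+ 2 <= C.
Proof.
move=> hy; apply: le_trans (hy (absz n)).
by apply: (@window_term _ _ (fun n => y n ^+ 2)) => [m|]; [exact: sqr_ge0|lia].
Qed.

Lemma bounded_mass_ge0 C y : bounded_mass C y -> 0 <= C.
Proof. by move=> /(bounded_mass_term 0); apply: le_trans; exact: sqr_ge0. Qed.

(** Young's inequality. The free parameter [s] allows a factor close to 1 in front of [C'], as the
    contraction argument of [partial_mass] requires. *)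
Lemma bounded_massD s C C' x y : 0 < s ->
  bounded_mass C x -> bounded_mass C' y ->
  bounded_mass ((1 + s^-1) * C + (1 + s) * C') (fun n => x n + y n).
Proof.
move=> s0 hx hy N.
apply: (@le_trans _ _ (window N (fun n => (1 + s^-1) * x n ^+ 2 + (1 + s) * y n ^+ 2))).
  apply: window_le => n; rewrite -subr_ge0.
  have -> : (1 + s^-1) * x n ^+ 2 + (1 + s) * y n ^+ 2 - (x n + y n) ^+ 2 =
     s^-1 * (x n - s * y n) ^+ 2 by field; rewrite gt_eqF.
  by rewrite mulr_ge0 ?sqr_ge0// invr_ge0 ltW.
have i0 : 0 < s^-1 by rewrite invr_gt0.
rewrite windowD !windowZ; apply: lerD; apply: ler_wpM2l; [lra|exact: hx|lra|exact: hy].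
Qed.

Lemma bounded_massZ a C x : bounded_mass C x ->
  bounded_mass (a ^+ 2 * C) (fun n => a * x n).
Proof.
move=> hx N; under [X in window N X]eq_fun do rewrite exprMn.
by rewrite windowZ ler_wpM2l ?sqr_ge0//; exact: hx.
Qed.

Lemma jacobi_local (F : pzRingType) (V : int -> F) (y y' : int -> F) n :
  (forall m, (`|m - n| <= 1)%R -> y m = y' m) -> jacobi V y n = jacobi V y' n.
Proof. by move=> h; rewrite /jacobi !h//; lia. Qed.

Lemma bounded_mass_jacobi V M C y : (forall n, `|V n| <= M) ->
  bounded_mass C y -> bounded_mass ((6 + 3 * M ^+ 2) * C) (jacobi V y).
Proof.
move=> hV; apply: (@bounded_mass_local _ 1) => [||phi fp|].
- by move=> x x' n h; exact: jacobi_local.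
- by move=> phi; exact: finsupp_jacobi.
- exact: n2_jacobi.
- by have := sqr_ge0 M; lra.
Qed.

Lemma jacobiD (F : comPzRingType) (V : int -> F) a (x y : int -> F) :
  jacobi V (fun n => a * x n + y n) = fun n => a * jacobi V x n + jacobi V y n.
Proof. by apply: funext => n; rewrite /jacobi; ring. Qed.

End BoundedMass.

(* Inverts [(H - a)^2 + b^2], for [W = V - a], by a Neumann series whose sum is taken entrywise. *)
Section Neumann.
Variables (R : realType) (W : int -> R) (M b c : R).
Hypothesis hW : forall n, `|W n| <= M.

Let C6 := 6 + 3 * M ^+ 2.
(** Chosen so that [n2 (quad phi)] is at most [kap] times the form [ip (quad phi) phi]. With step
    size [tau = 1 / kap], the map [S], which is the identity minus [tau] times [quad], reduces the
    squared norm by the factor [rho]; the hypothesis [ck] gives [0 <= rho]. *)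
Let kap := 2 * (C6 + b ^+ 2).
Let tau := kap^-1.
Let rho := 1 - tau * c.

Hypothesis c0 : 0 < c.
Hypothesis ck : c <= kap.
Hypothesis hlow : forall phi, finsupp phi ->
  c * n2 phi <= n2 (jacobi W phi) + b ^+ 2 * n2 phi.

Definition quad (y : int -> R) : int -> R :=
  fun n => jacobi W (jacobi W y) n + b ^+ 2 * y n.
Let S y : int -> R := fun n => y n - tau * quad y n.

Let C60 : 0 < C6. Proof. by rewrite /C6; have := sqr_ge0 M; lra. Qed.
Let kap0 : 0 < kap. Proof. by rewrite /kap; have := sqr_ge0 b; have := C60; lra. Qed.
Let tau0 : 0 < tau. Proof. by rewrite invr_gt0 kap0. Qed.
Let rho0 : 0 <= rho. Proof. by rewrite subr_ge0 mulrC ler_pdivrMr ?mul1r ?kap0. Qed.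
Let rho1 : rho < 1.
Proof. by rewrite /rho; have := mulr_gt0 tau0 c0; lra. Qed.

Let finsupp_quad phi : finsupp phi -> finsupp (quad phi).
Proof.
move=> fp; apply: finsuppD; last exact: (finsuppZ (fun=> b ^+ 2)).
by apply: finsupp_jacobi; apply: finsupp_jacobi.
Qed.

Let ip_quad phi : finsupp phi ->
  ip (quad phi) phi = n2 (jacobi W phi) + b ^+ 2 * n2 phi.
Proof.
move=> fp; have fJ := finsupp_jacobi W fp; have fJJ := finsupp_jacobi W fJ.
rewrite !n2E -(ip_jacobi W fJ fp) /ip -totZ; last exact: (finsuppZ phi).
rewrite -totD.
- by congr tot; apply: funext => n; rewrite /quad; ring.
- exact: (finsuppZ (jacobi W (jacobi W phi))).
- by apply: (finsuppZ (fun=> b ^+ 2)); exact: (finsuppZ phi).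
Qed.

(** Write [q] for the form [ip (quad phi) phi]. Expanding the square gives [n2 phi - 2 * tau * q +
    tau ^+ 2 * n2 (quad phi)]; the last term is at most [tau * q] by the choice of [tau], and [q] is
    at least [c * n2 phi]. *)
Let n2_S phi : finsupp phi -> n2 (S phi) <= rho * n2 phi.
Proof.
move=> fp; have fJ := finsupp_jacobi W fp; have fJJ := finsupp_jacobi W fJ.
have fb := finsuppZ (fun=> b ^+ 2) fp.
have ipC : ip phi (quad phi) = ip (quad phi) phi.
  by congr tot; apply: funext => n; rewrite mulrC.
rewrite /S n2BZ//; last exact: finsupp_quad.
rewrite ipC; set q := ip _ _.
have qE : q = n2 (jacobi W phi) + b ^+ 2 * n2 phi by exact: ip_quad.
have h1 : n2 (quad phi) <= kap * q.
  apply: (le_trans (n2D_le fJJ fb)); rewrite n2Z//.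
  have := n2_jacobi hW fJ; rewrite -/C6 => h; rewrite /kap qE.
  have := mulr_ge0 (sqr_ge0 b) (n2_ge0 (jacobi W phi)).
  have := mulr_ge0 (ltW C60) (mulr_ge0 (sqr_ge0 b) (n2_ge0 phi)).
  by move: h; lra.
have h2 : tau ^+ 2 * n2 (quad phi) <= tau * q.
  rewrite expr2 -mulrA ler_pM2l ?tau0// mulrC ler_pdivrMr ?kap0//.
  by rewrite [q * _]mulrC.
have h3 : tau * (c * n2 phi) <= tau * q by rewrite ler_pM2l ?tau0// qE hlow.
by move: h2 h3; rewrite /rho; lra.
Qed.

Let S_mass C y : bounded_mass C y -> bounded_mass (rho * C) (S y).
Proof.
apply: (@bounded_mass_local _ _ 2) => // [x x' n h|phi fp].
  have E : jacobi W (jacobi W x) n = jacobi W (jacobi W x') n.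
    by do 2 (apply: jacobi_local => ? ?); apply: h; lia.
  by rewrite /S /quad E (h n)//; lia.
by apply: finsuppB => //; apply: (finsuppZ (fun=> tau)); exact: finsupp_quad.
Qed.

Let iterS_mass C y k : bounded_mass C y -> bounded_mass (rho ^+ k * C) (iter k S y).
Proof.
move=> hy; elim: k => [|k IH]; first by rewrite mul1r.
by rewrite exprS -mulrA iterS; exact: S_mass.
Qed.

Let iterS_bound C y k n : bounded_mass C y ->
  `|iter k S y n| <= Num.sqrt C * Num.sqrt rho ^+ k.
Proof.
move=> hy; have C0 := bounded_mass_ge0 hy.
rewrite -(@ler_pXn2r _ 2)// ?nnegrE ?mulr_ge0 ?exprn_ge0 ?sqrtr_ge0//.
rewrite real_normK ?num_real// exprMn -exprM mulnC exprM !sqr_sqrtr// mulrC.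
exact: bounded_mass_term (iterS_mass k hy).
Qed.

Let sqrt_rho1 : `|Num.sqrt rho| < 1.
Proof. by rewrite ger0_norm// -sqrtr1 ltr_sqrt. Qed.

Definition resolvent_term y n : R ^nat := fun k => tau * iter k S y n.
Definition quad_inv y : int -> R := fun n => limn (series (resolvent_term y n)).

Let quad_inv_cvg C y n : bounded_mass C y -> cvgn (series (resolvent_term y n)).
Proof.
move=> hy; apply: normed_cvg.
apply: (@series_le_cvg _ _ (geometric (tau * Num.sqrt C) (Num.sqrt rho))) => //=.
- by move=> k; rewrite !mulr_ge0 ?exprn_ge0 ?(ltW tau0).
- move=> k; rewrite /resolvent_term /geometric/= normrM (gtr0_norm tau0) -mulrA ler_pM2l ?tau0//.
  exact: iterS_bound.
- exact: is_cvg_geometric_series.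
Qed.

Let iterS_cvg C y n : bounded_mass C y -> (fun k => iter k S y n) @ \oo --> (0 : R).
Proof.
move=> hy; apply/norm_cvg0P.
apply: (@squeeze_cvgr _ _ _ _ (cst 0) (geometric (Num.sqrt C) (Num.sqrt rho))).
- by apply: nearW => k; rewrite normr_ge0 /=; exact: iterS_bound.
- exact: cvg_cst.
- exact: cvg_geometric.
Qed.

Let quadD a x y : quad (fun n => a * x n + y n) = fun n => a * quad x n + quad y n.
Proof. by apply: funext => n; rewrite /quad !jacobiD; ring. Qed.

Let SD a x y : S (fun n => a * x n + y n) = fun n => a * S x n + S y n.
Proof. by apply: funext => n; rewrite /S quadD; ring. Qed.

Let iterSD k a x y :
  iter k S (fun n => a * x n + y n) = fun n => a * iter k S x n + iter k S y n.
Proof. by elim: k => // k IH; rewrite !iterS IH SD. Qed.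

Lemma quad_invD C C' a x y : bounded_mass C x -> bounded_mass C' y ->
  quad_inv (fun n => a * x n + y n) = fun n => a * quad_inv x n + quad_inv y n.
Proof.
move=> hx hy; apply: funext => n; rewrite /quad_inv.
have hx' := quad_inv_cvg (n := n) hx; have hy' := quad_inv_cvg (n := n) hy.
apply: cvg_lim => //.
rewrite (_ : series _ = (fun K => a * series (resolvent_term x n) K
                           + series (resolvent_term y n) K)).
  by apply: cvgD => //; apply: cvgMl_tmp.
apply: funext => K; rewrite /series /= mulr_sumr -big_split /=.
by apply: eq_bigr => k _; rewrite /resolvent_term iterSD; ring.
Qed.

Let partial y K : int -> R := fun n => series (resolvent_term y n) K.

(** Horner form of the Neumann sum. It turns the mass bound into a recursion with a contracting
    part, whereas adding the terms one by one would not keep the bound fixed. *)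
Let partialS y K : partial y K.+1 = fun n => tau * y n + S (partial y K) n.
Proof.
have E : partial y K.+1 = fun n => tau * iter K S y n + partial y K n.
  by apply: funext => n; rewrite /partial seriesSr /= addrC.
elim: K E => [|K IH] E.
  rewrite E; apply: funext => n; rewrite /partial/= /series/= big_nil addr0.
  rewrite (_ : S _ n = 0) ?addr0// /S /quad /jacobi !big_geq//; ring.
have E' : partial y K.+1 = fun n => tau * iter K S y n + partial y K n.
  by apply: funext => n; rewrite /partial seriesSr /= addrC.
rewrite E; apply: funext => n.
rewrite {2}E' SD -iterS IH//; ring.
Qed.

(** The fixed point of that recursion: with [s = (1 - rho) / 2] in [bounded_massD] one has
    [(1 + s) * rho <= (1 + rho) / 2], so the bound reproduces itself once the contribution of
    [tau * y] equals [(1 - rho) / 2] times the bound. *)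
Let kappa := ((1 + ((1 - rho) / 2)^-1) * tau ^+ 2) * (2 / (1 - rho)).

Let partial_mass C y K : bounded_mass C y -> bounded_mass (kappa * C) (partial y K).
Proof.
move=> hy; have C0 := bounded_mass_ge0 hy.
have r1 : 0 < 1 - rho by rewrite subr_gt0.
have i1 : 0 < ((1 - rho) / 2)^-1 by rewrite invr_gt0 divr_gt0.
have k0 : 0 <= kappa * C.
  rewrite /kappa mulr_ge0// mulr_ge0//; last by rewrite divr_ge0// ltW.
  by rewrite mulr_ge0 ?sqr_ge0// addr_ge0// ltW.
elim: K => [|K IH].
  move=> N; rewrite /window big1// => i _.
  by rewrite /partial /series /= big_geq// expr0n.
rewrite partialS => N.
have s0 : 0 < (1 - rho) / 2 by rewrite divr_gt0.
apply: (le_trans (bounded_massD s0 (bounded_massZ tau hy) (S_mass IH) N)).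
set A := (1 + _^-1) * (_ * C).
have EA : kappa * C = A * (2 / (1 - rho)) by rewrite /kappa /A; ring.
have A0 : 0 <= A by rewrite /A mulr_ge0//; [rewrite addr_ge0// ltW|rewrite mulr_ge0// sqr_ge0].
have h1 : (1 + (1 - rho) / 2) * rho <= (1 + rho) / 2.
  by have := mulr_ge0 (ltW r1) (ltW r1); move: rho1; lra.
have : (1 + (1 - rho) / 2) * (rho * (kappa * C)) <= (1 + rho) / 2 * (kappa * C).
  by rewrite mulrA ler_wpM2r.
have : A + (1 + rho) / 2 * (kappa * C) = kappa * C.
  by rewrite EA; field; rewrite gt_eqF.
lra.
Qed.

Lemma quad_inv_mass C y : bounded_mass C y -> bounded_mass (kappa * C) (quad_inv y).
Proof.
move=> hy N.
have h : (fun K => window N (fun n => partial y K n ^+ 2)) @ \oo -->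
   window N (fun n => quad_inv y n ^+ 2).
  rewrite /window; apply: cvg_big => /=.
    exact: add_continuous.
  move=> i _; rewrite expr2; under eq_fun do rewrite expr2.
  by apply: cvgM; exact: (quad_inv_cvg hy).
rewrite -(cvg_lim _ h)//; apply: limr_le; first exact: cvgP h.
by apply: nearW => K; exact: partial_mass.
Qed.

Let quad_partial y K : quad (partial y K) = fun n => y n - iter K S y n.
Proof.
elim: K => [|K IH].
  apply: funext => n; rewrite /quad /jacobi /partial /series /= !big_geq//; ring.
have -> : partial y K.+1 = fun n => tau * iter K S y n + partial y K n.
  by apply: funext => n; rewrite /partial seriesSr /= addrC.
rewrite quadD IH; apply: funext => n; rewrite iterS /S; ring.
Qed.

Let cvg_quad (u : nat -> int -> R) w n : (forall m, (fun K => u K m) @ \oo --> w m) ->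
  (fun K => quad (u K) n) @ \oo --> quad w n.
Proof.
have cvg_jacobi (u' : nat -> int -> R) w' m : (forall m, (fun K => u' K m) @ \oo --> w' m) ->
  (fun K => jacobi W (u' K) m) @ \oo --> jacobi W w' m.
  by move=> h; apply: cvgD; [apply: cvgD; exact: h|apply: cvgMl_tmp; exact: h].
by move=> h; apply: cvgD; [do 2 (apply: (cvg_jacobi) => ?); exact: h|apply: cvgMl_tmp; exact: h].
Qed.

Lemma quad_invK C y : bounded_mass C y -> quad (quad_inv y) = y.
Proof.
move=> hy; apply: funext => n.
have h1 : (fun K => quad (partial y K) n) @ \oo --> quad (quad_inv y) n.
  by apply: cvg_quad => m; exact: (quad_inv_cvg hy).
have h2 : (fun K => quad (partial y K) n) @ \oo --> y n.
  under eq_fun do rewrite quad_partial.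
  suff : (fun K => y n - iter K S y n) @ \oo --> y n - 0 by rewrite subr0.
  by apply: cvgB; [exact: cvg_cst|exact: iterS_cvg hy].
exact: (cvg_unique _ h1 h2).
Qed.

Let iterS_quad k x : iter k S (quad x) = quad (iter k S x).
Proof.
elim: k => // k IH; rewrite !iterS IH; apply: funext => n.
have -> : S (iter k S x) = fun n => - tau * quad (iter k S x) n + iter k S x n.
  by apply: funext => m; rewrite /S; ring.
by rewrite quadD /S; ring.
Qed.

Lemma quadK C x : bounded_mass C x -> quad_inv (quad x) = x.
Proof.
move=> hx; apply: funext => n; apply: cvg_lim => //.
rewrite (_ : series _ = fun K => x n - iter K S x n).
  rewrite -[X in _ --> X](subr0 (x n)); apply: cvgB; first exact: cvg_cst.
  exact: iterS_cvg hx.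
apply: funext; elim=> [|K IH]; first by rewrite /series/= big_geq// subrr.
by rewrite seriesSr IH /resolvent_term iterS_quad iterS /S; ring.
Qed.

End Neumann.

(* By [sigma_spec] below the spectrum consists of these points: finitely supported real sequences
   suffice as approximate eigenvectors. *)
Definition approx_point (R : realType) (V : int -> R) (x : R) : Prop :=
  forall c, 0 < c -> exists phi, finsupp phi /\
    n2 (jacobi (fun n => V n - x) phi) < c * n2 phi.

(** * The resolvent at a complex point and the description of the spectrum *)

Section Spectrum.
Variables (R : realType) (V : int -> R) (M0 : R).
Hypothesis hV : forall n, `|V n| <= M0.
Implicit Types (r s : int -> R) (psi : int -> R[i]).

Let VC : int -> R[i] := fun n => (V n)%:C.
Definition cplx r s : int -> R[i] := fun n => (r n +i* s n)%C.

Let rpart psi : int -> R := fun n => complex.Re (psi n).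
Let ipart psi : int -> R := fun n => complex.Im (psi n).

Let cplxK psi : cplx (rpart psi) (ipart psi) = psi.
Proof. by apply: funext => n; rewrite /cplx /rpart /ipart; case: (psi n). Qed.

Let msqE psi n : msq psi n = rpart psi n ^+ 2 + ipart psi n ^+ 2.
Proof.
rewrite /msq /rpart /ipart /normc; case: (psi n) => x y /=.
by rewrite sqr_sqrtr// addr_ge0// sqr_ge0.
Qed.

Lemma jacobi_cplx r s a b :
  (fun n => jacobi VC (cplx r s) n - (a +i* b)%C * cplx r s n) =
  cplx (fun n => jacobi (fun n => V n - a) r n + b * s n)
       (fun n => jacobi (fun n => V n - a) s n - b * r n).
Proof.
apply: funext => n; rewrite /jacobi /cplx /VC; apply/eqP; rewrite eq_complex /=.
by apply/andP; split; apply/eqP; ring.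
Qed.

(** On a real sequence [H - (a + ib)] has real part [(H - a) phi] and imaginary part [- b * phi], so
    the two squared norms add up. *)
Lemma real_bound_of_notin a b : ~ l2_spectrum (jacobi VC) (a +i* b)%C ->
  exists2 c, 0 < c & forall phi, finsupp phi ->
    c * n2 phi <= n2 (jacobi (fun n => V n - a) phi) + b ^+ 2 * n2 phi.
Proof.
move=> /notin_spectrum_bound [c c0 hc]; exists c => // phi fp.
have fC : finsupp (cplx phi (fun=> 0)).
  by apply: (finsupp_comp (h := fun _ x => (x +i* 0)%C)).
have := hc _ fC; rewrite jacobi_cplx.
have E r s : msq (cplx r s) = fun n => r n ^+ 2 + s n ^+ 2.
  by apply: funext => n; rewrite msqE.
rewrite /n2c !E; under [X in tot X]eq_fun do rewrite expr0n addr0.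
rewrite /n2 => h; apply: (le_trans h).
rewrite -totZ; last exact: finsupp_sqr.
rewrite -totD.
- rewrite le_eqVlt; apply/orP; left; apply/eqP; congr tot; apply: funext => n.
  by rewrite /jacobi; ring.
- by apply: finsupp_sqr; exact: finsupp_jacobi.
- by apply: (finsuppZ (fun=> b ^+ 2)); exact: finsupp_sqr.
Qed.

(** With [J = H - a] and [G] the inverse of [J^2 + b^2], the resolvent at [a + ib] is [(J + ib) G],
    because [(J - ib) (J + ib) = J^2 + b^2]. It is written out on real and imaginary parts, since
    [G] acts on real sequences. *)
Lemma notin_of_real_bound a b c : 0 < c ->
  (forall phi, finsupp phi ->
    c * n2 phi <= n2 (jacobi (fun n => V n - a) phi) + b ^+ 2 * n2 phi) ->
  ~ l2_spectrum (jacobi VC) (a +i* b)%C.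
Proof.
set W := fun n => V n - a.
set M := M0 + `|a|.
have hW n : `|W n| <= M.
  by rewrite /W (le_trans (ler_normB _ _))// lerD.
move=> c0; set kap := 2 * (6 + 3 * M ^+ 2 + b ^+ 2).
have kap0 : 0 < kap by rewrite /kap; have := sqr_ge0 M; have := sqr_ge0 b; lra.
(* Lowering [c] preserves the assumed bound and makes the contraction factor of the Neumann series
   nonnegative. *)
wlog ck : c c0 / c <= kap => [wl hlow|hlow].
  apply: (wl (Num.min c kap)); first by rewrite lt_min c0.
    by rewrite ge_min lexx orbT.
  move=> phi fp; apply: (le_trans _ (hlow _ fp)).
  by rewrite ler_wpM2r ?n2_ge0// ge_min lexx.
pose G := quad_inv W M b.
have [k hk] : exists k, forall C y, bounded_mass C y -> bounded_mass (k * C) (G y).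
  by eexists => C y; exact: (@quad_inv_mass _ _ _ _ c hW c0 ck hlow).
have k0 : 0 <= k.
  have h1 : bounded_mass 1 (fun=> 0 : R).
    by move=> N; rewrite /window big1// => i _; rewrite expr0n.
  by have := bounded_mass_ge0 (hk _ _ h1); rewrite mulr1.
have GK C y : bounded_mass C y -> quad W b (G y) = y.
  exact: (@quad_invK _ _ _ _ c hW c0 ck hlow).
have KG C y : bounded_mass C y -> G (quad W b y) = y.
  exact: (@quadK _ _ _ _ c hW c0 ck hlow).
have GD C C' t x y : bounded_mass C x -> bounded_mass C' y ->
    G (fun n => t * x n + y n) = fun n => t * G x n + G y n.
  exact: (@quad_invD _ _ _ _ c hW c0 ck hlow).
have Jm C y : bounded_mass C y -> bounded_mass ((6 + 3 * M ^+ 2) * C) (jacobi W y).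
  exact: bounded_mass_jacobi.
pose J := jacobi W.
have quadE y : quad W b y = fun n => J (J y) n + b ^+ 2 * y n by [].
have JD t x y : J (fun n => t * x n + y n) = fun n => t * J x n + J y n by exact: jacobiD.
(* [G] commutes with [J]: substitute [quad (G y)] for [y] and use that [J] commutes with [quad].
   This makes [B] a left inverse as well as a right inverse. *)
have GJ C y : bounded_mass C y -> G (J y) = J (G y).
  move=> hy; rewrite -{1}(GK _ _ hy) quadE.
  have -> : J (fun n => J (J (G y)) n + b ^+ 2 * G y n) = quad W b (J (G y)).
    have -> : (fun n => J (J (G y)) n + b ^+ 2 * G y n) =
       fun n => b ^+ 2 * G y n + J (J (G y)) n by apply: funext => n; rewrite addrC.
    by rewrite JD quadE; apply: funext => n; rewrite addrC.
  by apply: KG; apply: Jm; apply: hk hy.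
have mRe psi : l2 psi -> bounded_mass (fine (l2_mass psi)) (rpart psi).
  move=> h N; apply: (le_trans _ (window_le_mass N h)).
  by apply: window_le => n; rewrite msqE lerDl sqr_ge0.
have mIm psi : l2 psi -> bounded_mass (fine (l2_mass psi)) (ipart psi).
  move=> h N; apply: (le_trans _ (window_le_mass N h)).
  by apply: window_le => n; rewrite msqE lerDr sqr_ge0.
pose B psi := cplx (fun n => J (G (rpart psi)) n + - b * G (ipart psi) n)
                   (fun n => J (G (ipart psi)) n + b * G (rpart psi) n).
set K := 2 * ((1 + 1^-1) * ((6 + 3 * M ^+ 2) * k) + (1 + 1) * (b ^+ 2 * k)).
have K0 : 0 <= K.
  have := mulr_ge0 (sqr_ge0 M) k0; have := mulr_ge0 (sqr_ge0 b) k0.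
  by rewrite /K invr1; move: k0; lra.
have mB psi : l2 psi -> l2 (B psi) /\ fine (l2_mass (B psi)) <= K * fine (l2_mass psi).
  move=> h; apply: mass_le_window => N; set C := fine _.
  have h1 := hk _ _ (mRe _ h); have h2 := hk _ _ (mIm _ h).
  have h3 := bounded_massD ltr01 (Jm _ _ h1) (bounded_massZ (- b) h2) N.
  have h4 := bounded_massD ltr01 (Jm _ _ h2) (bounded_massZ b h1) N.
  apply: (@le_trans _ _ (window N (fun n => (J (G (rpart psi)) n + - b * G (ipart psi) n) ^+ 2) +
    window N (fun n => (J (G (ipart psi)) n + b * G (rpart psi) n) ^+ 2))).
    rewrite -windowD; apply: window_le => n; rewrite msqE //.
  apply: (le_trans (lerD h3 h4)); rewrite sqrrN -/C /K le_eqVlt.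
  by apply/orP; left; apply/eqP; ring.
rewrite /l2_spectrum/=; apply; exists B.
have TB z : (fun n => jacobi VC z n - (a +i* b)%C * z n) =
  cplx (fun n => J (rpart z) n + b * ipart z n) (fun n => J (ipart z) n - b * rpart z n).
  by rewrite -[in LHS](cplxK z) jacobi_cplx.
split; first split.
- by move=> psi /mB[].
- move=> t phi psi lphi lpsi.
  have hr := mRe _ lphi; have hi := mIm _ lphi; have hr' := mRe _ lpsi; have hi' := mIm _ lpsi.
  have E1 : G (rpart (fun n => t * phi n + psi n)) =
      fun n => complex.Re t * G (rpart phi) n + (- complex.Im t * G (ipart phi) n + G (rpart psi) n).
    have -> : rpart (fun n => t * phi n + psi n) =
        fun n => complex.Re t * rpart phi n + (fun m => - complex.Im t * ipart phi m + rpart psi m) n.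
      apply: funext => n; rewrite /rpart /ipart.
      by case: t (phi n) (psi n) => [t1 t2] [x1 x2] [y1 y2] /=; ring.
    have hB := bounded_massD ltr01 (bounded_massZ (- complex.Im t) hi) hr'.
    by rewrite (GD _ _ _ _ _ hr hB) (GD _ _ _ _ _ hi hr').
  have E2 : G (ipart (fun n => t * phi n + psi n)) =
      fun n => complex.Re t * G (ipart phi) n + (complex.Im t * G (rpart phi) n + G (ipart psi) n).
    have -> : ipart (fun n => t * phi n + psi n) =
        fun n => complex.Re t * ipart phi n + (fun m => complex.Im t * rpart phi m + ipart psi m) n.
      apply: funext => n; clear E1; rewrite /rpart /ipart.
      by case: t (phi n) (psi n) => [t1 t2] [x1 x2] [y1 y2] /=; ring.
    have hB := bounded_massD ltr01 (bounded_massZ (complex.Im t) hr) hi'.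
    by rewrite (GD _ _ _ _ _ hi hB) (GD _ _ _ _ _ hr hi').
  rewrite /B E1 E2 !JD; clear E1 E2; apply: funext => n; rewrite /cplx.
  apply/eqP; rewrite eq_complex; case: t => t1 t2 /=.
  by apply/andP; split; apply/eqP; ring.
- exists (Num.sqrt K) => psi /mB[_ h]; rewrite /l2_norm -sqrtrM// ler_wsqrtr//.
- move=> psi lpsi; have hr := mRe _ lpsi; have hi := mIm _ lpsi.
  have Er n : rpart psi n = J (J (G (rpart psi))) n + b ^+ 2 * G (rpart psi) n.
    by rewrite -{1}(GK _ _ hr).
  have Es n : ipart psi n = J (J (G (ipart psi))) n + b ^+ 2 * G (ipart psi) n.
    by rewrite -{1}(GK _ _ hi).
  split.
    have eR : rpart (B psi) = fun n => (- b) * G (ipart psi) n + J (G (rpart psi)) n.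
      by apply: funext => m; rewrite /rpart /= addrC.
    have eI : ipart (B psi) = fun n => b * G (rpart psi) n + J (G (ipart psi)) n.
      by apply: funext => m; rewrite /ipart /= addrC.
    rewrite TB -[RHS]cplxK eR eI !JD.
    by congr cplx; apply: funext => n; [rewrite Er|rewrite Es]; ring.
  rewrite TB /B -[RHS]cplxK.
  have E1 : G (fun n => J (rpart psi) n + b * ipart psi n) =
      fun n => b * G (ipart psi) n + J (G (rpart psi)) n.
    rewrite -(GJ _ _ hr) -(GD _ _ _ _ _ hi (Jm _ _ hr)).
    by congr G; apply: funext => n; rewrite addrC.
  have E2 : G (fun n => J (ipart psi) n - b * rpart psi n) =
      fun n => (- b) * G (rpart psi) n + J (G (ipart psi)) n.
    rewrite -(GJ _ _ hi) -(GD _ _ _ _ _ hr (Jm _ _ hi)).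
    by congr G; apply: funext => n; rewrite addrC mulNr.
  have -> : rpart (cplx (fun n => J (rpart psi) n + b * ipart psi n)
    (fun n => J (ipart psi) n - b * rpart psi n)) = fun n => J (rpart psi) n + b * ipart psi n by [].
  have -> : ipart (cplx (fun n => J (rpart psi) n + b * ipart psi n)
    (fun n => J (ipart psi) n - b * rpart psi n)) = fun n => J (ipart psi) n - b * rpart psi n by [].
  rewrite E1 E2 !JD.
  by congr cplx; apply: funext => n; [rewrite Er|rewrite Es]; ring.
Qed.

Lemma spectrum_jacobi :
  l2_spectrum (jacobi VC) = [set x%:C | x in [set x | approx_point V x]].
Proof.
apply/seteqP; split=> [[a b] hE|_ [x /= hx <-]]; last first.
  apply: contrapT => /real_bound_of_notin[c c0 hc].
  have [phi [fp]] := hx _ c0; have := hc _ fp; rewrite expr0n mul0r addr0.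
  by move=> h /(le_lt_trans h); rewrite ltxx.
(* Off the real axis the lower bound holds with [c = b ^+ 2], so the spectrum is real. *)
have b0 : b = 0.
  apply: contrapT => /eqP bn0.
  apply: (@notin_of_real_bound a b (b ^+ 2)) hE; first by rewrite exprn_even_gt0.
  by move=> phi fp; rewrite lerDr n2_ge0.
exists a; last by rewrite b0.
move=> c c0; apply: contrapT => h.
apply: (@notin_of_real_bound a b c c0) hE => phi fp.
rewrite b0 expr0n mul0r addr0 leNgt; apply/negP => hlt; apply: h.
by exists phi.
Qed.

End Spectrum.

Definition poly_act (F : comNzRingType) (V : int -> F) (p : {poly F}) (psi : int -> F) : int -> F :=
  fun n => \sum_(k < size p) p`_k * iter k (jacobi V) psi n.

(** * Polynomials of a Jacobi operator *)

Section PolyAct.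
Variables (F : comNzRingType) (V : int -> F).
Implicit Types (p q : {poly F}) (psi : int -> F).

Lemma poly_act_wide N p psi n : (size p <= N)%N ->
  poly_act V p psi n = \sum_(k < N) p`_k * iter k (jacobi V) psi n.
Proof.
move=> h; rewrite /poly_act (big_ord_widen N (fun k => p`_k * iter k (jacobi V) psi n))//.
rewrite big_mkcond; apply: eq_bigr => k _; case: ltnP => // hk.
by rewrite nth_default ?mul0r.
Qed.

Lemma poly_act0 psi : poly_act V 0 psi = fun=> 0.
Proof. by apply: funext => n; rewrite /poly_act size_poly0 big_ord0. Qed.

Lemma poly_actD p q psi :
  poly_act V (p + q) psi = fun n => poly_act V p psi n + poly_act V q psi n.
Proof.
apply: funext => n; set N := maxn (size p) (size q).
rewrite (@poly_act_wide N) ?size_polyD// (@poly_act_wide N p) ?leq_maxl//.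
rewrite (@poly_act_wide N q) ?leq_maxr// -big_split /=.
by apply: eq_bigr => k _; rewrite coefD mulrDl.
Qed.

Lemma poly_actZ c p psi : poly_act V (c *: p) psi = fun n => c * poly_act V p psi n.
Proof.
apply: funext => n.
rewrite (@poly_act_wide (size p)) ?size_scale_leq// /poly_act mulr_sumr.
by apply: eq_bigr => k _; rewrite coefZ mulrA.
Qed.

Lemma poly_actC c psi : poly_act V c%:P psi = fun n => c * psi n.
Proof.
apply: funext => n; rewrite (@poly_act_wide 1) ?size_polyC_leq1//.
by rewrite big_ord1 coefC.
Qed.

Lemma poly_act_mulX p psi : poly_act V (p * 'X) psi = jacobi V (poly_act V p psi).
Proof.
apply: funext => n; rewrite (@poly_act_wide (size p).+1) ?size_mulX_leq//; last first.
  by have [->|p0] := eqVneq p 0; rewrite ?mul0r ?size_poly0// size_mulX.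
rewrite big_ord_recl coefMX eqxx mul0r add0r /jacobi /poly_act mulr_sumr -!big_split /=.
by apply: eq_bigr => k _; rewrite coefMX /= /jacobi; ring.
Qed.

Lemma poly_actM p q psi : poly_act V (p * q) psi = poly_act V p (poly_act V q psi).
Proof.
elim/poly_ind: p => [|p c IH]; first by rewrite mul0r !poly_act0.
rewrite mulrDl !poly_actD mulrAC !poly_act_mulX IH mul_polyC poly_actZ.
by rewrite poly_actC.
Qed.

Lemma poly_act_XsubC z psi :
  poly_act V ('X - z%:P) psi = fun n => jacobi V psi n - z * psi n.
Proof.
rewrite -[X in X - _]mul1r -[- z%:P]polyCN poly_actD poly_act_mulX !poly_actC.
have -> : (fun n => 1 * psi n) = psi by apply: funext => n; rewrite mul1r.
by apply: funext => n /=; rewrite mulNr.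
Qed.

Lemma finsupp_poly_act p psi : finsupp psi -> finsupp (poly_act V p psi).
Proof.
move=> fp; elim/poly_ind: p => [|p c IH]; first by rewrite poly_act0; exists 0%N.
rewrite poly_actD poly_act_mulX poly_actC; apply: finsuppD; first exact: finsupp_jacobi.
exact: (finsuppZ (fun=> c)).
Qed.

End PolyAct.

Section SpectralRadius.
Variables (R : realType) (V : int -> R) (M : R).
Hypothesis hV : forall n, `|V n| <= M.
Implicit Types (p : {poly R}) (phi : int -> R).

Let VC : int -> R[i] := fun n => (V n)%:C.

Lemma poly_act_complex p phi :
  poly_act VC (map_poly (real_complex R) p) (fun n => (phi n)%:C) =
  fun n => (poly_act V p phi n)%:C.
Proof.
have J (x : int -> R) : jacobi VC (fun n => (x n)%:C) = fun n => (jacobi V x n)%:C.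
  by apply: funext => n; rewrite /jacobi /VC !rmorphD rmorphM.
elim/poly_ind: p => [|p c IH]; first by rewrite rmorph0 !poly_act0.
rewrite rmorphD rmorphM /= map_polyX map_polyC /= !poly_actD !poly_act_mulX IH J !poly_actC.
by apply: funext => n; rewrite [RHS]rmorphD (rmorphM _ c).
Qed.

Lemma ip_poly_act p phi psi : finsupp phi -> finsupp psi ->
  ip (poly_act V p phi) psi = ip phi (poly_act V p psi).
Proof.
elim/poly_ind: p phi psi => [|p c IH] phi psi fp fs.
  rewrite !poly_act0 /ip; congr tot; apply: funext => n; ring.
have fap := finsupp_poly_act V p fp; have fas := finsupp_poly_act V p fs.
have fJ := finsupp_jacobi V fap; have fJs := finsupp_jacobi V fas.
have E1 : ip (poly_act V (p * 'X + c%:P) phi) psi =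
    ip (jacobi V (poly_act V p phi)) psi + c * ip phi psi.
  rewrite poly_actD poly_act_mulX poly_actC /ip -totZ; last exact: (finsuppZ phi).
  rewrite -totD; first by congr tot; apply: funext => n; ring.
    exact: (finsuppZ (jacobi V (poly_act V p phi))).
  by apply: (finsuppZ (fun=> c)); exact: (finsuppZ phi).
have E2 : ip phi (poly_act V (p * 'X + c%:P) psi) =
    ip phi (jacobi V (poly_act V p psi)) + c * ip phi psi.
  rewrite poly_actD poly_act_mulX poly_actC /ip -totZ; last exact: (finsuppZ phi).
  rewrite -totD; first by congr tot; apply: funext => n; ring.
    exact: (finsuppZ phi).
  by apply: (finsuppZ (fun=> c)); exact: (finsuppZ phi).
rewrite E1 E2; congr (_ + _).
rewrite ip_jacobi// IH//; last exact: finsupp_jacobi.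
congr ip; have J1 : jacobi V psi = poly_act V 'X psi.
  rewrite -['X]mul1r poly_act_mulX poly_actC; congr jacobi.
  by apply: funext => n; rewrite mul1r.
by rewrite J1 -poly_actM poly_act_mulX.
Qed.

Lemma n2_poly_act p : exists2 C, 0 <= C & forall phi, finsupp phi ->
  n2 (poly_act V p phi) <= C * n2 phi.
Proof.
elim/poly_ind: p => [|p c [C C0 IH]].
  exists 0 => // phi _; rewrite poly_act0 mul0r /n2 /tot /window big1//.
  by move=> i _; rewrite expr0n.
have M60 : 0 <= 6 + 3 * M ^+ 2 by have := sqr_ge0 M; lra.
exists (2 * ((6 + 3 * M ^+ 2) * C) + 2 * c ^+ 2).
  by rewrite addr_ge0// mulr_ge0 ?sqr_ge0// mulr_ge0.
move=> phi fp; have fap := finsupp_poly_act V p fp.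
rewrite poly_actD poly_act_mulX poly_actC.
apply: (le_trans (n2D_le (finsupp_jacobi V fap) (finsuppZ (fun=> c) fp))).
have := n2_jacobi hV fap.
have : (6 + 3 * M ^+ 2) * n2 (poly_act V p phi) <= (6 + 3 * M ^+ 2) * (C * n2 phi).
  by rewrite ler_wpM2l// IH.
by rewrite n2Z//; lra.
Qed.

Lemma n2c_prod_bound (r : seq R[i]) :
  (forall z, z \in r -> ~ l2_spectrum (jacobi VC) z) ->
  exists2 c, 0 < c & forall psi, finsupp psi ->
    c * n2c psi <= n2c (poly_act VC (\prod_(z <- r) ('X - z%:P)) psi).
Proof.
elim: r => [|z r IH] h.
  exists 1 => // psi _; rewrite big_nil poly_actC mul1r.
  by have -> : (fun n => 1 * psi n) = psi by apply: funext => n; rewrite mul1r.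
have [|c c0 hc] := IH; first by move=> w wr; apply: h; rewrite inE wr orbT.
have [|d d0 hd] := @notin_spectrum_bound _ VC z; first by apply: h; rewrite inE eqxx.
exists (d * c); first exact: mulr_gt0.
move=> psi fp; rewrite big_cons poly_actM poly_act_XsubC.
apply: (le_trans _ (hd _ _)); last exact: finsupp_poly_act.
by rewrite -mulrA ler_pM2l// hc.
Qed.

(* The squared norm [alpha] of [p(H)] makes [p(H)^2 - alpha] not bounded below, so some
   complex root of [p^2 - alpha] lies in the spectrum. *)
Lemma spectral_radius p s phi : (1 < size p)%N -> 0 < s -> finsupp phi -> 0 < n2 phi ->
  s * n2 phi <= n2 (poly_act V p phi) ->
  exists x, approx_point V x /\ s <= p.[x] ^+ 2.
Proof.
move=> p1 s0 fp p0 hs; set A := poly_act V p.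
pose D := [set C | 0 <= C /\ forall phi, finsupp phi -> n2 (A phi) <= C * n2 phi].
pose al := inf D.
have D0 : D !=set0 by have [C C0 hC] := n2_poly_act p; exists C.
have lbD : has_lbound D by exists 0 => C [].
have hal psi : finsupp psi -> n2 (A psi) <= al * n2 psi.
  move=> fs; have [h0|h0] := ltP 0 (n2 psi).
    rewrite -ler_pdivrMr//; apply: lb_le_inf => // C [C0 hC].
    by rewrite ler_pdivrMr// hC.
  have [C [C0 hC]] := D0.
  have n0 : n2 psi = 0 by apply/eqP; rewrite eq_le h0 n2_ge0.
  by have := hC _ fs; rewrite n0 !mulr0.
have sal : s <= al by have := le_trans hs (hal _ fp); rewrite ler_pM2r.
have al0 : 0 < al by exact: lt_le_trans s0 sal.
pose r := p ^+ 2 - al%:P.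
have [rs hrs] := closed_field_poly_normal (map_poly (real_complex R) r).
set rC := map_poly _ r in hrs; set lc := lead_coef rC in hrs.
have [h|] := pselect (forall z, z \in rs -> ~ l2_spectrum (jacobi VC) z); last first.
  move=> /existsNP[z] /not_implyP[zr /contrapT].
  rewrite (spectrum_jacobi hV) => -[x /= hx xz].
  exists x; split => //.
  have : rC.[x%:C] = 0.
    by rewrite hrs hornerZ (rootP (_ : root _ _)) ?mulr0// xz root_prod_XsubC.
  rewrite /rC horner_map /= => /complexI.
  by rewrite /r hornerD hornerN horner_exp hornerC => /eqP; rewrite subr_eq0 => /eqP ->.
have [c c0 hc] := n2c_prod_bound h.
have rE psi : poly_act V r psi = fun n => A (A psi) n - al * psi n.
  by rewrite /r expr2 -polyCN poly_actD poly_actM poly_actC; apply: funext => n; rewrite mulNr.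
have lc0 : lc != 0.
  rewrite lead_coef_eq0 map_poly_eq0 subr_eq0; apply/negP => /eqP pE.
  by have := size_exp p 2; rewrite pE size_polyC; move: p1; case: (size p) => [//|[//|k]] _; case: (al != 0); rewrite mulnC /=.
have n20 (z : R[i]) : z != 0 -> 0 < normc z ^+ 2.
  by move=> z0; rewrite exprn_even_gt0//=; apply: contra z0 => /eqP/eq0_normc ->.
have hc' psi : finsupp psi -> c * normc lc ^+ 2 * n2 psi <= n2 (poly_act V r psi).
  move=> fs; rewrite -!n2c_real -poly_act_complex -/rC hrs poly_actZ.
  have fsC : finsupp (fun n => (psi n)%:C) by exact: (finsupp_comp (h := fun _ x => x%:C)).
  have fac := finsupp_poly_act VC (\prod_(z <- rs) ('X - z%:P)) fsC.
  have -> (w : int -> R[i]) : finsupp w -> n2c (fun n => lc * w n) = normc lc ^+ 2 * n2c w.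
    move=> fw; rewrite /n2c -totZ; last exact: finsupp_msq.
    by congr tot; apply: funext => n; rewrite /msq normcM exprMn.
  - by rewrite mulrAC mulrC ler_pM2l ?n20// hc.
  - exact: fac.
set d := c * normc lc ^+ 2 in hc'.
have d0 : 0 < d by rewrite mulr_gt0// n20.
(* For [psi] with [n2 (A psi)] above [(al - eta) * n2 psi], the bound [hal] at [A psi] gives [n2] of
   [A (A psi) - al psi] below [al * eta * n2 psi], hence below [d * n2 psi], against [hc']. The
   minimum with [al] keeps [al - eta] nonnegative, as membership in [D] demands. *)
pose eta := Num.min al (d / al).
have eta0 : 0 < eta by rewrite lt_min al0 divr_gt0.
have [psi [fs hpsi]] : exists psi, finsupp psi /\ (al - eta) * n2 psi < n2 (A psi).
  apply: contrapT => hn; have : al <= al - eta.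
    apply: (inf_lbound lbD); split; first by rewrite subr_ge0 ge_min lexx.
    by move=> psi fs; rewrite leNgt; apply/negP => hlt; apply: hn; exists psi.
  by move: eta0; lra.
have fA := finsupp_poly_act V p fs.
have := hc' _ fs; rewrite rE n2BZ//; last exact: finsupp_poly_act.
rewrite (ip_poly_act _ fA fs) -n2E => h1.
have h2 := hal _ fA.
have h3 : al * eta <= d.
  by rewrite mulrC -ler_pdivlMr// ge_min lexx orbT.
have h4 : al * ((al - eta) * n2 psi) < al * n2 (A psi) by rewrite ltr_pM2l.
have h5 : al * eta * n2 psi <= d * n2 psi by rewrite ler_wpM2r// n2_ge0.
by move: h1 h2 h4 h5; rewrite expr2; lra.
Qed.

End SpectralRadius.

Section ApproxPoint.
Variables (R : realType) (V : int -> R) (M : R).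
Hypothesis hV : forall n, `|V n| <= M.
Implicit Types (p : {poly R}) (phi : int -> R).

Lemma jacobi_subC x phi n :
  jacobi (fun n => V n - x) phi n = jacobi V phi n - x * phi n.
Proof. by rewrite /jacobi; ring. Qed.

Definition delta0 : int -> R := fun n => (n == 0)%:R.

Lemma iter_jacobi_delta k : iter k (jacobi V) delta0 k%:Z = 1 /\
  forall n : int, (k%:Z < n)%R -> iter k (jacobi V) delta0 n = 0.
Proof.
elim: k => [|k [IH1 IH2]]; first by split=> [|n hn]; rewrite /= /delta0 ?eqxx//; case: eqP => //; lia.
rewrite iterS; split=> [|n hn]; rewrite /jacobi; last by rewrite !IH2; [ring|lia..].
by rewrite (_ : k.+1%:Z - 1 = k%:Z) ?IH1 ?(IH2 (k.+1%:Z + 1)) ?(IH2 k.+1%:Z); [ring|lia..].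
Qed.

Lemma finsupp_delta0 : finsupp delta0.
Proof. by exists 0%N => n hn; rewrite /delta0; case: eqP => //; lia. Qed.

Lemma n2_delta0 : n2 delta0 = 1.
Proof.
rewrite /n2 (@totE _ 0%N); last first.
  by move=> n hn; rewrite /delta0; case: eqP; rewrite ?expr0n//; lia.
by rewrite /window big_ord1 /delta0 /= expr1n.
Qed.

(* The off-diagonal entries of [H] equal [1], so [p(H)] maps the unit vector at [0] to a sequence
   whose entry at [deg p] is the leading coefficient of [p]. *)
Lemma monic_large_on_spectrum p : p \is monic -> (1 < size p)%N ->
  exists x, approx_point V x /\ 1 <= p.[x] ^+ 2.
Proof.
move=> pm p1; apply: (spectral_radius hV p1 ltr01 finsupp_delta0); rewrite n2_delta0 ?mulr1//.
have := n2_term (size p).-1%:Z (finsupp_poly_act V p finsupp_delta0).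
apply: le_trans; rewrite /poly_act; have := monicP pm; rewrite /lead_coef; case: (size p) p1 => // d _ /= pd.
rewrite big_ord_recr /= (iter_jacobi_delta d).1 mulr1 big1 ?add0r; last first.
  by move=> i _; rewrite (iter_jacobi_delta i).2 ?mulr0//; have := ltn_ord i; lia.
by rewrite pd expr1n.
Qed.

Lemma approx_energy_bound x phi e : finsupp phi -> 0 < n2 phi ->
  n2 (jacobi (fun n => V n - x) phi) <= e * n2 phi ->
  x ^+ 2 <= 2 * (6 + 3 * M ^+ 2) + 2 * e.
Proof.
move=> fp p0 h; rewrite -(ler_pM2r p0) -n2Z//.
have fJ := finsupp_jacobi V fp; have fT := finsupp_jacobi (fun n => V n - x) fp.
have -> : (fun n => x * phi n) =
   fun n => jacobi V phi n + (- 1) * jacobi (fun n => V n - x) phi n.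
  by apply: funext => n; rewrite jacobi_subC; ring.
apply: (le_trans (n2D_le fJ (finsuppZ (fun=> - 1) fT))).
by have := n2_jacobi hV fp; rewrite n2Z// sqrrN expr1n; move: h; lra.
Qed.

Lemma approx_point_bound x : approx_point V x -> x ^+ 2 <= 2 * (6 + 3 * M ^+ 2).
Proof.
move=> hx; apply/ler_addgt0Pr => e e0.
have e2 : 0 < e / 2 by rewrite divr_gt0.
have [phi [fp h]] := hx _ e2.
have p0 : 0 < n2 phi.
  by rewrite -(pmulr_rgt0 _ e2) (le_lt_trans _ h)// n2_ge0.
by have := approx_energy_bound fp p0 (ltW h); lra.
Qed.

(** Apply [spectral_radius] to the polynomial [C - (X - x)^2]: the approximate eigenvector makes its
    squared norm at least [C^2 - 2 C e], so some spectral point [y], with [t = (y - x)^2], satisfies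
    [(C - t)^2 >= C^2 - 2 C e]. As [t <= C], this forces [t <= 2 e]. *)
Lemma approx_point_near x phi e : 0 < e -> finsupp phi -> 0 < n2 phi ->
  n2 (jacobi (fun n => V n - x) phi) <= e * n2 phi ->
  exists y, approx_point V y /\ (y - x) ^+ 2 <= 2 * e.
Proof.
move=> e0 fp p0 h; have hx := approx_energy_bound fp p0 h.
set B := 2 * (6 + 3 * M ^+ 2) in hx.
(* Large enough that [t <= C] for every spectral [y]: both [y ^+ 2 <= B] and [x ^+ 2 <= B + 2 * e]
   hold, and [t <= 2 * y ^+ 2 + 2 * x ^+ 2]. *)
pose C := 4 * B + 8 * e.
have B0 : 0 < B by rewrite /B; have := sqr_ge0 M; lra.
have C0 : 0 < C by rewrite /C; lra.
pose p : {poly R} := C%:P - ('X - x%:P) ^+ 2.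
have szX : size (('X - x%:P) ^+ 2 : {poly R}) = 3%N.
  exact: size_exp_XsubC.
have p1 : (1 < size p)%N.
  rewrite /p addrC size_polyDl size_polyN szX//.
  exact: leq_ltn_trans (size_polyC_leq1 _) _.
have s0 : 0 < C ^+ 2 - 2 * C * e.
  have -> : C ^+ 2 - 2 * C * e = C * (C - 2 * e) by ring.
  by apply: mulr_gt0 => //; rewrite /C; lra.
pose T := jacobi (fun n => V n - x).
have fT : finsupp (T phi) by exact: finsupp_jacobi.
have fTT : finsupp (T (T phi)) by exact: finsupp_jacobi.
have actT psi : poly_act V ('X - x%:P) psi = T psi.
  by rewrite poly_act_XsubC; apply: funext => n; rewrite /T jacobi_subC.
have pE : poly_act V p phi = fun n => - 1 * (T (T phi) n - C * phi n).
  rewrite /p expr2 -[- _]scaleN1r poly_actD poly_actZ poly_actM !actT poly_actC.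
  by apply: funext => n; ring.
have [|y [hy]] := spectral_radius hV p1 s0 fp p0.
  rewrite pE n2Z; last by apply: finsuppB => //; exact: (finsuppZ (fun=> C)).
  rewrite sqrrN expr1n mul1r n2BZ// (ip_jacobi (fun n => V n - x) fT fp) -/T -n2E.
  have := n2_ge0 (T (T phi)); have : 2 * C * n2 (T phi) <= 2 * C * (e * n2 phi).
    by rewrite ler_pM2l// mulr_gt0.
  lra.
rewrite /p !hornerE; set t := (y - x) ^+ 2 => b; exists y; split => //; rewrite -/t.
have t0 : 0 <= t by exact: sqr_ge0.
have tC : t <= C.
  have := approx_point_bound hy; rewrite -/B => hyB.
  have : t <= 2 * y ^+ 2 + 2 * x ^+ 2 by have := sqr_ge0 (y + x); rewrite /t !expr2; lra.
  by rewrite /C; lra.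
have h1 : t * C <= t * (2 * C - t) by rewrite ler_wpM2l//; lra.
by rewrite -(ler_pM2r C0); move: b; rewrite !expr2; lra.
Qed.

End ApproxPoint.

(** * Dependence of the spectrum on frequency and phase *)

Section Localization.
Variables (R : realType).
Implicit Types (W psi phi : int -> R).

Lemma sum_ltn_nat K b : (b <= K)%N -> \sum_(i < K) (i < b)%:R = b%:R :> R.
Proof.
move=> h; rewrite (bigID (fun i : 'I_K => (i < b)%N)) /=.
rewrite [X in _ + X]big1 ?addr0; last by move=> i /negbTE ->.
rewrite (eq_bigr (fun=> 1)); last by move=> i ->.
by rewrite -(big_ord_widen K (fun=> 1 : R) h) sumr_const card_ord.
Qed.

Lemma sum_eqn_nat_le K a : \sum_(i < K) (i == a :> nat)%:R <= 1 :> R.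
Proof.
have [h|h] := ltnP a K.
  by rewrite (bigD1 (Ordinal h))//= eqxx big1 ?addr0// => i /negbTE; rewrite -val_eqE /= => ->.
by rewrite big1// => i _; rewrite ltn_eqF// (leq_trans (ltn_ord i)).
Qed.

Definition box (L : nat) (j n : int) : R := ((j <= n) && (n < j + L%:Z))%R%:R.

Let sqr_bool (b : bool) : (b%:R : R) ^+ 2 = b%:R.
Proof. by case: b; rewrite ?expr1n// expr0n. Qed.

Lemma sum_box (K A L : nat) (n : int) : (`|n| + L%:Z <= A%:Z)%R -> (A.*2 < K)%N ->
  \sum_(i < K) box L (i%:Z - A%:Z) n ^+ 2 = L%:R.
Proof.
move=> hn hK; set m := absz (n + A%:Z).
have hm : m%:Z = n + A%:Z by rewrite /m; lia.
rewrite (eq_bigr (fun i : 'I_K => (i < m.+1)%:R - (i < m.+1 - L)%N%:R)).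
  rewrite sumrB !sum_ltn_nat; try lia.
  by rewrite -natrB; [congr (_%:R); lia|lia].
move=> i _; rewrite /box sqr_bool; have := ltn_ord i.
case: (i%:Z - A%:Z <= n) / idP => h1; case: (n < i%:Z - A%:Z + L%:Z) / idP => h2 /= _;
case: (ltnP i m.+1) => h3; case: (ltnP i (m.+1 - L)) => h4 /=; rewrite ?subr0 ?subrr//; lia.
Qed.

(** Only the box that begins at [n + 1] and the box whose last point is [n] distinguish the two
    points. *)
Lemma sum_box_diff (K A L : nat) (n : int) : (`|n| + L%:Z < A%:Z)%R ->
  \sum_(i < K) (box L (i%:Z - A%:Z) (n + 1) - box L (i%:Z - A%:Z) n) ^+ 2 <= 2.
Proof.
move=> hn; set m := absz (n + A%:Z).
have hm : m%:Z = n + A%:Z by rewrite /m; lia.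
apply: (@le_trans _ _ (\sum_(i < K) ((i == m.+1 :> nat)%:R + (i == (m.+1 - L)%N :> nat)%:R))).
  apply: ler_sum => i _; rewrite /box.
  case: (i%:Z - A%:Z <= n + 1) / idP => h1; case: (n + 1 < i%:Z - A%:Z + L%:Z) / idP => h2;
  case: (i%:Z - A%:Z <= n) / idP => h3; case: (n < i%:Z - A%:Z + L%:Z) / idP => h4 /=;
  case: (i =P m.+1 :> nat) => h5; case: (i =P (m.+1 - L)%N :> nat) => h6 /=;
  rewrite ?subr0 ?sub0r ?subrr ?sqrrN ?expr1n ?expr0n//=; first [lra | lia].
rewrite big_split /=; have := sum_eqn_nat_le K m.+1; have := sum_eqn_nat_le K (m.+1 - L).
lra.
Qed.

(* Averaging over all translates of a window of length [L]: the commutators with the windows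
   contribute [O(1 / L)]. *)
Lemma localized_approx W psi c (L : nat) : (0 < L)%N -> finsupp psi ->
  n2 (jacobi W psi) < c * n2 psi ->
  exists (j : int) phi, (forall n, ~~ ((j <= n) && (n < j + L%:Z))%R -> phi n = 0) /\
    n2 (jacobi W phi) < (3 * c + 12 / L%:R) * n2 phi.
Proof.
move=> L0 fp h; have [N sp] := fp.
(* The windows begin at [i - A], that is at every integer from [- A] to [A], so each point of the
   support and each of its neighbours lies in exactly [L] of them. *)
set A := (N + L + 3)%N; set K := A.*2.+1.
pose phi (i : nat) : int -> R := fun n => box L (i%:Z - A%:Z) n * psi n.
have fphi i : finsupp (phi i) by exact: finsuppZ.
have fJphi i : finsupp (jacobi W (phi i)) by exact: finsupp_jacobi.
apply: contrapT => hn.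
(* The factor 3 comes from squaring a sum of three terms. Each of the two commutator terms costs
   [3 * 2] in total over the windows, against a total mass multiplied by [L]. *)
set kap := 3 * c + 12 / L%:R in hn.
have hge (i : 'I_K) : kap * n2 (phi i) <= n2 (jacobi W (phi i)).
  rewrite leNgt; apply/negP => hlt; apply: hn; exists (i%:Z - A%:Z), (phi i); split => //.
  by move=> n; rewrite /phi /box => /negbTE ->; rewrite mul0r.
have L0' : 0 < L%:R :> R by rewrite ltr0n.
have S1 : \sum_(i < K) n2 (phi i) = L%:R * n2 psi.
  rewrite /n2 -totZ; last exact: finsupp_sqr.
  rewrite -tot_sum; last by move=> i; exact: finsupp_sqr.
  congr tot; apply: funext => n; rewrite /phi.
  under eq_bigr do rewrite exprMn.
  rewrite -mulr_suml; have [hN|hN] := leP `|n| N%:Z; first by rewrite sum_box//; lia.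
  by rewrite sp// expr0n !mulr0.
have fJ := finsupp_jacobi W fp.
have f1 := finsuppZ (fun=> 3 * L%:R) (finsupp_sqr fJ).
have f2 := finsuppZ (fun=> 6) (finsupp_sqr (finsupp_shift (- 1) fp)).
have f3 := finsuppZ (fun=> 6) (finsupp_sqr (finsupp_shift 1 fp)).
have S2 : \sum_(i < K) n2 (jacobi W (phi i)) <= 3 * L%:R * n2 (jacobi W psi) + 12 * n2 psi.
  have -> : 3 * L%:R * n2 (jacobi W psi) + 12 * n2 psi =
     tot (fun n => (3 * L%:R * jacobi W psi n ^+ 2 + 6 * psi (n - 1) ^+ 2) + 6 * psi (n + 1) ^+ 2).
    rewrite totD//; last exact: finsuppD.
    have g1 := finsupp_sqr (finsupp_shift (- 1) fp).
    have g2 := finsupp_sqr (finsupp_shift 1 fp).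
    rewrite totD// (totZ _ g1) (totZ _ g2) (totZ _ (finsupp_sqr fJ)).
    by rewrite -/(n2 _) -/(n2 (fun n => psi (n - 1))) -/(n2 (fun n => psi (n + 1))) !n2_shift//; ring.
  rewrite /n2 -tot_sum; last by move=> i; exact: finsupp_sqr.
  apply: tot_le.
  - by apply: finsupp_sum => i; exact: finsupp_sqr.
  - by apply: finsuppD => //; exact: finsuppD.
  move=> n.
  have pw (i : 'I_K) : jacobi W (phi i) n ^+ 2 <=
     3 * jacobi W psi n ^+ 2 * box L (i%:Z - A%:Z) n ^+ 2 +
     3 * psi (n - 1) ^+ 2 * (box L (i%:Z - A%:Z) (n - 1 + 1) - box L (i%:Z - A%:Z) (n - 1)) ^+ 2 +
     3 * psi (n + 1) ^+ 2 * (box L (i%:Z - A%:Z) (n + 1) - box L (i%:Z - A%:Z) n) ^+ 2.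
    rewrite subrK; set x := box _ _ n; set y := box _ _ (n - 1); set z := box _ _ (n + 1).
    (* Product rule: the window commutes with the potential, and its commutators with the two shifts
       give the last two terms. *)
    have -> : jacobi W (phi i) n = jacobi W psi n * x - psi (n - 1) * (x - y) + psi (n + 1) * (z - x).
      by rewrite /jacobi /phi -/x -/y -/z; ring.
    set a := jacobi W psi n; set b := psi (n - 1); set d := psi (n + 1).
    have := sqr_ge0 (a * x + b * (x - y)); have := sqr_ge0 (a * x - d * (z - x)).
    have := sqr_ge0 (b * (x - y) + d * (z - x)).
    by rewrite !expr2; lra.
  apply: (le_trans (ler_sum _ (fun i _ => pw i))).
  rewrite !big_split /= -!mulr_sumr.
  apply: lerD; first apply: lerD.
  - have [hN|hN] := leP `|n| N.+1%:Z; first by rewrite sum_box//; [lra|lia..].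
    by rewrite /jacobi !sp; [rewrite !(mulr0, addr0) expr0n !(mulr0, mul0r)|lia..].
  - have [hN|hN] := leP `|n - 1| N%:Z; last by rewrite sp// expr0n !(mulr0, mul0r).
    have := @sum_box_diff K A L (n - 1); have := sqr_ge0 (psi (n - 1)) => p0 /(_ _).
    move=> /(_ ltac:(rewrite /A; lia)) h'.
    apply: (@le_trans _ _ (3 * psi (n - 1) ^+ 2 * 2)); last by lra.
    by rewrite ler_wpM2l//; lra.
  - have [hN|hN] := leP `|n + 1| N%:Z; last by rewrite sp// expr0n !(mulr0, mul0r).
    have := @sum_box_diff K A L n; have := sqr_ge0 (psi (n + 1)) => p0 /(_ _).
    move=> /(_ ltac:(rewrite /A; lia)) h'.
    apply: (@le_trans _ _ (3 * psi (n + 1) ^+ 2 * 2)); last by lra.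
    by rewrite ler_wpM2l//; lra.
have S3 : kap * (L%:R * n2 psi) <= 3 * L%:R * n2 (jacobi W psi) + 12 * n2 psi.
  by apply: le_trans S2; rewrite -S1 mulr_sumr; apply: ler_sum => i _; exact: hge.
have S4 : kap * (L%:R * n2 psi) = 3 * L%:R * (c * n2 psi) + 12 * n2 psi.
  by rewrite /kap; field; rewrite gt_eqF.
have : 3 * L%:R * n2 (jacobi W psi) < 3 * L%:R * (c * n2 psi) by rewrite ltr_pM2l// mulr_gt0.
by move: S3; rewrite S4; lra.
Qed.

End Localization.

Section Circle.
Variable R : realType.
Implicit Types (f v : R -> R).

(** Only [x] is confined to the segment; [y] may lie just outside it, which is what periodic
    extension and grids that overshoot the segment require. *)
Lemma unif_continuous_segment f a b e : continuous f -> 0 < e ->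
  exists2 d, 0 < d & forall x y, a <= x <= b -> `|x - y| < d -> `|f x - f y| < e.
Proof.
move=> cf e0.
have /compact_near_coveringP cov := @segment_compact R a b.
have : \forall d \near (0:R)^'+, `[a, b] `<=` (fun x => forall y, `|x - y| < d -> `|f x - f y| < e).
  apply: cov => x _.
  have /cvgrPdist_lt /(_ (e / 2)) := cf x; rewrite divr_gt0// => /(_ isT).
  move=> /nbhs_ballP[r /= r0 hr].
  exists (ball x (r / 2), [set d | 0 < d < r / 2]) => /=.
    split; first by apply: nbhsx_ballx; rewrite divr_gt0.
    near=> d; apply/andP; split; first by near: d; exact: nbhs_right_gt.
    by near: d; apply: nbhs_right_lt; rewrite divr_gt0.
  move=> [x' d] /= [hx' /andP[d0 hd]] y hy.
  have r1 : ball x r x' by apply: le_ball hx'; lra.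
  have r2 : ball x r y.
    rewrite /ball/= in hx' *.
    have -> : x - y = (x - x') + (x' - y) by ring.
    by apply: (le_lt_trans (ler_normD _ _)); move: hx' hy hd; lra.
  have -> : f x' - f y = (f x - f y) - (f x - f x') by ring.
  have h1 := hr _ r1; have h2 := hr _ r2; rewrite /= in h1 h2.
  by apply: (le_lt_trans (ler_normB _ _)); lra.
move=> [d /= d0 hd]; exists (d / 2); first by rewrite divr_gt0.
move=> x y hx; apply: (hd (d / 2)) => //=; last by rewrite divr_gt0.
by rewrite sub0r normrN gtr0_norm ?divr_gt0//; lra.
Unshelve. all: by end_near. Qed.

Variable v : R -> R.
Hypothesis hv : circle_continuous v.

Lemma circle_periodic x (m : int) : v (x + m%:~R) = v x.
Proof.
have pos (k : nat) y : v (y + k%:R) = v y.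
  elim: k y => [|k IH] y; first by rewrite addr0.
  by rewrite -addn1 natrD addrA hv.2 IH.
case: m => k; first by rewrite -pmulrn pos.
by rewrite NegzE mulrNz -pmulrn -[in RHS](subrK k.+1%:R x) pos.
Qed.

Lemma circle_bounded : exists M, forall x, `|v x| <= M.
Proof.
have cn : {within `[0, 1], continuous (fun x => `|v x|)}.
  by apply: continuous_subspaceT => x; apply: continuous_comp; [exact: hv.1|exact: norm_continuous].
have [c _ hc] := EVT_max ler01 cn.
exists `|v c| => x.
rewrite -(circle_periodic x (- Num.floor x)); apply: hc.
have /andP[h1 h2] := floor_itv x.
by rewrite in_itv /= rmorphN /=; move: h1 h2; rewrite rmorphD /=; lra.
Qed.

Lemma circle_unif_continuous e : 0 < e ->
  exists2 d, 0 < d & forall x y (m : int), `|x - y - m%:~R| < d -> `|v x - v y| <= e.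
Proof.
move=> e0; have [d d0 hd] := @unif_continuous_segment v 0 1 e hv.1 e0.
exists d => // x y m h.
rewrite -(circle_periodic x (- Num.floor x)) -(circle_periodic y (m - Num.floor x)).
apply/ltW/hd.
  have /andP[h1 h2] := floor_itv x.
  by rewrite rmorphN /=; move: h1 h2; rewrite rmorphD /=; lra.
move: h; rewrite !rmorphD !rmorphN /=; congr (`|_| < _); ring.
Qed.

End Circle.

(* Two of the fractional parts of [0, alpha, .., N alpha] lie in a common interval of length [1 / N];
   the multiples of their difference are [1 / N]-dense. *)
Lemma kronecker (R : realType) (alpha t d : R) : irrational alpha -> 0 < d ->
  exists k m : int, `|alpha * k%:~R - t - m%:~R| < d.
Proof.
move=> irr d0; pose N := (Num.truncn d^-1).+1.
have N0 : 0 < N%:R :> R by rewrite ltr0n.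
have Nd : N%:R^-1 < d.
  by rewrite invf_plt ?posrE// /N; apply: truncnS_gt.
pose fr (i : nat) : R := alpha * i%:R - (Num.floor (alpha * i%:R))%:~R.
have fr01 i : 0 <= fr i < 1.
  have /andP[h1 h2] := floor_itv (alpha * i%:R).
  by rewrite /fr; move: h1 h2; rewrite rmorphD /=; lra.
have bin i : (Num.truncn (N%:R * fr i) < N)%N.
  have /andP[h1 h2] := fr01 i.
  rewrite truncn_lt_nat ?mulr_ge0// ?(ltW N0)//.
  by rewrite -[ltRHS]mulr1 ltr_pM2l.
pose g (i : 'I_N.+1) : 'I_N := Ordinal (bin i).
have /injectivePn[i [j ij gij]] : ~~ injectiveb g.
  by apply/negP => /injectiveP /leq_card; rewrite !card_ord ltnn.
have hij : `|fr i - fr j| < N%:R^-1.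
  have /andP[a1 _] := fr01 i; have /andP[b1 _] := fr01 j.
  have A : 0 <= N%:R * fr i by rewrite mulr_ge0// ltW.
  have B : 0 <= N%:R * fr j by rewrite mulr_ge0// ltW.
  have /andP[h1 h2] := truncn_itv A; have /andP[h3 h4] := truncn_itv B.
  have e : Num.truncn (N%:R * fr i) = Num.truncn (N%:R * fr j) by exact: (congr1 (@nat_of_ord _) gij).
  rewrite e in h1 h2.
  rewrite -(ltr_pM2l N0) divff ?gt_eqF// -[X in X * _]gtr0_norm// -normrM mulrBr.
  rewrite ltr_norml; apply/andP; move: h1 h2 h3 h4; rewrite -natr1; split; lra.
pose a := fr i - fr j.
pose K : int := i%:Z - j%:Z; pose L : int := Num.floor (alpha * i%:R) - Num.floor (alpha * j%:R).
have aE : a = alpha * K%:~R - L%:~R.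
  by rewrite /a /fr /K /L !rmorphB /= -!pmulrn; ring.
have a0 : a != 0.
  apply/eqP => a0; apply: irr.
  have K0 : K != 0 by rewrite /K subr_eq0; apply: contra ij => /eqP[h]; apply/eqP/val_inj.
  exists (L%:~R / K%:~R) => //.
  rewrite fmorph_div /= !ratr_int; apply/eqP; rewrite eq_sym -subr_eq0.
  have K0' : K%:~R != 0 :> R by rewrite intr_eq0.
  by rewrite -(mulIr_eq0 _ (mulIf K0')) mulrBl divfK// -aE a0.
pose l := Num.floor (t / a).
exists (K * l), (L * l).
have -> : alpha * (K * l)%:~R - t - (L * l)%:~R = a * (l%:~R - t / a).
  by rewrite mulrBr mulrCA divff// mulr1 aE !intrM; ring.
rewrite normrM; apply: lt_trans Nd; apply: le_lt_trans hij.
rewrite -/a -[leRHS]mulr1 ler_pM2l ?normr_gt0// ler_norml.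
by have /andP[h1 h2] := floor_itv (t / a); move: h1 h2; rewrite rmorphD /=; lra.
Qed.

Lemma n2_jacobi_perturb (R : realType) (V V' : int -> R) e phi : finsupp phi ->
  (forall n, phi n != 0 -> `|V n - V' n| <= e) ->
  n2 (jacobi V' phi) <= 2 * n2 (jacobi V phi) + 2 * e ^+ 2 * n2 phi.
Proof.
move=> fp h.
have -> : jacobi V' phi = fun n => jacobi V phi n + (V' n - V n) * phi n.
  by apply: funext => n; rewrite /jacobi; ring.
apply: (le_trans (n2D_le (finsupp_jacobi V fp) (finsuppZ _ fp))).
rewrite lerD2l -mulrA ler_pM2l// /n2 -totZ; last exact: finsupp_sqr.
apply: tot_le; [exact: finsupp_sqr (finsuppZ _ fp)|exact: (finsuppZ (fun=> e ^+ 2) (finsupp_sqr fp))|].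
move=> n; rewrite exprMn; have [->|p0] := eqVneq (phi n) 0; first by rewrite expr0n !mulr0.
rewrite ler_wpM2r ?sqr_ge0// -sqrrN opprB -(real_normK (num_real (V n - V' n))).
by rewrite lerXn2r// ?nnegrE ?(le_trans _ (h _ p0))// h.
Qed.

(** * Spectra of quasi-periodic operators under change of frequency and phase *)

Section QuasiPeriodic.
Variables (R : realType) (v : R -> R).
Hypothesis hv : circle_continuous v.

Definition qp (alpha theta : R) : int -> R := fun n => v (alpha * n%:~R + theta).

Definition spec (alpha theta : R) : set R := approx_point (qp alpha theta).

Lemma sigma_spec alpha theta : sigma v alpha theta = [set x%:C | x in spec alpha theta].
Proof.
have [M hM] := circle_bounded hv.
exact: (@spectrum_jacobi _ (qp alpha theta) M (fun n => hM _)).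
Qed.

Lemma spec_bounded : exists2 M, 1 <= M & forall alpha theta x, spec alpha theta x -> `|x| <= M.
Proof.
have [M hM] := circle_bounded hv.
set B := 2 * (6 + 3 * M ^+ 2).
exists (1 + B); first by rewrite /B; have := sqr_ge0 M; lra.
move=> alpha theta x hx.
have := @approx_point_bound _ (qp alpha theta) M (fun n => hM _) x hx.
rewrite -/B -(real_normK (num_real x)); set y := `|x| => h.
by have := sqr_ge0 (y - 1); have := sqr_ge0 y; move: h; rewrite !expr2; lra.
Qed.

(** An approximate eigenvector for [beta], [theta] is cut to a window of length [L] beginning at
    [j]. Density of the multiples of [alpha] supplies [k] with [alpha * k] close to
    [beta * j + theta] modulo 1, and the piece is moved to begin at [k]; along [L] sites the two
    phases stay close. As [L] depends on [eta] only, [d] is uniform in [theta] and [x]. *)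
Lemma spec_near_irrational alpha eta : irrational alpha -> 0 < eta ->
  exists2 d, 0 < d & forall beta theta x (m : int), `|beta - alpha - m%:~R| < d ->
    spec beta theta x -> exists y, spec alpha 0 y /\ (y - x) ^+ 2 <= eta.
Proof.
move=> irr eta0; have [M hM] := circle_bounded hv.
(* Makes [12 / L] at most [eta / 16]. With [c = eta / 48] in the localization and
   [e ^+ 2 <= eta / 16], the moved vector has error at most [6 * eta / 16], below the [eta / 2]
   needed at the end. *)
pose L := (Num.truncn (192 / eta)).+1.
have L0 : 0 < L%:R :> R by rewrite ltr0n.
have hL : 12 / L%:R <= eta / 16.
  rewrite ler_pdivrMr//; have := truncnS_gt (192 / eta); rewrite -/L ltr_pdivrMr//.
  lra.
pose e := Num.min 1 (eta / 16).
have e0 : 0 < e by rewrite lt_min ltr01 divr_gt0.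
have he : e ^+ 2 <= eta / 16.
  have e1 : e <= 1 by rewrite ge_min lexx.
  have e2 : e <= eta / 16 by rewrite ge_min lexx orbT.
  by apply: le_trans e2; rewrite expr2 ger_pMl.
have [d d0 hd] := circle_unif_continuous hv e0.
(* Half of [d] is left for the initial phase mismatch, the other half for the frequency mismatch
   accumulated over [L] sites. *)
exists (d / 2 / L%:R); first by rewrite !divr_gt0.
move=> beta theta x m hm hx.
have c0 : 0 < eta / 48 by rewrite divr_gt0.
have [psi [fs hpsi]] := hx _ c0.
have [j [phi [sphi hphi]]] := localized_approx (isT : (0 < L)%N) fs hpsi.
have [k [l hkl]] := kronecker (beta * j%:~R + theta) irr (divr_gt0 d0 (ltr0n _ 2)).
have fphi : finsupp phi.
  by exists (absz j + L)%N => n hn; apply: sphi; apply/negP => /andP[]; clear -hn; lia.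
pose phi' : int -> R := fun n => phi (n + (j - k)).
have fphi' : finsupp phi' by exact: finsupp_shift.
have n2phi : n2 phi' = n2 phi by exact: n2_shift.
have p0 : 0 < n2 phi.
  rewrite lt_def n2_ge0 andbT; apply/eqP => h0; move: hphi; rewrite h0 mulr0.
  by rewrite ltNge n2_ge0.
pose V0 : int -> R := fun n => qp beta theta (n + (j - k)) - x.
have JV0 : n2 (jacobi V0 phi') = n2 (jacobi (fun n => qp beta theta n - x) phi).
  rewrite -(n2_shift (j - k) (finsupp_jacobi _ fphi)); congr n2; apply: funext => n.
  by rewrite /jacobi /V0 /phi'; congr (phi _ + phi _ + _); ring.
have pert : n2 (jacobi (fun n => qp alpha 0 n - x) phi') <=
   2 * n2 (jacobi V0 phi') + 2 * e ^+ 2 * n2 phi'.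
  apply: n2_jacobi_perturb => // n hn.
  have hn' : (j <= n + (j - k))%R && (n + (j - k) < j + L%:Z)%R.
    by apply: contraNT hn => /sphi h; rewrite /phi' h.
  rewrite /V0 /qp opprB addrA subrK addr0.
  have [s En] : exists s, n = s + k by exists (n - k); rewrite subrK.
  rewrite {}En in hn hn' *.
  have s0 : (0 <= s)%R by move: hn'; clear => /andP[]; lia.
  have sL : (s < L%:Z)%R by move: hn'; clear => /andP[]; lia.
  rewrite distrC; apply: (hd _ _ (l - m * s)).
  have -> : s + k + (j - k) = s + j by ring.
  rewrite !rmorphD !rmorphN !rmorphM /=.
  set S := s%:~R; set K := k%:~R; set J := j%:~R.
  have -> : alpha * (S + K) - (beta * (S + J) + theta) - (l%:~R - m%:~R * S) =
     (alpha * K - (beta * J + theta) - l%:~R) - (beta - alpha - m%:~R) * S by ring.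
  apply: (le_lt_trans (ler_normB _ _)).
  have hS : `|S| <= L%:R.
    rewrite /S -intr_norm ger0_norm// (_ : L%:R = L%:Z%:~R)// ler_int ltW//.
  have : `|(beta - alpha - m%:~R) * S| <= d / 2.
    rewrite normrM -(divfK (lt0r_neq0 L0) (d / 2)).
    by apply: ler_pM => //; exact: ltW.
  have : `|alpha * K - (beta * J + theta) - l%:~R| < d / 2 by exact: hkl.
  lra.
have [y [hy hyx]] : exists y, approx_point (qp alpha 0) y /\ (y - x) ^+ 2 <= 2 * (eta / 2).
  apply: (@approx_point_near _ (qp alpha 0) M (fun n => hM _) x phi') => //.
  - by rewrite divr_gt0.
  - by rewrite n2phi.
  apply: (le_trans pert); rewrite JV0 n2phi.
  have h1 : 2 * e ^+ 2 * n2 phi <= 2 * (eta / 16) * n2 phi by rewrite ler_pM2r// ler_pM2l.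
  have h2 : 12 / L%:R * n2 phi <= eta / 16 * n2 phi by rewrite ler_pM2r.
  by have := mulr_gt0 eta0 p0; move: hphi h1 h2; lra.
by exists y; split => //; apply: (le_trans hyx); lra.
Qed.

Lemma spec_periodic beta theta (m : int) : spec beta (theta + m%:~R) = spec beta theta.
Proof.
congr approx_point; apply: funext => n.
by rewrite /qp addrA circle_periodic.
Qed.

Lemma approx_point_perturb (V V' : int -> R) x y c e phi : finsupp phi ->
  (forall n, `|V n - V' n| <= e) -> `|x - y| <= e ->
  n2 (jacobi (fun n => V n - x) phi) < c * n2 phi ->
  n2 (jacobi (fun n => V' n - y) phi) <= (2 * c + 8 * e ^+ 2) * n2 phi.
Proof.
move=> fp hV hxy h.
have := @n2_jacobi_perturb _ (fun n => V n - x) (fun n => V' n - y) (2 * e) phi fp.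
move=> /(_ _) H; apply: (le_trans (H _)).
  move=> n _; have -> : V n - x - (V' n - y) = (V n - V' n) - (x - y) by ring.
  by apply: (le_trans (ler_normB _ _)); have := hV n; move: hxy; lra.
by move: h; rewrite exprMn; have := n2_ge0 phi; lra.
Qed.

Lemma spec_closed alpha theta : closed (spec alpha theta).
Proof.
move=> x clx c c0; pose e := Num.min 1 (c / 32).
have e0 : 0 < e by rewrite lt_min ltr01 divr_gt0.
have he : e ^+ 2 <= c / 32.
  have e1 : e <= 1 by rewrite ge_min lexx.
  have e2 : e <= c / 32 by rewrite ge_min lexx orbT.
  by apply: le_trans e2; rewrite expr2 ger_pMl.
have [y [hy yx]] := clx _ (nbhsx_ballx x e e0).
have c4 : 0 < c / 8 by rewrite divr_gt0.
have [phi [fp h]] := hy _ c4.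
have p0 : 0 < n2 phi by rewrite -(pmulr_rgt0 _ c4) (le_lt_trans _ h)// n2_ge0.
exists phi; split => //.
have := @approx_point_perturb (qp alpha theta) (qp alpha theta) y x _ e phi fp _ _ h.
move=> H; apply: le_lt_trans (H _ _) _.
- by move=> n; rewrite subrr normr0 ltW.
- by rewrite distrC ltW.
by rewrite ltr_pM2r//; lra.
Qed.

Definition union_spec (beta : R) : set R := [set x | exists theta, spec beta theta x].

(** Compactness of the circle of phases: each point near [x] is given a phase in [[0, 1]], and at a
    cluster phase [t] the approximate eigenvectors of nearby points still serve [x]. *)
Lemma union_spec_closed beta : closed (union_spec beta).
Proof.
move=> x clx.
have hth y : exists theta, union_spec beta y -> (0 <= theta <= 1) /\ spec beta theta y.
  have [[t ht]|h] := pselect (union_spec beta y); last by exists 0.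
  exists (t - (Num.floor t)%:~R) => _; split.
    by have /andP[h1 h2] := floor_itv t; move: h1 h2; rewrite rmorphD /=; lra.
  by rewrite -mulrNz spec_periodic.
have [th hthP] := choice hth.
have FF : ProperFilter (within (union_spec beta) (nbhs x)).
  exact: within_nbhs_proper.
have [|t [_ clt]] := @segment_compact R 0 1 (th @ within (union_spec beta) (nbhs x)) _.
  rewrite /fmap/= /nbhs /=; apply: (@filterS _ (nbhs x) _ setT) filterT => y _ /= hy.
  by have [h _] := hthP y hy; rewrite /= in_itv /= h.
exists t => c c0.
pose e := Num.min 1 (c / 32).
have e0 : 0 < e by rewrite lt_min ltr01 divr_gt0.
have he : e ^+ 2 <= c / 32.
  have e1 : e <= 1 by rewrite ge_min lexx.
  have e2 : e <= c / 32 by rewrite ge_min lexx orbT.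
  by apply: le_trans e2; rewrite expr2 ger_pMl.
have [d d0 hd] := circle_unif_continuous hv e0.
have hB : (th @ within (union_spec beta) (nbhs x)) (th @` (union_spec beta `&` ball x e)).
  rewrite /fmap/= /nbhs /=; apply: (@filterS _ (nbhs x) _ (ball x e)) (nbhsx_ballx x e e0).
  by move=> y bxy /= hy; exists y.
have [_ [[y [hy bxy] <-] bt]] := clt _ _ hB (nbhsx_ballx t d d0).
have c4 : 0 < c / 8 by rewrite divr_gt0.
have [_ hy'] := hthP y hy; have [phi [fp h]] := hy' _ c4.
have p0 : 0 < n2 phi by rewrite -(pmulr_rgt0 _ c4) (le_lt_trans _ h)// n2_ge0.
exists phi; split => //.
have := @approx_point_perturb (qp beta (th y)) (qp beta t) y x _ e phi fp _ _ h.
move=> H; apply: le_lt_trans (H _ _) _.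
- move=> n; apply: (hd _ _ 0); move: bt; rewrite /ball/= distrC; congr (`|_| < _).
  by rewrite /=; ring.
- by rewrite distrC ltW.
by rewrite ltr_pM2r//; lra.
Qed.

(** The lower bound 1 for the capacity of a single spectrum, in the form used by Leja points. The
    constant polynomial 1 asks only for a point of the spectrum, which the polynomial ['X]
    provides. *)
Lemma spec_large alpha theta (p : {poly R}) : p \is monic -> exists x, spec alpha theta x /\ 1 <= `|p.[x]|.
Proof.
have [M hM] := circle_bounded hv.
have mono (q : {poly R}) : q \is monic -> (1 < size q)%N ->
    exists x, spec alpha theta x /\ 1 <= `|q.[x]|.
  move=> qm q1.
  have [x [hx h1]] := @monic_large_on_spectrum _ (qp alpha theta) M (fun n => hM _) q qm q1.
  exists x; split => //; rewrite -(@ler_pXn2r _ 2)// ?nnegrE//.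
  by rewrite expr1n real_normK// num_real.
move=> pm; have [|p1] := ltnP 1 (size p); first exact: mono.
have [x [hx _]] := mono 'X (monicX _) ltac:(by rewrite size_polyX).
exists x; split => //; have p1' : p = 1.
  rewrite (size1_polyC p1); move: pm => /monicP; rewrite [in lead_coef p](size1_polyC p1) lead_coefC => ->//.
by rewrite p1' hornerC normr1.
Qed.

End QuasiPeriodic.

(** * Small polynomials from a vanishing Lyapunov exponent *)

Section OpNorm.
Variable R : realType.
Implicit Types (A B : 'M[R[i]]_2) (x y : 'cV[R[i]]_2).

(** Presents the Euclidean norm as the modulus of one complex number, so that its triangle
    inequality is that of [normc]. *)
Lemma vec_normE x : vec_norm x = normc (normc (x 0 0) +i* normc (x 1 0))%C.
Proof.
rewrite /vec_norm big_ord_recl big_ord1 [RHS]/normc.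
by rewrite (_ : lift ord0 ord0 = 1)//; apply/val_inj.
Qed.

Lemma normc_ge0 (z : R[i]) : 0 <= normc z.
Proof. by case: z => a b; rewrite sqrtr_ge0. Qed.

Lemma vec_norm_ge0 x : 0 <= vec_norm x. Proof. exact: sqrtr_ge0. Qed.

Lemma vec_normD x y : vec_norm (x + y) <= vec_norm x + vec_norm y.
Proof.
rewrite !vec_normE; apply: le_trans (le_normcD _ _).
have h i : normc ((x + y) i 0) <= normc (x i 0) + normc (y i 0) by rewrite mxE le_normcD.
rewrite [leLHS]/normc [leRHS]/normc /=; apply: ler_wsqrtr.
by apply: lerD; apply: lerXn2r (h _); rewrite nnegrE ?addr_ge0 ?normc_ge0.
Qed.

Lemma vec_normZ (a : R[i]) x : vec_norm (a *: x) = normc a * vec_norm x.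
Proof.
rewrite /vec_norm -[normc a]ger0_norm ?normc_ge0// -sqrtr_sqr -sqrtrM ?sqr_ge0//.
congr Num.sqrt; rewrite mulr_sumr; apply: eq_bigr => i _.
by rewrite mxE normcM exprMn.
Qed.

Lemma normc_le_vec_norm x i : normc (x i 0) <= vec_norm x.
Proof.
rewrite /vec_norm -[leLHS]ger0_norm ?normc_ge0// -sqrtr_sqr ler_wsqrtr//.
by rewrite (bigD1 i)//= lerDl sumr_ge0// => j _; rewrite sqr_ge0.
Qed.

Lemma vec_norm_le_sum x : vec_norm x <= \sum_i normc (x i 0).
Proof.
have s0 : 0 <= \sum_i normc (x i 0) by rewrite sumr_ge0// => i _; rewrite normc_ge0.
rewrite -[leRHS]ger0_norm// -sqrtr_sqr /vec_norm ler_wsqrtr//.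
rewrite !big_ord_recl !big_ord0 !addr0 sqrrD.
have := normc_ge0 (x ord0 0); have := normc_ge0 (x (lift ord0 ord0) 0) => h1 h2.
by have := mulr_ge0 h1 h2; lra.
Qed.

Definition entry_sum A : R := \sum_i \sum_j normc (A i j).

Lemma vec_norm_mul_le A x : vec_norm (A *m x) <= entry_sum A * vec_norm x.
Proof.
apply: (le_trans (vec_norm_le_sum _)); rewrite /entry_sum mulr_suml.
apply: ler_sum => i _; rewrite mxE; apply: (@le_trans _ _ (\sum_j normc (A i j * x j 0))).
  rewrite !big_ord_recl !big_ord0 !addr0; exact: le_normcD.
rewrite mulr_suml; apply: ler_sum => j _; rewrite normcM ler_wpM2l ?normc_ge0//.
exact: normc_le_vec_norm.
Qed.

Lemma vec_norm0 : vec_norm (0 : 'cV[R[i]]_2) = 0.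
Proof. by rewrite -(scale0r (0 : 'cV[R[i]]_2)) vec_normZ normc0 mul0r. Qed.

Lemma vec_norm_eq0 x : vec_norm x = 0 -> x = 0.
Proof.
move=> h; apply/matrixP => i j; rewrite !mxE ord1; apply: eq0_normc.
by apply/eqP; rewrite eq_le normc_ge0 andbT -h normc_le_vec_norm.
Qed.

Let op_set A := [set vec_norm (A *m x) | x in [set x | vec_norm x <= 1]].

Lemma op_set_has_sup A : has_sup (op_set A).
Proof.
split; first by exists (vec_norm (A *m 0)), 0 => //=; rewrite vec_norm0.
exists (entry_sum A) => _ [x /= x1 <-]; apply: (le_trans (vec_norm_mul_le _ _)).
rewrite ler_piMr// sumr_ge0// => i _; apply: sumr_ge0 => j _; exact: normc_ge0.
Qed.

Lemma op_norm_mul A x : vec_norm (A *m x) <= op_norm A * vec_norm x.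
Proof.
have [x0|xn0] := eqVneq (vec_norm x) 0.
  by rewrite x0 (vec_norm_eq0 x0) mulmx0 vec_norm0 mulr0.
have xp : 0 < vec_norm x by rewrite lt_def xn0 vec_norm_ge0.
rewrite -ler_pdivrMr//.
pose c : R[i] := ((vec_norm x)^-1)%:C.
have nc : normc c = (vec_norm x)^-1.
  by rewrite /c /normc /= expr0n /= addr0 sqrtr_sqr ger0_norm// invr_ge0 ltW.
have -> : vec_norm (A *m x) / vec_norm x = vec_norm (A *m (c *: x)).
  by rewrite -scalemxAr vec_normZ nc mulrC.
apply: (ub_le_sup (op_set_has_sup A).2); exists (c *: x) => //=.
by rewrite vec_normZ nc mulVf.
Qed.

Lemma op_norm_le A C : 0 <= C -> (forall x, vec_norm (A *m x) <= C * vec_norm x) ->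
  op_norm A <= C.
Proof.
move=> C0 h; apply: ge_sup; first exact: (op_set_has_sup A).1.
by move=> _ [x /= x1 <-]; apply: (le_trans (h x)); rewrite ler_piMr.
Qed.

Lemma op_norm_ge0 A : 0 <= op_norm A.
Proof.
apply: (ub_le_sup (op_set_has_sup A).2); exists 0 => /=; first by rewrite vec_norm0.
by rewrite mulmx0 vec_norm0.
Qed.

Lemma op_normM A B : op_norm (A *m B) <= op_norm A * op_norm B.
Proof.
apply: op_norm_le => [|x]; first by rewrite mulr_ge0 ?op_norm_ge0.
rewrite -mulmxA -mulrA; apply: (le_trans (op_norm_mul _ _)).
by rewrite ler_wpM2l ?op_norm_ge0// op_norm_mul.
Qed.

Lemma op_normD A B : op_norm (A + B) <= op_norm A + op_norm B.
Proof.
apply: op_norm_le => [|x]; first by rewrite addr_ge0 ?op_norm_ge0.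
by rewrite mulmxDl mulrDl; apply: (le_trans (vec_normD _ _)); rewrite lerD// op_norm_mul.
Qed.

Lemma op_norm_le_entry_sum A : op_norm A <= entry_sum A.
Proof.
apply: op_norm_le => [|x]; last exact: vec_norm_mul_le.
by apply: sumr_ge0 => i _; apply: sumr_ge0 => j _; exact: normc_ge0.
Qed.

Lemma op_norm_dist A B : `|op_norm A - op_norm B| <= entry_sum (A - B).
Proof.
have h A' B' : op_norm A' - op_norm B' <= entry_sum (A' - B').
  rewrite lerBlDr; apply: (@le_trans _ _ (op_norm (A' - B') + op_norm B')).
    by rewrite -[in leLHS](subrK B' A'); exact: op_normD.
  by rewrite lerD2r op_norm_le_entry_sum.
rewrite ler_norml h andbT lerNl opprB; apply: (le_trans (h B A)).
rewrite le_eqVlt; apply/orP; left; apply/eqP; apply: eq_bigr => i _; apply: eq_bigr => j _.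
by rewrite -normcN !mxE opprB.
Qed.

Lemma vec_norm_delta j : vec_norm (delta_mx j 0 : 'cV[R[i]]_2) = 1.
Proof.
rewrite /vec_norm (bigD1 j)//= mxE !eqxx big1 => [|i /negbTE ij].
  by rewrite normc1 expr1n addr0 sqrtr1.
by rewrite mxE ij normc0 expr0n.
Qed.

Lemma op_norm_col A j : vec_norm (col j A) <= op_norm A.
Proof.
by have := op_norm_mul A (delta_mx j 0); rewrite vec_norm_delta mulr1 -colE.
Qed.

Lemma normc_le_op_norm A i j : normc (A i j) <= op_norm A.
Proof.
apply: le_trans (op_norm_col A j); have := normc_le_vec_norm (col j A) i.
by rewrite mxE.
Qed.

Lemma det_mx22 A : \det A = A 0 0 * A 1 1 - A 0 1 * A 1 0.
Proof.
rewrite (expand_det_row _ 0) !big_ord_recl big_ord0 addr0 /cofactor !det_mx11 !mxE /=.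
rewrite /bump /= !(add0n, addn0, add1n) expr0 expr1 mul1r mulN1r mulrN.
by congr (A _ _ * A _ _ - A _ _ * A _ _); apply/val_inj.
Qed.

(** Hadamard: the determinant is at most the product of the column norms, hence at most
    [op_norm A ^+ 2]. Norms at least 1 are where [ln] is 1-Lipschitz. *)
Lemma op_norm_ge1 A : \det A = 1 -> 1 <= op_norm A.
Proof.
move=> dA; have h : 1 <= op_norm A ^+ 2.
  apply: (@le_trans _ _ (vec_norm (col 0 A) * vec_norm (col 1 A))); last first.
    by rewrite expr2 ler_pM ?vec_norm_ge0// op_norm_col.
  have := det_mx22 A; rewrite dA => /(congr1 (@normc R)); rewrite normc1 => ->.
  apply: (le_trans (le_normcD _ _)); rewrite normcN !normcM.
  rewrite !vec_normE !mxE.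
  set a := normc (A 0 0); set b := normc (A 1 0); set c := normc (A 0 1); set d := normc (A 1 1).
  have e0 : 0 <= a * d + c * b by rewrite addr_ge0// mulr_ge0// normc_ge0.
  rewrite -(ger0_norm e0) -sqrtr_sqr -sqrtrM ?addr_ge0 ?sqr_ge0//; apply: ler_wsqrtr.
  have := sqr_ge0 (a * c - b * d); rewrite !expr2; lra.
rewrite -(@ler_pXn2r _ 2)// ?nnegrE ?op_norm_ge0// expr1n//.
Qed.

Lemma ln_dist (x y : R) : 1 <= x -> 1 <= y -> `|ln x - ln y| <= `|x - y|.
Proof.
wlog xy : x y / y <= x => [wl x1 y1|x1 y1].
  have [h|h] := leP y x; first exact: wl.
  by rewrite distrC [leRHS]distrC; apply: wl => //; exact: ltW.
have y0 : 0 < y by exact: lt_le_trans y1.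
have x0 : 0 < x by exact: lt_le_trans x1.
rewrite [leRHS]ger0_norm ?subr_ge0// ger0_norm ?subr_ge0 ?ler_ln//.
rewrite -ln_div//.
have -> : x / y = 1 + (x - y) / y by field; rewrite gt_eqF.
apply: (le_trans (le_ln1Dx _)).
  by apply: (@lt_le_trans _ _ 0); rewrite ?ltrN10// divr_ge0 ?subr_ge0// ltW.
by rewrite ler_pdivrMr// ler_peMr// subr_ge0.
Qed.

End OpNorm.

Section StripContinuity.
Variables (R : realType) (M : R).
Implicit Types f g : R -> R -> R.

(** The strip consists of all real phases and the energies up to [M]. It is not compact, so
    boundedness and uniform continuity are both carried through the algebra; periodicity of [v]
    provides them at the start. *)
Definition strip_bounded f : Prop :=
  exists2 B, 0 <= B & forall t x, `|x| <= M -> `|f t x| <= B.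

Definition strip_unif_continuous f : Prop := forall e, 0 < e -> exists2 d, 0 < d &
  forall t t' x x', `|x| <= M -> `|x'| <= M -> `|t - t'| < d -> `|x - x'| < d ->
    `|f t x - f t' x'| <= e.

Definition strip_regular f := strip_bounded f /\ strip_unif_continuous f.

Lemma strip_regular_cst c : strip_regular (fun _ _ => c).
Proof.
split; first by exists `|c|.
by move=> e e0; exists 1 => // *; rewrite subrr normr0 ltW.
Qed.

Lemma strip_regular_id : strip_regular (fun _ x => x).
Proof.
split; last by move=> e e0; exists e => // t t' x x' _ _ _ /ltW.
by exists `|M| => // _ x hx; apply: (le_trans hx); exact: ler_norm.
Qed.

Lemma strip_regularB f g : strip_regular f -> strip_regular g ->
  strip_regular (fun t x => f t x - g t x).
Proof.
move=> [[B B0 hB] hf] [[C C0 hC] hg]; split.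
  exists (B + C); first exact: addr_ge0.
  by move=> t x hx; apply: (le_trans (ler_normB _ _)); rewrite lerD ?hB ?hC.
move=> e e0; have e2 : 0 < e / 2 by rewrite divr_gt0.
have [d d0 hd] := hf _ e2; have [d' d0' hd'] := hg _ e2.
exists (Num.min d d'); first by rewrite lt_min d0.
move=> t t' x x' hx hx'; rewrite !lt_min => /andP[a1 a2] /andP[b1 b2].
have -> : f t x - g t x - (f t' x' - g t' x') = (f t x - f t' x') - (g t x - g t' x') by ring.
apply: (le_trans (ler_normB _ _)); rewrite [leRHS](splitr e).
by apply: lerD; [exact: hd|exact: hd'].
Qed.

Lemma strip_regularM f g : strip_regular f -> strip_regular g ->
  strip_regular (fun t x => f t x * g t x).
Proof.
move=> [[B B0 hB] hf] [[C C0 hC] hg]; split.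
  exists (B * C); first exact: mulr_ge0.
  by move=> t x hx; rewrite normrM ler_pM// ?hB ?hC.
move=> e e0.
have B1 : 0 < B + 1 by rewrite ltr_wpDl.
have C1 : 0 < C + 1 by rewrite ltr_wpDl.
have [d d0 hd] := hf _ (divr_gt0 (divr_gt0 e0 (ltr0n _ 2)) C1).
have [d' d0' hd'] := hg _ (divr_gt0 (divr_gt0 e0 (ltr0n _ 2)) B1).
exists (Num.min d d'); first by rewrite lt_min d0.
move=> t t' x x' hx hx'; rewrite !lt_min => /andP[a1 a2] /andP[b1 b2].
have -> : f t x * g t x - f t' x' * g t' x' =
   (f t x - f t' x') * g t x + f t' x' * (g t x - g t' x') by ring.
apply: (le_trans (ler_normD _ _)); rewrite !normrM [leRHS](splitr e).
have h1 := hd _ _ _ _ hx hx' a1 b1; have h2 := hd' _ _ _ _ hx hx' a2 b2.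
have h3 := hC t x hx; have h4 := hB t' x' hx'.
apply: lerD.
  rewrite -(divfK (lt0r_neq0 C1) (e / 2)); apply: ler_pM => //.
  by apply: (le_trans h3); rewrite lerDl.
rewrite mulrC -(divfK (lt0r_neq0 B1) (e / 2)); apply: ler_pM => //.
by apply: (le_trans h4); rewrite lerDl.
Qed.

Lemma strip_regular_circle (v : R -> R) c : circle_continuous v ->
  strip_regular (fun t _ => v (t + c)).
Proof.
move=> hv; split.
  have [B hB] := circle_bounded hv; exists B => //.
  by apply: le_trans (hB 0).
move=> e e0; have [d d0 hd] := circle_unif_continuous hv e0.
exists d => // t t' x x' _ _ h _; apply: (hd _ _ 0).
by move: h; congr (`|_| < _); rewrite /=; ring.
Qed.

End StripContinuity.

(** * Transfer matrices as polynomials in the energy *)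

Section Cocycle.
Variables (R : realType) (v : R -> R) (alpha : R).
Hypothesis hv : circle_continuous v.

(** The recursion for solutions of the eigenvalue equation, with the energy as indeterminate; the
    initial pairs [(1, 0)] and [(0, 1)] give the two columns of the cocycle. *)
Fixpoint sol (s : {poly R} * {poly R}) (n : nat) (theta : R) : {poly R} * {poly R} :=
  if n is m.+1 then
    let t := sol s m theta in
    (('X - (v (theta + m%:R * alpha))%:P) * t.1 - t.2, t.1)
  else s.

Definition cocycle_entry (n : nat) (theta : R) (i j : 'I_2) : {poly R} :=
  let t := sol (if j == 0 then (1, 0) else (0, 1)) n theta in
  if i == 0 then t.1 else t.2.

Lemma cocycle_entryE x n theta :
  cocycle v alpha x%:C n theta = \matrix_(i, j) ((cocycle_entry n theta i j).[x])%:C.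
Proof.
elim: n => [|n IH]; apply/matrixP => i j.
  rewrite !mxE /cocycle_entry /=; case: i => -[|[|//]] hi; case: j => -[|[|//]] hj /=;
  by rewrite ?hornerC ?horner0 //.
rewrite /= IH !mxE !big_ord_recl big_ord0 addr0 !mxE /=.
rewrite /cocycle_entry /=; case: i => -[|[|//]] hi /=; last first.
  by rewrite mul1r mul0r addr0.
by rewrite mulN1r !hornerE !(rmorphB, rmorphM).
Qed.

Lemma cocycle_det E n theta : \det (cocycle v alpha E n theta) = 1.
Proof.
elim: n => [|n IH]; first by rewrite det1.
rewrite /= det_mulmx IH mulr1 det_mx22 !mxE /=; ring.
Qed.

Lemma cocycle_entry_regular M n i j : strip_regular M (fun t x => (cocycle_entry n t i j).[x]).
Proof.
rewrite /cocycle_entry; set s := if j == 0 then _ else _.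
have [h1 h2] : strip_regular M (fun t x => (sol s n t).1.[x]) /\
    strip_regular M (fun t x => (sol s n t).2.[x]).
  elim: n => [|n [IH1 IH2]] /=.
    rewrite /s; case: ifP => _ /=; split; under eq_fun do under eq_fun do rewrite hornerC;
    exact: strip_regular_cst.
  split => //; under eq_fun do under eq_fun do rewrite !hornerE.
  apply: strip_regularB => //; apply: strip_regularM => //; apply: strip_regularB.
    exact: strip_regular_id.
  exact: strip_regular_circle.
by case: (i == 0).
Qed.

Definition log_norm n t x : R := ln (op_norm (cocycle v alpha x%:C n t)).

Lemma cocycle_op_norm_ge1 n t x : 1 <= op_norm (cocycle v alpha x%:C n t).
Proof. by apply: op_norm_ge1; exact: cocycle_det. Qed.

Lemma log_norm_unif_continuous M n : strip_unif_continuous M (log_norm n).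
Proof.
move=> e e0; have e4 : 0 < e / 4 by rewrite divr_gt0.
have H i j := (cocycle_entry_regular M n i j).2 _ e4.
have [d00 p00 h00] := H 0 0; have [d01 p01 h01] := H 0 1.
have [d10 p10 h10] := H 1 0; have [d11 p11 h11] := H 1 1.
exists (Num.min (Num.min d00 d01) (Num.min d10 d11)); first by rewrite !lt_min p00 p01 p10.
move=> t t' x x' hx hx'; rewrite !lt_min => /andP[/andP[a1 a2] /andP[a3 a4]] /andP[/andP[b1 b2] /andP[b3 b4]].
rewrite /log_norm; apply: (le_trans (ln_dist (cocycle_op_norm_ge1 _ _ _) (cocycle_op_norm_ge1 _ _ _))).
apply: (le_trans (op_norm_dist _ _)); rewrite !cocycle_entryE /entry_sum.
have E i j : normc ((\matrix_(i, j) ((cocycle_entry n t i j).[x])%:C -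
   \matrix_(i, j) ((cocycle_entry n t' i j).[x'])%:C) i j) =
   `|(cocycle_entry n t i j).[x] - (cocycle_entry n t' i j).[x']|.
  by rewrite !mxE -rmorphB /normc /= expr0n /= addr0 sqrtr_sqr.
rewrite !big_ord_recl !big_ord0 !addr0 !E.
rewrite (_ : lift ord0 ord0 = 1); last exact/val_inj.
have := h00 _ _ _ _ hx hx' a1 b1; have := h01 _ _ _ _ hx hx' a2 b2.
have := h10 _ _ _ _ hx hx' a3 b3; have := h11 _ _ _ _ hx hx' a4 b4.
lra.
Qed.

Lemma cocycle_periodic E n t : cocycle v alpha E n (t + 1) = cocycle v alpha E n t.
Proof.
elim: n => //= n ->; congr (_ *m _); apply/matrixP => i j; rewrite !mxE.
by rewrite addrAC hv.2.
Qed.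

Lemma cocycleD E m n t :
  cocycle v alpha E (m + n) t = cocycle v alpha E m (t + n%:R * alpha) *m cocycle v alpha E n t.
Proof.
elim: m => [|m IH]; first by rewrite mul1mx.
rewrite addSn /= IH mulmxA; congr (transfer _ _ _ *m _ *m _).
by rewrite natrD; ring.
Qed.

Lemma log_normD m n t x :
  log_norm (m + n) t x <= log_norm m (t + n%:R * alpha) x + log_norm n t x.
Proof.
have p k s : 0 < op_norm (cocycle v alpha x%:C k s).
  by apply: lt_le_trans (cocycle_op_norm_ge1 _ _ _).
rewrite /log_norm -lnM ?posrE// ler_ln ?posrE ?mulr_gt0// cocycleD.
exact: op_normM.
Qed.

Lemma log_norm_mul k n t x :
  log_norm (k * n) t x <= \sum_(i < k) log_norm n (t + (i * n)%:R * alpha) x.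
Proof.
elim: k => [|k IH].
  rewrite big_ord0 mul0n /log_norm /= ; apply: ln_le0; apply: op_norm_le => // y.
  by rewrite mul1mx mul1r.
by rewrite big_ord_recr /= mulSn; apply: (le_trans (log_normD _ _ _ _)); rewrite [leLHS]addrC lerD2r.
Qed.

Definition cocycle_poly n theta : {poly R} := (sol (1, 0) n theta).1.

Lemma cocycle_poly_size n theta :
  cocycle_poly n theta \is monic /\ size (cocycle_poly n theta) = n.+1.
Proof.
rewrite /cocycle_poly; set s := (1, 0).
suff [m [e1 e2]] : (sol s n theta).1 \is monic /\
    (size (sol s n theta).1 = n.+1 /\ (size (sol s n theta).2 <= n)%N) by [].
elim: n => [|n [IHm [IH1 IH2]]] /=; first by rewrite monic1 size_poly1 size_poly0.
set p := ('X - _) * _.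
have mp : p \is monic by rewrite monicMl ?monicXsubC.
have sp : size p = n.+2 by rewrite /p (size_monicM (monicXsubC _) (monic_neq0 IHm)) size_XsubC IH1.
have lt : (size (- (sol s n theta).2) < size p)%N.
  by rewrite size_polyN sp ltnS (leq_trans IH2).
split; last by split; [rewrite size_polyDl// sp|rewrite IH1].
by rewrite monicE lead_coefDl// -monicE.
Qed.

Lemma cocycle_poly_le n theta x : `|(cocycle_poly n theta).[x]| <= expR (log_norm n theta x).
Proof.
rewrite /log_norm lnK; last by rewrite posrE (lt_le_trans _ (cocycle_op_norm_ge1 _ _ _)).
have := normc_le_op_norm (cocycle v alpha x%:C n theta) 0 0.
rewrite {1}cocycle_entryE mxE /cocycle_entry /=.
by rewrite /normc /= expr0n /= addr0 sqrtr_sqr.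
Qed.

End Cocycle.

(** * Riemann sums with explicit errors *)

Section StepIntegral.
Variable R : realType.
Implicit Type g : R -> R.
Let mu := @lebesgue_measure R.

Lemma Rintegral_co_bound g (a b c e : R) : a <= b ->
  mu.-integrable `[a, b[ (EFin \o g) ->
  (forall t, a <= t < b -> `|g t - c| <= e) ->
  `|\int[mu]_(t in `[a, b[) g t - c * (b - a)| <= e * (b - a).
Proof.
move=> ab ig h.
have muE : mu `[a, b[ = (b - a)%:E.
  rewrite /mu lebesgue_measure_itv /= lte_fin; case: ltP => // ba.
  have -> : a = b by apply/eqP; rewrite eq_le ab ba.
  by rewrite subrr.
have mu_ab : fine (mu `[a, b[) = b - a by rewrite muE.
have icst k : mu.-integrable `[a, b[ (EFin \o cst k).
  apply: measurable_bounded_integrable => //.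
    by apply: (@le_lt_trans _ _ (b - a)%:E); rewrite ?ltry// -muE.
  by exists `|k|; split => [|r kr]; [exact: num_real|move=> t _ /=; exact: ltW].
rewrite ler_distl -mulrBl -mulrDl; apply/andP; split.
  rewrite -[X in (_ - _) * X]mu_ab -Rintegral_cst//; apply: le_Rintegral => //.
    exact: icst.
  by move=> t /=; rewrite in_itv /= => /h; rewrite ler_distl => /andP[].
rewrite -[X in (_ + _) * X]mu_ab -Rintegral_cst//; apply: le_Rintegral => //.
  exact: icst.
by move=> t /=; rewrite in_itv /= => /h; rewrite ler_distl => /andP[].
Qed.

(** The errors may vary from cell to cell: constant for a uniformly continuous integrand,
    telescoping for a monotone one, zero for a step function. Half-open cells make the last case
    exact. *)
Lemma step_integral g (K : nat) (c e : nat -> R) : (0 < K)%N ->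
  mu.-integrable `[0, 1] (EFin \o g) ->
  (forall j t, (j < K)%N -> j%:R / K%:R <= t < j.+1%:R / K%:R -> `|g t - c j| <= e j) ->
  `|\int[mu]_(t in `[0, 1]) g t - K%:R^-1 * \sum_(j < K) c j| <= K%:R^-1 * \sum_(j < K) e j.
Proof.
move=> K0 ig h; have K0' : 0 < K%:R :> R by rewrite ltr0n.
have sub m : (m <= K)%N -> `[0, m%:R / K%:R[ `<=` `[(0:R), 1].
  move=> mK t /=; rewrite !in_itv /= => /andP[-> /ltW ht] /=; apply: (le_trans ht).
  by rewrite ler_pdivrMr// mul1r ler_nat.
have int m : (m <= K)%N -> mu.-integrable `[0, m%:R / K%:R[ (EFin \o g).
  by move=> mK; apply: (@integrableS _ _ _ mu `[0, 1]) => //; exact: sub.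
have -> : \int[mu]_(t in `[0, 1]) g t = \int[mu]_(t in `[0, K%:R / K%:R[) g t.
  rewrite divff ?gt_eqF// Rintegral_itv_bndo_bndc//.
  by have := int K (leqnn K); rewrite divff ?gt_eqF.
suff : forall m, (m <= K)%N ->
  `|\int[mu]_(t in `[0, m%:R / K%:R[) g t - K%:R^-1 * \sum_(j < m) c j| <= K%:R^-1 * \sum_(j < m) e j.
  by apply.
elim=> [|m IH] mK.
  rewrite !big_ord0 !mulr0 mul0r subr0 set_itvco0 Rintegral_set0 normr0//.
have mm : m%:R / K%:R <= m.+1%:R / K%:R :> R by rewrite ler_pM2r ?invr_gt0// ler_nat.
have m0 : 0 <= m%:R / K%:R :> R by rewrite divr_ge0.
have U : [set` `[0, m.+1%:R / K%:R[] = `[0, m%:R / K%:R[ `|` `[m%:R / K%:R, (m.+1%:R / K%:R : R)[.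
  by rewrite -itv_bndbnd_setU// bnd_simp.
rewrite U Rintegral_setU//; last 2 first.
- by rewrite -U; exact: int.
- apply/disj_setPS => t /=; rewrite !in_itv /= => -[/andP[_ a1] /andP[a2 _]].
  by move: (lt_le_trans a1 a2); rewrite ltxx.
rewrite !big_ord_recr /= !mulrDr.
have := IH (ltnW mK); set A := \int[mu]_(t in `[0, _[) _; set B := \int[mu]_(t in _) _.
have dm : m.+1%:R / K%:R - m%:R / K%:R = K%:R^-1 :> R by rewrite -mulrBl -natr1 addrAC subrr add0r mul1r.
have : `|B - c m * (m.+1%:R / K%:R - m%:R / K%:R)| <= e m * (m.+1%:R / K%:R - m%:R / K%:R).
  apply: Rintegral_co_bound => //; last by move=> t; exact: h.
  by apply: (@integrableS _ _ _ mu `[0, m.+1%:R / K%:R[) => //; [rewrite U; exact: subsetUr|exact: int].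
rewrite dm => h1 h2.
have -> : A + B - (K%:R^-1 * (\sum_(j < m) c j) + K%:R^-1 * c m) =
  (A - K%:R^-1 * (\sum_(j < m) c j)) + (B - c m * K%:R^-1) by ring.
by apply: (le_trans (ler_normD _ _)); rewrite [K%:R^-1 * e m]mulrC lerD.
Qed.

End StepIntegral.

Section Riemann.
Variable R : realType.
Let mu := @lebesgue_measure R.

Lemma sum_periodic_shift (K : nat) (h : int -> R) (a : int) :
  (forall i, h (i + K%:Z) = h i) -> \sum_(j < K) h (a + j%:Z) = \sum_(j < K) h j%:Z.
Proof.
move=> hK.
have S1 b : \sum_(j < K) h (b + 1 + j%:Z) = \sum_(j < K) h (b + j%:Z).
  apply/eqP; rewrite -subr_eq0; apply/eqP.
  transitivity (h (b + K%:Z) - h b); last by rewrite hK subrr.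
  rewrite -sumrB -(big_mkord xpredT (fun j => h (b + 1 + j%:Z) - h (b + j%:Z))).
  rewrite (eq_bigr (fun j => (fun j : nat => h (b + j%:Z)) j.+1 - (fun j : nat => h (b + j%:Z)) j)).
    by rewrite telescope_sumr// addr0.
  by move=> j _ /=; congr (h _ - _); rewrite -addrA; congr (_ + _); lia.
have pos (k : nat) b : \sum_(j < K) h (b + k%:Z + j%:Z) = \sum_(j < K) h (b + j%:Z).
  elim: k => [|k IH]; first by under eq_bigr do rewrite addr0.
  rewrite -IH -(S1 (b + k%:Z)); apply: eq_bigr => j _; congr (h (_ + _)).
  by rewrite -addrA; congr (_ + _); lia.
have z0 : \sum_(j < K) h (0 + j%:Z) = \sum_(j < K) h j%:Z by under eq_bigr do rewrite add0r.
case: a => k; first by rewrite -z0 -(pos k 0); under [RHS]eq_bigr do rewrite add0r.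
rewrite -z0 -(pos k.+1 (Negz k)); apply: eq_bigr => j _; congr (h (_ + _)); lia.
Qed.

(** Modulo 1 the phases [t + j / K] are a cyclic permutation of [r + j / K] with [0 <= r < 1 / K],
    so every starting phase obeys the same bound. *)
Lemma riemann_periodic (f : R -> R) (d e t : R) (K : nat) : (0 < K)%N -> 0 <= e ->
  (forall x, f (x + 1) = f x) -> mu.-integrable `[0, 1] (EFin \o f) ->
  K%:R^-1 < d -> (forall x y, `|x - y| < d -> `|f x - f y| <= e) ->
  \sum_(j < K) f (t + j%:R / K%:R) <= K%:R * (\int[mu]_(x in `[0, 1]) f x + e).
Proof.
move=> K0 e0 fp fint Kd fd; have K0' : 0 < K%:R :> R by rewrite ltr0n.
pose m := Num.floor (t * K%:R); pose r := t - m%:~R / K%:R.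
have /andP[m1 m2] := floor_itv (t * K%:R); rewrite -/m in m1 m2.
have r0 : 0 <= r by rewrite subr_ge0 ler_pdivrMr.
have r1 : r < K%:R^-1.
  by rewrite /r ltrBlDr -[X in X + _]mul1r -mulrDl ltr_pdivlMr//; move: m2; rewrite rmorphD /=; lra.
pose h (i : int) := f (r + i%:~R / K%:R).
have hK i : h (i + K%:Z) = h i.
  rewrite /h intrD mulrDl -pmulrn divff ?gt_eqF// addrA; exact: fp.
have -> : \sum_(j < K) f (t + j%:R / K%:R) = \sum_(j < K) f (r + j%:R / K%:R).
  rewrite -[RHS](sum_periodic_shift m hK); apply: eq_bigr => j _; rewrite /h /r; congr f.
  by rewrite intrD -pmulrn; field; rewrite gt_eqF.
have : `|\int[mu]_(x in `[0, 1]) f x - K%:R^-1 * \sum_(j < K) f (r + j%:R / K%:R)| <=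
   K%:R^-1 * \sum_(j < K) e.
  apply: (step_integral (c := fun j => f (r + j%:R / K%:R)) (e := fun=> e)) => // j x jK /andP[x1 x2]; apply: fd.
  have E : j.+1%:R / K%:R = j%:R / K%:R + K%:R^-1 :> R by rewrite -natr1 mulrDl mul1r.
  by rewrite {}E in x2; rewrite ltr_norml; apply/andP; split; lra.
rewrite sumr_const card_ord -[e *+ K]mulr_natl mulKf ?gt_eqF//.
rewrite ler_norml => /andP[h1 _].
by rewrite -ler_pdivrMl//; lra.
Qed.

End Riemann.

Section SmallPolynomial.
Variables (R : realType) (v : R -> R) (alpha : R).
Hypothesis hv : circle_continuous v.
Hypothesis hL : forall x, spec v alpha 0 x -> lyapunov v alpha x%:C = 0.
Let mu := @lebesgue_measure R.
Local Notation F := (log_norm v alpha).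

Let F_periodic n t x : F n (t + 1) x = F n t x.
Proof. by rewrite /log_norm cocycle_periodic. Qed.

Let F_integrable n x : mu.-integrable `[0, 1] (EFin \o (F n ^~ x)).
Proof.
apply: continuous_compact_integrable; first exact: segment_compact.
apply: continuous_subspaceT => t; apply/cvgrPdist_le => e e0.
have [d d0 hd] := log_norm_unif_continuous (v := v) alpha hv `|x| n e0.
exists d => //= t' tt'; apply: hd => //.
by rewrite subrr normr0.
Qed.

(** The average of [F n] over [K] equally spaced phases is at most [n * e], for every starting phase
    [t]. This uniformity in [t] is what [good_mul] rests on. *)
Let good (x e : R) (n K0 : nat) : Prop :=
  forall (K : nat) t, (0 < K)%N -> (K0 <= K)%N ->
    \sum_(j < K) F n (t + j%:R / K%:R) x <= n%:R * e * K%:R.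

(** The cocycle of length [k * n] splits into [k] blocks of length [n] that differ only in the
    starting phase, and each block satisfies the same bound. *)
Let good_mul x e n K0 k : good x e n K0 -> good x e (k * n) K0.
Proof.
move=> h K t K0' hK; apply: (le_trans (ler_sum _ (fun j _ => log_norm_mul _ _ _ _ _ _))) => //.
rewrite exchange_big /=.
have -> : (k * n)%:R * e * K%:R = \sum_(i < k) (n%:R * e * K%:R).
  by rewrite sumr_const card_ord -mulr_natl natrM; ring.
apply: ler_sum => i _.
apply: le_trans (h K (t + (i * n)%:R * alpha) K0' hK).
by apply: ler_sum => j _; rewrite addrAC.
Qed.

(** Since the infimum defining the exponent is 0, some [n] has average below [e]. Of the additional
    [n * e], half pays for the Riemann sum and half for replacing [x0] by [x]. *)
Let good_near x0 e : 0 < e -> spec v alpha 0 x0 ->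
  exists n K0 d, [/\ (0 < n)%N, 0 < d & forall x, `|x - x0| < d -> good x (2 * e) n K0].
Proof.
move=> e0 hx0.
have [n n0 hn] : exists2 n, (0 < n)%N & n%:R^-1 * \int[mu]_(t in `[0, 1]) F n t x0 < e.
  apply: contrapT => hn; have := hL hx0; rewrite /lyapunov => L0.
  have : e <= 0; last by rewrite leNgt e0.
  rewrite -L0; apply: lb_le_inf; first by eexists; exists 1%N.
  move=> _ [n /= n0 <-]; rewrite leNgt; apply/negP => hlt; apply: hn; exists n => //.
have nR : 0 < n%:R :> R by rewrite ltr0n.
have ne2 : 0 < n%:R * e / 2 by rewrite divr_gt0// mulr_gt0.
have [d d0 hd] := log_norm_unif_continuous (v := v) alpha hv (`|x0| + 1) n ne2.
have x01 : `|x0| <= `|x0| + 1 by rewrite lerDl.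
exists n, (Num.truncn d^-1).+1, (Num.min 1 d); split => //; first by rewrite lt_min ltr01.
move=> x; rewrite lt_min => /andP[xx1 xxd] K t K0 hK.
have xM : `|x| <= `|x0| + 1.
  by have := ler_normD (x - x0) x0; rewrite subrK; lra.
have K0' : 0 < K%:R :> R by rewrite ltr0n.
have Kd : K%:R^-1 < d.
  rewrite invf_plt ?posrE//; apply: lt_le_trans (truncnS_gt _) _; by rewrite ler_nat.
have hR : \sum_(j < K) F n (t + j%:R / K%:R) x0 <=
    K%:R * (\int[mu]_(t in `[0, 1]) F n t x0 + n%:R * e / 2).
  apply: (@riemann_periodic _ (F n ^~ x0) d) => //; first exact: ltW.
  by move=> y z yz; apply: hd => //; rewrite subrr normr0.
have h1 : \sum_(j < K) F n (t + j%:R / K%:R) x <=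
    \sum_(j < K) (F n (t + j%:R / K%:R) x0 + n%:R * e / 2).
  apply: ler_sum => j _; rewrite -lerBlDl.
  by apply: le_trans (ler_norm _) _; apply: hd => //; rewrite subrr normr0.
apply: (le_trans h1); rewrite big_split /=.
have -> : \sum_(j < K) (n%:R * e / 2) = K%:R * (n%:R * e / 2).
  by rewrite sumr_const card_ord [RHS]mulr_natl.
apply: (@le_trans _ _ (K%:R * (\int[mu]_(t in `[0, 1]) F n t x0 + n%:R * e / 2) + K%:R * (n%:R * e / 2))).
  by rewrite lerD2r.
set I := \int[mu]_(t in _) _ in hn *.
have -> : K%:R * (I + n%:R * e / 2) + K%:R * (n%:R * e / 2) = K%:R * (I + n%:R * e) by field.
have -> : n%:R * (2 * e) * K%:R = K%:R * (n%:R * e + n%:R * e) by ring.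
by rewrite ler_pM2l// lerD2r ltW// -ltr_pdivrMl.
Qed.

Lemma spec_compact beta theta : compact (spec v beta theta).
Proof.
have [M M1 hM] := spec_bounded hv.
apply: (@subclosed_compact _ _ `[- M, M]); first exact: spec_closed.
  exact: segment_compact.
by move=> x /hM; rewrite ler_norml /= in_itv.
Qed.

(* Finitely many cocycle lengths work on neighbourhoods covering the compact spectrum, so the length
   [m`!] works everywhere for large [m]; [Q] is the product over [j < m] of the upper left entries of
   the cocycle of that length at phase [j / m]. *)
Lemma small_polynomial e : 0 < e -> exists Q : {poly R},
  [/\ Q \is monic, (1 < size Q)%N &
      forall x, spec v alpha 0 x -> `|Q.[x]| <= expR ((size Q).-1%:R * e)].
Proof.
move=> e0; have e2 : 0 < e / 2 by rewrite divr_gt0.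
have /compact_near_coveringP cov := @spec_compact alpha 0.
have : \forall m \near \oo, spec v alpha 0 `<=` (fun x => good x e m`! m).
  apply: cov => x0 hx0; have [n [K0 [d [n0 d0 hd]]]] := good_near e2 hx0.
  exists (ball x0 d, [set m | (maxn n K0 <= m)%N]) => /=.
    by split; [exact: nbhsx_ballx|exists (maxn n K0)].
  move=> [x m] /= [bx hm].
  have ndvd : (n %| m`!)%N by rewrite dvdn_fact// n0 (leq_trans (leq_maxl _ _) hm).
  rewrite -(divnK ndvd); apply: good_mul => K t K1 hK.
  rewrite [e](_ : _ = 2 * (e / 2)); last by rewrite mulrC divfK.
  apply: hd => //; first by rewrite distrC.
  by rewrite (leq_trans _ hK)// (leq_trans (leq_maxr _ _) hm).
move=> [m0 _ hm0]; pose m := m0.+1; have hm := hm0 m (leqnSn _).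
pose Q : {poly R} := \prod_(j < m) cocycle_poly v alpha m`! (j%:R / m%:R).
have Qm : Q \is monic by apply: monic_prod => j _; exact: (cocycle_poly_size v alpha _ _).1.
have Qs : size Q = (m * m`!).+1.
  rewrite /Q size_prod; last by move=> j _; apply: monic_neq0; exact: (cocycle_poly_size v alpha _ _).1.
  rewrite (eq_bigr (fun=> m`!.+1)) => [|j _]; last exact: (cocycle_poly_size v alpha _ _).2.
  by rewrite sum_nat_const card_ord mulnS -addnS addnC addnK.
exists Q; split => //; first by rewrite Qs ltnS muln_gt0 fact_gt0.
move=> x /hm /(_ m 0 isT (leqnn _)) h.
rewrite Qs /= /Q horner_prod normr_prod.
apply: (@le_trans _ _ (\prod_(j < m) expR (F m`! (0 + j%:R / m%:R) x))).
  by apply: ler_prod => j _; rewrite normr_ge0 add0r /=; exact: cocycle_poly_le.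
rewrite -expR_sum ler_expR; apply: (le_trans h).
by rewrite natrM le_eqVlt; apply/orP; left; apply/eqP; ring.
Qed.

End SmallPolynomial.

(** * Truncated logarithmic energy *)

Section TruncatedLog.
Variables (R : realType) (D : R).
Hypothesis D0 : 0 < D.
Implicit Types r d s : R.

(* The convex function [r |-> ln (D / r)], continued below [d] by its tangent at [d]. *)
Definition tlog d r : R := ln (D / Num.max r d) + 1 - r / Num.max r d.

Lemma ln_le_sub1 (x : R) : 0 < x -> ln x <= x - 1.
Proof.
move=> x0; have := @le_ln1Dx R (x - 1).
by rewrite (_ : 1 + (x - 1) = x); [apply; lra|ring].
Qed.

Lemma tlog_far d r : 0 < d -> d <= r -> tlog d r = ln (D / r).
Proof.
move=> d0 dr; rewrite /tlog max_l// divff ?addrK// gt_eqF//; exact: lt_le_trans dr.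
Qed.

(** The tangent of the convex function at any [s >= d] lies below it. Positivity, monotonicity in
    [d], the Lipschitz bound and convexity of [tlog] all follow by suitable choices of [s], mostly
    [D] or [Num.max r d]. *)
Lemma tlog_tangent d r s : 0 < d -> 0 <= r -> d <= s ->
  ln (D / s) + 1 - r / s <= tlog d r.
Proof.
move=> d0 r0 ds; have s0 : 0 < s by exact: lt_le_trans ds.
rewrite /tlog; have [dr|rd] := leP d r.
  have rp : 0 < r by exact: lt_le_trans dr.
  have := ln_le_sub1 (divr_gt0 rp s0); rewrite !ln_div ?posrE//.
  by rewrite divff ?gt_eqF//; lra.
have h := ln_le_sub1 (divr_gt0 d0 s0).
have h2 : d / s <= 1 by rewrite ler_pdivrMr// mul1r.
have h3 : r / d <= 1 by rewrite ler_pdivrMr// mul1r ltW.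
have h4 : r / s = (r / d) * (d / s) by field; rewrite !gt_eqF.
(* On the tangent part the comparison is between two lines; this product is the excess left after
   [ln (d / s) <= d / s - 1]. *)
have h5 : 0 <= (1 - r / d) * (1 - d / s) by rewrite mulr_ge0 ?subr_ge0.
move: h; rewrite !ln_div ?posrE// h4; move: h5; lra.
Qed.

Lemma tlog_ge0 d r : 0 < d -> d <= D -> 0 <= r -> r <= D -> 0 <= tlog d r.
Proof.
move=> d0 dD r0 rD; apply: le_trans (tlog_tangent d0 r0 dD).
by rewrite divff ?gt_eqF// ln1 add0r subr_ge0 ler_pdivrMr// mul1r.
Qed.

Lemma tlog_lb d r : 0 < d -> d <= D -> 0 <= r -> 1 - r / D <= tlog d r.
Proof.
move=> d0 dD r0; apply: le_trans (tlog_tangent d0 r0 dD).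
by rewrite divff ?gt_eqF// ln1 add0r.
Qed.

Lemma tlog_le d r : 0 < d -> 0 < r -> tlog d r <= ln (D / r).
Proof.
move=> d0 r0; have [dr|rd] := leP d r; first by rewrite tlog_far.
rewrite /tlog max_r ?(ltW rd)//.
by have := ln_le_sub1 (divr_gt0 r0 d0); rewrite !ln_div ?posrE//; lra.
Qed.

Lemma tlog_at0 d : 0 < d -> tlog d 0 = ln (D / d) + 1.
Proof. by move=> d0; rewrite /tlog max_r ?(ltW d0)// mul0r subr0. Qed.

Lemma tlog_mono d d' r : 0 < d' -> d' <= d -> 0 <= r -> tlog d r <= tlog d' r.
Proof.
move=> d0 dd r0; apply: (tlog_tangent d0 r0).
by rewrite le_max dd orbT.
Qed.

Lemma tlog_close d r : 0 < d -> 0 <= r -> r <= d -> ln (D / d) <= tlog d r.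
Proof.
move=> d0 r0 rd; rewrite /tlog max_r// -addrA lerDl subr_ge0.
by rewrite ler_pdivrMr// mul1r.
Qed.

Lemma tlog_lipschitz d r r' : 0 < d -> 0 <= r -> 0 <= r' ->
  `|tlog d r - tlog d r'| <= d^-1 * `|r - r'|.
Proof.
move=> d0.
suff h : forall r r', 0 <= r -> 0 <= r' -> tlog d r - tlog d r' <= d^-1 * `|r - r'|.
  move=> h0 h0'; rewrite ler_norml h// andbT lerNl opprB distrC; exact: h.
move=> {}r {}r' r0 r0'; set s := Num.max r d.
have ds : d <= s by rewrite le_max lexx orbT.
have s0 : 0 < s by exact: lt_le_trans ds.
have := tlog_tangent d0 r0' ds => h; have E : tlog d r = ln (D / s) + 1 - r / s by [].
rewrite E.
apply: (@le_trans _ _ ((r' - r) / s)); first by rewrite mulrBl; move: h; lra.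
apply: (@le_trans _ _ (`|r - r'| / s)).
  by rewrite ler_pM2r ?invr_gt0// distrC ler_norm.
by rewrite mulrC ler_wpM2r// lef_pV2 ?posrE.
Qed.

Lemma tlog_convex d (r h : R) : 0 < d -> 0 <= r - h -> 0 <= h ->
  2 * tlog d r <= tlog d (r - h) + tlog d (r + h).
Proof.
move=> d0 rh h0; have r0 : 0 <= r by lra.
set s := Num.max r d; have ds : d <= s by rewrite le_max lexx orbT.
have := tlog_tangent d0 rh ds; have := tlog_tangent d0 (addr_ge0 r0 h0) ds.
have -> : tlog d r = ln (D / s) + 1 - r / s by [].
by rewrite !mulrDl; lra.
Qed.

End TruncatedLog.

Section Mean.
Variable R : realType.
Implicit Types (f g : R -> R) (X : set R).

Definition lip f : Prop := exists L, forall x y, `|f x - f y| <= L * `|x - y|.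

(* Normalized positive linear functionals on Lipschitz functions: integration against a
   probability measure carried by [X] is the example in mind. *)
Definition mean X (Lam : (R -> R) -> R) : Prop :=
  [/\ forall a f g, lip f -> lip g -> Lam (fun x => a * f x + g x) = a * Lam f + Lam g,
      Lam (fun=> 1) = 1 &
      forall f, lip f -> (forall x, X x -> 0 <= f x) -> 0 <= Lam f].

Lemma lip_cst c : lip (fun=> c).
Proof. by exists 0 => x y; rewrite subrr normr0 mul0r. Qed.

Lemma lipD a f g : lip f -> lip g -> lip (fun x => a * f x + g x).
Proof.
move=> [L hL] [L' hL']; exists (`|a| * L + L') => x y.
have -> : a * f x + g x - (a * f y + g y) = a * (f x - f y) + (g x - g y) by ring.
apply: (le_trans (ler_normD _ _)); rewrite mulrDl normrM -mulrA.
by apply: lerD => //; exact: ler_wpM2l.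
Qed.

Lemma lipZ a f : lip f -> lip (fun x => a * f x).
Proof.
move=> lf; have := lipD a lf (lip_cst 0).
by under [X in lip X]eq_fun do rewrite addr0.
Qed.

Lemma lip_sum (I : Type) (s : seq I) (F : I -> R -> R) :
  (forall i, lip (F i)) -> lip (fun x => \sum_(i <- s) F i x).
Proof.
move=> h; elim: s => [|i s IH].
  by under [X in lip X]eq_fun do rewrite big_nil; exact: lip_cst.
have := lipD 1 (h i) IH.
by under [X in lip X -> _]eq_fun do rewrite mul1r -(big_cons _ _ i s xpredT (F ^~ _)).
Qed.

Section MeanTheory.
Variables (X : set R) (Lam : (R -> R) -> R).
Hypothesis mL : mean X Lam.

Lemma meanD f g : lip f -> lip g -> Lam (fun x => f x + g x) = Lam f + Lam g.
Proof.
case: mL => h _ _ lf lg; have := h 1 f g lf lg; rewrite mul1r => <-.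
by congr Lam; apply: funext => x; rewrite mul1r.
Qed.

Lemma mean0 : Lam (fun=> 0) = 0.
Proof.
have := meanD (lip_cst 0) (lip_cst 0); under [X in Lam X]eq_fun do rewrite addr0.
by move/eqP; rewrite -subr_eq0 opprD addNKr oppr_eq0 => /eqP.
Qed.

Lemma meanZ a f : lip f -> Lam (fun x => a * f x) = a * Lam f.
Proof.
case: mL => h _ _ lf; have := h a f _ lf (lip_cst 0).
by rewrite mean0 addr0; under [X in Lam X]eq_fun do rewrite addr0.
Qed.

Lemma mean_cst c : Lam (fun=> c) = c.
Proof.
case: mL => h h1 _; have : Lam (fun=> c * 1) = c * Lam (fun=> 1) := meanZ c (lip_cst 1).
by rewrite h1 !mulr1.
Qed.

Lemma meanB f g : lip f -> lip g -> Lam (fun x => f x - g x) = Lam f - Lam g.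
Proof.
case: mL => h _ _ lf lg; have := h (-1) g f lg lf; rewrite mulN1r addrC => <-.
by congr Lam; apply: funext => x; rewrite mulN1r addrC.
Qed.

Lemma mean_le f g : lip f -> lip g -> (forall x, X x -> f x <= g x) -> Lam f <= Lam g.
Proof.
move=> lf lg h; rewrite -subr_ge0 -meanB//; case: mL => _ _; apply.
  by have := lipD (- 1) lf lg; under [X in lip X -> _]eq_fun do rewrite mulN1r addrC.
by move=> x /h; rewrite subr_ge0.
Qed.

Lemma mean_dist_le f g e : lip f -> lip g -> (forall x, X x -> `|f x - g x| <= e) ->
  `|Lam f - Lam g| <= e.
Proof.
move=> lf lg h.
have le' u w : lip u -> lip w -> (forall x, X x -> `|u x - w x| <= e) -> Lam u - Lam w <= e.
  move=> lu lw h'; rewrite lerBlDl -(mean_cst e) -meanD//; last exact: lip_cst.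
  apply: mean_le => //.
    by have := lipD 1 lw (lip_cst e); under [X in lip X -> _]eq_fun do rewrite mul1r.
  by move=> x /h' /ler_normlW; rewrite lerBlDl.
rewrite ler_norml le'// andbT lerNl opprB le'// => x /h.
by rewrite distrC.
Qed.

Lemma mean_sum (I : Type) (s : seq I) (F : I -> R -> R) :
  (forall i, lip (F i)) -> Lam (fun x => \sum_(i <- s) F i x) = \sum_(i <- s) Lam (F i).
Proof.
move=> h; elim: s => [|i s IH].
  by rewrite big_nil; under [X in Lam X]eq_fun do rewrite big_nil; exact: mean0.
rewrite big_cons -IH -meanD//; last exact: lip_sum.
by congr Lam; apply: funext => x; rewrite big_cons.
Qed.

Lemma mean_attained f e : lip f -> 0 < e -> exists2 x, X x & f x <= Lam f + e.
Proof.
move=> lf e0; apply: contrapT => hn.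
have : Lam f + e <= Lam f; last by rewrite gerDl leNgt e0.
rewrite -[leLHS]mean_cst; apply: mean_le => //; first exact: lip_cst.
by move=> x Xx; apply/ltW; rewrite ltNge; apply/negP => h; apply: hn; exists x.
Qed.

End MeanTheory.

Lemma mean_sub X Y Lam : X `<=` Y -> mean X Lam -> mean Y Lam.
Proof. by move=> XY [h1 h2 h3]; split => // f lf h; apply: h3 => // x /XY/h. Qed.

Lemma mean_avg X Lam Lam' : mean X Lam -> mean X Lam' ->
  mean X (fun f => (Lam f + Lam' f) / 2).
Proof.
move=> [h1 h2 h3] [k1 k2 k3]; split.
- by move=> a f g lf lg; rewrite h1// k1//; field.
- by rewrite h2 k2; field.
- by move=> f lf h; rewrite divr_ge0// addr_ge0// ?h3 ?k3.
Qed.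

End Mean.

Fixpoint pair_sum (R : nmodType) (T : Type) (k : T -> T -> R) (s : seq T) : R :=
  if s is x :: s' then \sum_(y <- s') k x y + pair_sum k s' else 0.

Lemma pair_sumE (R : nmodType) (T : Type) (x0 : T) (k : T -> T -> R) (s : seq T) :
  pair_sum k s = \sum_(i < size s) \sum_(j < size s | (i < j)%N) k (nth x0 s i) (nth x0 s j).
Proof.
elim: s => [|x s IH]; first by rewrite big_ord0.
rewrite /= big_ord_recl IH; congr (_ + _).
  rewrite [RHS]big_mkcond [RHS]big_ord_recl /= add0r (big_nth x0) big_mkord.
  by apply: eq_bigr => j _.
apply: eq_bigr => i _; rewrite [RHS]big_mkcond [RHS]big_ord_recl /= add0r [LHS]big_mkcond.
by apply: eq_bigr => j _; rewrite /bump /= !add1n ltnS.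
Qed.

(** * Products of distances as determinants *)

Section Vandermonde.
Variable R : realType.

(** The matrix is the Vandermonde matrix multiplied by the coefficient matrix of the [q k], which is
    triangular with unit diagonal. *)
Lemma vandermonde_monic (m : nat) (z : 'I_m -> R) (q : 'I_m -> {poly R}) :
  (forall k, q k \is monic) -> (forall k : 'I_m, size (q k) = k.+1) ->
  \det (\matrix_(k, i) (q k).[z i]) = \prod_(i < m) \prod_(j < m | (i < j)%N) (z j - z i).
Proof.
move=> qm qs.
have -> : \matrix_(k, i) (q k).[z i] =
    (\matrix_(k, l) (q k)`_l) *m Vandermonde m (\row_i z i).
  apply/matrixP => k i; rewrite !mxE (@horner_coef_wide _ m) ?qs//.
  by apply: eq_bigr => l _; rewrite !mxE.
rewrite det_mulmx det_Vandermonde det_trig.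
  rewrite big1 ?mul1r => [|k _]; last first.
    by rewrite mxE; have := monicP (qm k); rewrite /lead_coef qs.
  by apply: eq_bigr => i _; apply: eq_bigr => j _; rewrite !mxE.
by apply/is_trig_mxP => k l kl; rewrite mxE nth_default// qs.
Qed.

Lemma det_le (m : nat) (A : 'M[R]_m) (b : 'I_m -> R) :
  (forall k i, `|A k i| <= b k) -> `|\det A| <= m`!%:R * \prod_k b k.
Proof.
move=> h; rewrite /determinant; apply: (le_trans (ler_norm_sum _ _ _)).
apply: (@le_trans _ _ (\sum_(s : 'S_m) \prod_k b k)).
  apply: ler_sum => s _; rewrite normrM normrX normrN1 expr1n mul1r normr_prod.
  by apply: ler_prod => k _; rewrite normr_ge0 h.
by rewrite sumr_const card_Sn mulr_natl.
Qed.

(** The determinant is taken in the monic basis [Q ^+ (k %/ n) * 'X^(k %% n)]: on the points the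
    power of [Q] is at most [expR (k%:R * e)] and the power of ['X] at most [B ^+ n]. Only the first
    factor is exponential in [k]. *)
Lemma distances_le (m n : nat) (z : 'I_m -> R) (Q : {poly R}) (e B : R) :
  (0 < n)%N -> Q \is monic -> size Q = n.+1 -> 0 <= e -> 1 <= B ->
  (forall i, `|z i| <= B) -> (forall i, `|Q.[z i]| <= expR (n%:R * e)) ->
  \prod_(i < m) \prod_(j < m | (i < j)%N) `|z j - z i| <=
  m`!%:R * \prod_(k < m) (expR (k%:R * e) * B ^+ n).
Proof.
move=> n0 Qm Qs e0 B1 hz hQ.
pose q (k : 'I_m) : {poly R} := Q ^+ (k %/ n) * 'X^(k %% n).
have qm k : q k \is monic by rewrite monicMr ?monicXn// monic_exp.
have qs (k : 'I_m) : size (q k) = k.+1.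
  rewrite size_monicM ?monic_exp// ?monic_neq0 ?monicXn// size_polyXn addnS /=.
  have := size_exp Q (k %/ n); rewrite Qs /= => h.
  have : (0 < size (Q ^+ (k %/ n)))%N by rewrite size_poly_gt0 monic_neq0// monic_exp.
  case: (size _) h => //= a -> _; rewrite addSn mulnC -divn_eq//.
have -> : \prod_(i < m) \prod_(j < m | (i < j)%N) `|z j - z i| =
    `|\det (\matrix_(k, i) (q k).[z i])|.
  rewrite vandermonde_monic// normr_prod; apply: eq_bigr => i _.
  by rewrite normr_prod.
apply: det_le => k i; rewrite mxE /q hornerM horner_exp hornerXn normrM !normrX.
apply: ler_pM; rewrite ?exprn_ge0//.
  apply: (@le_trans _ _ (expR (n%:R * e) ^+ (k %/ n))).
    by rewrite lerXn2r// ?nnegrE ?expR_ge0.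
  rewrite -expRM_natl ler_expR mulrA -natrM ler_wpM2r// ler_nat.
  exact: leq_trunc_div.
apply: (@le_trans _ _ (B ^+ (k %% n))).
  by rewrite lerXn2r// ?nnegrE ?(le_trans _ B1).
by rewrite ler_weXn2l// ltnW// ltn_mod.
Qed.

End Vandermonde.

(** * Energy of functionals and its lower bound *)

Section Energy.
Variables (R : realType) (M : R).
Hypothesis M0 : 0 < M.
Let D := 2 * M.
Let D0 : 0 < D. Proof. by rewrite mulr_gt0. Qed.
Implicit Types (X : set R) (Lam : (R -> R) -> R).

Definition kernel (d x y : R) : R := tlog D d `|x - y|.

Definition energy d Lam Lam' : R := Lam (fun x => Lam' (kernel d x)).

Lemma kernel_lipschitz d x y y' : 0 < d ->
  `|kernel d x y - kernel d x y'| <= d^-1 * `|y - y'|.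
Proof.
move=> d0; apply: (le_trans (tlog_lipschitz D0 d0 _ _)) => //.
apply: ler_wpM2l; first by rewrite invr_ge0 ltW.
apply: (le_trans (ler_dist_dist _ _)).
by rewrite (_ : x - y - (x - y') = - (y - y')) ?normrN//; ring.
Qed.

Lemma kernelC d x y : kernel d x y = kernel d y x.
Proof. by rewrite /kernel distrC. Qed.

Lemma lip_kernel d x : 0 < d -> lip (kernel d x).
Proof. by move=> d0; exists d^-1 => y y'; exact: kernel_lipschitz. Qed.

Lemma potential_lipschitz X Lam d x x' : mean X Lam -> 0 < d ->
  `|Lam (kernel d x) - Lam (kernel d x')| <= d^-1 * `|x - x'|.
Proof.
move=> mL d0; apply: (mean_dist_le mL) => [||y _]; try exact: lip_kernel.
by rewrite !(kernelC d _ y); exact: kernel_lipschitz.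
Qed.

Lemma lip_potential X Lam d : mean X Lam -> 0 < d -> lip (fun x => Lam (kernel d x)).
Proof. by move=> mL d0; exists d^-1 => x x'; exact: potential_lipschitz mL d0. Qed.

(* The greedy choice of each new point does not increase the conditional expectation of the
   total energy, the remaining points being distributed along [Lam]. *)
Lemma low_energy_points X Lam d e (r : nat) (s : seq R) : mean X Lam -> 0 < d -> 0 < e ->
  exists s', [/\ size s' = r, forall x, x \in s' -> X x &
    pair_sum (kernel d) (s' ++ s) <= pair_sum (kernel d) s
      + r%:R * \sum_(y <- s) Lam (kernel d y) + 'C(r, 2)%:R * energy d Lam Lam + r%:R * e].
Proof.
move=> mL d0 e0; elim: r s => [|r IH] s.
  by exists [::]; split => //=; rewrite !mul0r !addr0.
have lk := lip_kernel _ d0; have lU := lip_potential mL d0.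
(* What the choice of [x] adds: its interaction with the points already chosen and the expected
   interaction with the [r] points still to come. *)
pose f x := \sum_(y <- s) kernel d y x + r%:R * Lam (kernel d x).
have ls : lip (fun x => \sum_(y <- s) kernel d y x) by apply: lip_sum => y; exact: lk.
have lf : lip f.
  have := lipD r%:R lU ls; congr lip; apply: funext => x; exact: addrC.
have [x Xx hx] := mean_attained mL lf e0.
have fE : Lam f = \sum_(y <- s) Lam (kernel d y) + r%:R * energy d Lam Lam.
  rewrite /f (meanD mL)//; last exact: lipZ.
  by rewrite (meanZ mL)// (mean_sum mL).
have [s' [ss' Xs' hs']] := IH (x :: s).
exists (rcons s' x); split.
- by rewrite size_rcons ss'.
- by move=> y; rewrite mem_rcons inE => /predU1P[->//|]; exact: Xs'.
rewrite cat_rcons; apply: (le_trans hs'); rewrite /= big_cons binS bin1 natrD.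
have -> : \sum_(y <- s) kernel d x y = \sum_(y <- s) kernel d y x.
  by apply: eq_bigr => y _; exact: kernelC.
move: hx; rewrite fE /f -natr1; lra.
Qed.

(** The greedy points have low truncated energy. For a very small truncation no pair of them is
    close enough for the truncation to be active, so their energy is exactly minus the logarithm of
    the product of distances, up to the shift by [ln D]. *)
Lemma energy_config X Lam c m : X `<=` [set x | `|x| <= M] -> mean X Lam ->
  (forall d, 0 < d -> d <= D -> energy d Lam Lam <= c + ln D) ->
  exists s : seq R, [/\ size s = m, forall x, x \in s -> X x &
    expR (- ('C(m, 2)%:R * c + m%:R)) <=
    \prod_(i < m) \prod_(j < m | (i < j)%N) `|nth 0 s j - nth 0 s i|].
Proof.
move=> XM mL hE.
pose C := 'C(m, 2)%:R * (c + ln D) + m%:R.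
(* Then [ln (D / d)] exceeds [C], the bound for the total energy. As all terms are nonnegative, a
   single pair at distance at most [d] would already violate that bound. *)
pose d := D * expR (- (`|C| + 1)).
have d0 : 0 < d by rewrite mulr_gt0// expR_gt0.
have dD : d <= D.
  by rewrite ler_piMr// ?ltW// -expR0 ler_expR oppr_le0 addr_ge0.
have lnd : C < ln (D / d).
  have -> : D / d = expR (`|C| + 1) by rewrite /d invfM mulrA divff ?gt_eqF// mul1r -expRN opprK.
  by rewrite expRK; apply: (le_lt_trans (ler_norm _)); rewrite ltrDl.
have [s [ss Xs hs]] := low_energy_points m [::] mL d0 ltr01.
exists s; split => //.
rewrite cats0 /= big_nil mulr0 addr0 add0r mulr1 in hs.
have hsC : pair_sum (kernel d) s <= C.
  by apply: (le_trans hs); rewrite lerD2r ler_wpM2l// hE.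
move: hsC; rewrite (pair_sumE 0) ss => hsC.
pose t (i j : 'I_m) : R := kernel d (nth 0 s i) (nth 0 s j).
have nthM (i : 'I_m) : `|nth 0 s i| <= M by apply: XM; apply: Xs; rewrite mem_nth// ss.
have dist_le (i j : 'I_m) : `|nth 0 s i - nth 0 s j| <= D.
  by apply: (le_trans (ler_normB _ _)); have := nthM i; have := nthM j; rewrite /D; lra.
have t0 (i j : 'I_m) : 0 <= t i j by apply: tlog_ge0.
have far (i j : 'I_m) : (i < j)%N -> d < `|nth 0 s i - nth 0 s j|.
  move=> ij; rewrite ltNge; apply/negP => h.
  have h1 : ln (D / d) <= t i j by apply: tlog_close.
  have : t i j <= C.
    apply: (@le_trans _ _ (\sum_(k < m | (i < k)%N) t i k)).
      by rewrite (bigD1 j)//=; apply: ler_wpDr => //; apply: sumr_ge0 => k _; exact: t0.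
    apply: le_trans hsC; rewrite [leRHS](bigD1 i)//= lerDl.
    by apply: sumr_ge0 => k _; apply: sumr_ge0 => l _; exact: t0.
  by move: lnd h1; lra.
have tE (i j : 'I_m) : (i < j)%N -> t i j = ln D - ln `|nth 0 s j - nth 0 s i|.
  move=> ij; have f := far i j ij; rewrite /t /kernel tlog_far//; last exact: ltW.
  by rewrite ln_div ?posrE// ?(lt_trans d0)// distrC.
have -> : \prod_(i < m) \prod_(j < m | (i < j)%N) `|nth 0 s j - nth 0 s i| =
   expR (\sum_(i < m) \sum_(j < m | (i < j)%N) (ln D - t i j)).
  rewrite expR_sum; apply: eq_bigr => i _; rewrite expR_sum; apply: eq_bigr => j ij.
  rewrite tE// opprB addrCA subrr addr0 lnK// posrE distrC.
  exact: lt_trans d0 (far i j ij).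
rewrite ler_expR.
have -> : \sum_(i < m) \sum_(j < m | (i < j)%N) (ln D - t i j) =
   'C(m, 2)%:R * ln D - \sum_(i < m) \sum_(j < m | (i < j)%N) t i j.
  rewrite (eq_bigr (fun i : 'I_m => \sum_(j < m | (i < j)%N) ln D - \sum_(j < m | (i < j)%N) t i j)).
    rewrite sumrB; congr (_ - _).
    rewrite -[m in LHS]ss -(pair_sumE 0 (fun _ _ => ln D) s) -ss.
    elim: {+}s => [|x s' IH] /=; first by rewrite mul0r.
    by rewrite IH binS bin1 natrD big_const_seq count_predT iter_addr_0 -mulr_natl; ring.
  by move=> i _; rewrite sumrB.
have : \sum_(i < m) \sum_(j < m | (i < j)%N) t i j <= C by [].
by rewrite /C; lra.
Qed.

(** For [m] points the product of distances is at least about [expR (- m^2 c / 2)] by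
    [energy_config] and at most about [expR (m^2 e / 2)] by [distances_le]; the corrections are
    [expR] of [m ln m] and of multiples of [m]. If [c < - e], this fails for large [m]. *)
Lemma energy_lower_bound X Lam (Q : {poly R}) e c : X `<=` [set x | `|x| <= M] -> mean X Lam ->
  Q \is monic -> (1 < size Q)%N -> 0 <= e ->
  (forall x, X x -> `|Q.[x]| <= expR ((size Q).-1%:R * e)) ->
  (forall d, 0 < d -> d <= D -> energy d Lam Lam <= c + ln D) -> - e <= c.
Proof.
move=> XM mL Qm Q1 e0 hQ hE; rewrite leNgt; apply/negP => ce.
pose n := (size Q).-1; have n0 : (0 < n)%N by rewrite /n; case: (size Q) Q1 => [|[]].
have Qs : size Q = n.+1 by rewrite /n prednK// ltnW.
pose B := Num.max 1 M; have B1 : 1 <= B by rewrite le_max lexx.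
have B0 : 0 < B by exact: lt_le_trans B1.
pose eta := - (c + e) / 2; have eta0 : 0 < eta by rewrite divr_gt0// oppr_gt0; lra.
have key (m : nat) : (0 < m)%N -> eta * (m%:R - 1) <= 1 + ln m%:R + n%:R * ln B.
  move=> m0; have [s [ss Xs hs]] := energy_config m XM mL hE.
  have nX (i : 'I_m) : X (nth 0 s i) by apply: Xs; rewrite mem_nth// ss.
  have hB i : `|nth 0 s (nat_of_ord (i : 'I_m))| <= B.
    by apply: (le_trans (XM _ (nX i))); rewrite le_max lexx orbT.
  have hQ' i : `|Q.[nth 0 s (nat_of_ord (i : 'I_m))]| <= expR (n%:R * e) by exact: hQ.
  have := le_trans hs (distances_le n0 Qm Qs e0 B1 hB hQ').
  have m0' : 0 < m%:R :> R by rewrite ltr0n.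
  have -> : \prod_(k < m) (expR (k%:R * e) * B ^+ n) = expR ('C(m, 2)%:R * e + m%:R * (n%:R * ln B)).
    rewrite big_split /= prodr_const card_ord -expR_sum -mulr_suml expRD; congr (_ * _).
      by rewrite -natr_sum -bin2_sum big_mkord.
    by rewrite -exprM -[B in LHS]lnK ?posrE// -expRM_natl mulrA -natrM mulnC.
  have hf : m`!%:R <= expR (m%:R * ln m%:R) :> R.
    rewrite expRM_natl lnK ?posrE// -natrX ler_nat; clear.
    elim: m => // m IH; rewrite factS expnS leq_mul//; apply: (leq_trans IH).
    by case: m {IH} => [|m]; [rewrite !expn0|rewrite leq_exp2r// leqnSn].
  move=> h; have : expR (- ('C(m, 2)%:R * c + m%:R)) <=
    expR (m%:R * ln m%:R) * expR ('C(m, 2)%:R * e + m%:R * (n%:R * ln B)).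
    by apply: (le_trans h); rewrite ler_wpM2r// expR_ge0.
  rewrite -expRD ler_expR.
  have -> : 'C(m, 2)%:R = m%:R * (m%:R - 1) / 2 :> R.
    rewrite bin2; have : odd (m * m.-1) = false by rewrite oddM; case: m {h hQ' hB nX Xs hs ss m0 m0' hf s} => // k /=; case: odd.
    move=> od; have : (m * m.-1)%:R = (m%:R * (m%:R - 1)) :> R.
      by rewrite natrM -[m%:R - 1]/(m%:R - 1%:R) -natrB// subn1.
    move=> <-; rewrite -[in RHS](odd_double_half (m * m.-1)) od add0n -muln2 natrM.
    by field.
  move=> h'; rewrite -(ler_pM2l m0') /eta.
  move: h'; lra.
(* The number of points will be [m = k^2], so that [ln m = 2 ln k] is controlled by [2 k] and loses
   against the term [eta * k^2]. *)
have [k hk] : exists k : nat, (1 + n%:R * ln B + eta + 2) / eta < k%:R.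
  by exists (Num.truncn ((1 + n%:R * ln B + eta + 2) / eta)).+1; exact: truncnS_gt.
have lB : 0 <= n%:R * ln B by rewrite mulr_ge0// ln_ge0.
have k0 : 0 < k%:R :> R.
  by apply: le_lt_trans hk; rewrite divr_ge0// ltW//; lra.
have k0' : (0 < k)%N by rewrite ltr0n in k0.
have := key (k ^ 2)%N; rewrite expn_gt0 k0' => /(_ isT).
rewrite natrX lnXn// -[ln _ *+ 2]mulr_natl.
have lk := ln_sublinear k0.
rewrite ltr_pdivrMr// in hk.
have k1 : 1 <= k%:R :> R by rewrite ler1n.
have h1 : (1 + n%:R * ln B + eta + 2) * k%:R <= k%:R * eta * k%:R by rewrite ler_wpM2r// ltW.
have h2 : (1 + n%:R * ln B + eta) * 1 <= (1 + n%:R * ln B + eta) * k%:R.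
  by rewrite ler_wpM2l//; lra.
have h3 : (1 + n%:R * ln B + eta + 2) * k%:R < k%:R * eta * k%:R by rewrite ltr_pM2r.
move: h3 h2 lk; rewrite expr2; lra.
Qed.

End Energy.

(** * Positive definiteness of convex sequences on a grid *)

Section ConvexSequence.
Variable R : realType.

Definition tent (l a b : nat) : nat := l - (maxn a b - minn a b).

(** Both sides count the integers common to [(a, a + l]] and [(b, b + l]]. So a tent is a Gram
    matrix of windows, which [tent_form] turns into a sum of squares. *)
Lemma tent_windows (N l a b : nat) : (a <= N)%N -> (b <= N)%N ->
  (tent l a b)%:R =
  \sum_(i < (N + l).+1) (((a < i) && (i <= a + l))%N%:R * ((b < i) && (i <= b + l))%N%:R) :> R.
Proof.
move=> aN bN.
have E (i : 'I_(N + l).+1) : ((a < i) && (i <= a + l))%N%:R * ((b < i) && (i <= b + l))%N%:R =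
   (i < minn a b + l + 1)%N%:R - (i < minn (maxn a b + 1) (minn a b + l + 1))%N%:R :> R.
  case: (ltnP a i) => h1; case: (leqP i (a + l)) => h2; case: (ltnP b i) => h3;
  case: (leqP i (b + l)) => h4 /=; case: (ltnP i (minn a b + l + 1)) => h5;
  case: (ltnP i (minn (maxn a b + 1) (minn a b + l + 1))) => h6;
  rewrite ?mulr0 ?mul0r ?mulr1 ?subr0 ?subrr//; lia.
rewrite (eq_bigr _ (fun i _ => E i)) sumrB !sum_ltn_nat; try lia.
by rewrite -natrB; [congr (_%:R); rewrite /tent; lia|lia].
Qed.

Lemma tent_form (N l : nat) (m : nat -> R) :
  \sum_(a < N.+1) \sum_(b < N.+1) (tent l a b)%:R * (m a * m b) =
  \sum_(i < (N + l).+1) (\sum_(a < N.+1) ((a < i) && (i <= a + l))%N%:R * m a) ^+ 2.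
Proof.
under [RHS]eq_bigr => i _.
  rewrite expr2 mulr_suml.
  under eq_bigr => a _ do rewrite mulr_sumr.
  over.
rewrite [RHS]exchange_big /=; apply: eq_bigr => a _.
rewrite [RHS]exchange_big /=; apply: eq_bigr => b _.
rewrite (@tent_windows N)// ?leq_ord// mulr_suml; apply: eq_bigr => i _; ring.
Qed.

(** Discrete Taylor formula at 0 with the second differences in the remainder; truncated subtraction
    makes each remainder term a ramp. *)
Lemma convex_taylor (phi : nat -> R) (e : nat) : phi 0%N = 0 ->
  phi e = e%:R * phi 1%N + \sum_(l < e) (e - l.+1)%:R * (phi l - 2 * phi l.+1 + phi l.+2).
Proof.
move=> p0; pose T e := e%:R * phi 1%N + \sum_(l < e) (e - l.+1)%:R * (phi l - 2 * phi l.+1 + phi l.+2).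
have S k : \sum_(l < k) (phi l - 2 * phi l.+1 + phi l.+2) = phi k.+1 - phi k - phi 1%N.
  elim: k => [|k IH]; first by rewrite big_ord0 p0 subr0 subrr.
  by rewrite big_ord_recr IH /=; ring.
rewrite -/(T e); elim: e => [|e IH]; first by rewrite /T mul0r big_ord0 addr0.
have -> : T e.+1 = T e + (phi 1%N + \sum_(l < e) (phi l - 2 * phi l.+1 + phi l.+2)).
  rewrite /T big_ord_recr /= subnn mul0r addr0 -natr1.
  rewrite (eq_bigr (fun l : 'I_e => (e - l.+1)%:R * (phi l - 2 * phi l.+1 + phi l.+2) +
     (phi l - 2 * phi l.+1 + phi l.+2))); first by rewrite big_split /=; ring.
  by move=> l _; rewrite subSS -[in LHS](subnSK (ltn_ord l)) -natr1; ring.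
by rewrite -IH S; ring.
Qed.

(* A convex decreasing sequence vanishing at [N] is a positive combination of tents, and each tent
   is a sum of squares of window sums. *)
Lemma convex_form_ge (N : nat) (phi : nat -> R) (kap : R) (m : nat -> R) :
  phi N = 0 -> 0 <= kap -> kap <= phi N.-1 ->
  (forall l, (l.+1 < N)%N -> 2 * phi l.+1 <= phi l + phi l.+2) ->
  kap * \sum_(c < N) (\sum_(a < c.+1) m a) ^+ 2 <=
  \sum_(a < N.+1) \sum_(b < N.+1) phi (maxn a b - minn a b)%N * (m a * m b).
Proof.
move=> pN k0 kp cvx.
(* Reversal moves the zero of [phi] to the origin, and the distance [|a - b|] becomes
   [tent N a b]. *)
pose psi e := phi (N - e)%N.
have psi0 : psi 0%N = 0 by rewrite /psi subn0.
have psi1 : psi 1%N = phi N.-1 by rewrite /psi subn1.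
pose cc l := psi l - 2 * psi l.+1 + psi l.+2.
have cc0 l : (l.+1 < N)%N -> 0 <= cc l.
  move=> lN; have := cvx (N - l.+2)%N; rewrite /cc /psi.
  have -> : (N - l.+2).+1 = (N - l.+1)%N by lia.
  have -> : (N - l.+1).+1 = (N - l)%N by lia.
  by move=> /(_ ltac:(lia)); lra.
(* [convex_taylor] at [tent N a b]; subtracting [l.+1] there gives a smaller tent. For [l = N - 1]
   that tent is identically 0, so the coefficient, on which convexity says nothing, can be set to
   0. *)
have E (a b : 'I_N.+1) : phi (maxn a b - minn a b)%N =
   (tent N a b)%:R * phi N.-1 + \sum_(l < N) (tent (N - l.+1) a b)%:R * (if (l.+1 < N)%N then cc l else 0).
  have hab : (maxn a b - minn a b <= N)%N by have := ltn_ord a; have := ltn_ord b; lia.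
  have -> : phi (maxn a b - minn a b)%N = psi (tent N a b) by rewrite /psi /tent subKn.
  rewrite (convex_taylor _ psi0) psi1; congr (_ + _).
  rewrite (big_ord_widen N (fun l => (tent N a b - l.+1)%:R * (psi l - 2 * psi l.+1 + psi l.+2))); last by rewrite /tent; lia.
  rewrite big_mkcond; apply: eq_bigr => l _; have := ltn_ord l => lN.
  have -> : (tent (N - l.+1) a b = tent N a b - l.+1)%N by rewrite /tent; lia.
  case: ltnP => h1; case: ltnP => h2 //.
  - have -> : (tent N a b - l.+1 = 0)%N by rewrite /tent; lia.
    by rewrite !mul0r.
  - have -> : (tent N a b - l.+1 = 0)%N by lia.
    by rewrite !mul0r.
  - by rewrite mulr0.
have -> : \sum_(a < N.+1) \sum_(b < N.+1) phi (maxn a b - minn a b)%N * (m a * m b) =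
   phi N.-1 * (\sum_(a < N.+1) \sum_(b < N.+1) (tent N a b)%:R * (m a * m b)) +
   \sum_(l < N) (if (l.+1 < N)%N then cc l else 0) *
     \sum_(a < N.+1) \sum_(b < N.+1) (tent (N - l.+1) a b)%:R * (m a * m b).
  rewrite mulr_sumr.
  under [X in _ = _ + X]eq_bigr => l _ do rewrite mulr_sumr.
  rewrite [X in _ = _ + X]exchange_big /= -big_split /=; apply: eq_bigr => a _.
  rewrite mulr_sumr; under [X in _ = _ + X]eq_bigr => l _ do rewrite mulr_sumr.
  rewrite [X in _ = _ + X]exchange_big /= -big_split /=; apply: eq_bigr => b _.
  rewrite E mulrDl; congr (_ + _); first by ring.
  rewrite mulr_suml.
  by apply: eq_bigr => l _; rewrite [RHS]mulrA [X in _ = X * _]mulrC.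
apply: ler_wpDr.
  apply: sumr_ge0 => l _; apply: mulr_ge0; first by case: ifP => // /cc0.
  by rewrite tent_form; apply: sumr_ge0 => i _; exact: sqr_ge0.
rewrite tent_form; apply: ler_pM => //.
  by apply: sumr_ge0 => i _; exact: sqr_ge0.
have W : (N.+1 <= (N + N).+1)%N by lia.
(* Only windows with [i <= N] are kept: there [i <= a + N] is automatic and the window sum is the
   sum of the first [i] masses. *)
apply: (@le_trans _ _ (\sum_(i < N.+1) (\sum_(a < N.+1) ((a < i) && (i <= a + N))%N%:R * m a) ^+ 2)).
  rewrite [leRHS]big_ord_recl /= -[leLHS]add0r lerD ?sqr_ge0//.
  apply: ler_sum => c _; rewrite le_eqVlt; apply/orP; left; apply/eqP; congr (_ ^+ 2).
  rewrite (big_ord_widen N.+1 m); last by have := ltn_ord c; lia.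
  rewrite big_mkcond; apply: eq_bigr => a _; rewrite /bump /= add1n ltnS.
  have -> : (c.+1 <= a + N)%N by have := ltn_ord c; lia.
  by rewrite andbT -ltnS; case: ltnP; rewrite ?mul1r ?mul0r.
rewrite (big_ord_widen _ (fun i => (\sum_(a < N.+1) ((a < i) && (i <= a + N))%N%:R * m a) ^+ 2) W).
by rewrite [leLHS]big_mkcond; apply: ler_sum => i _; case: ifP => // _; exact: sqr_ge0.
Qed.

Lemma sqr_sum_le (N : nat) (F : 'I_N -> R) :
  (\sum_(c < N) F c) ^+ 2 <= N%:R * \sum_(c < N) F c ^+ 2.
Proof.
have h : 0 <= \sum_(a < N) \sum_(b < N) (F a - F b) ^+ 2.
  by apply: sumr_ge0 => a _; apply: sumr_ge0 => b _; exact: sqr_ge0.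
have E : \sum_(a < N) \sum_(b < N) (F a - F b) ^+ 2 =
   2 * (N%:R * \sum_(c < N) F c ^+ 2) - 2 * (\sum_(c < N) F c) ^+ 2.
  have c1 (x : R) : N%:R * x = \sum_(b < N) x by rewrite sumr_const card_ord mulr_natl.
  have E1 a : \sum_(b < N) (F a - F b) ^+ 2 =
     N%:R * F a ^+ 2 - 2 * F a * (\sum_(c < N) F c) + \sum_(c < N) F c ^+ 2.
    rewrite mulr_sumr c1 -sumrB -big_split /=.
    by apply: eq_bigr => b _; ring.
  rewrite (eq_bigr _ (fun a _ => E1 a)) big_split /= sumrB -mulr_sumr -mulr_suml -mulr_sumr.
  by rewrite -c1; ring.
by move: h; rewrite E; lra.
Qed.

Lemma abel_sum (N : nat) (f m : nat -> R) :
  \sum_(a < N.+1) f a * m a =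
  f N * \sum_(a < N.+1) m a - \sum_(c < N) (f c.+1 - f c) * \sum_(a < c.+1) m a.
Proof.
elim: N => [|N IH]; first by rewrite !big_ord_recl !big_ord0 /=; ring.
rewrite big_ord_recr IH /= [X in _ = f N.+1 * X - _]big_ord_recr [X in _ = _ - X]big_ord_recr /=.
ring.
Qed.

End ConvexSequence.

(** * Piecewise linear interpolation on a grid *)

Section Hats.
Variable R : realType.

Definition clamp (t : R) : R := Num.max 0 (Num.min 1 t).

Lemma clamp_spec t : [\/ t <= 0 /\ clamp t = 0, 0 <= t <= 1 /\ clamp t = t | 1 <= t /\ clamp t = 1].
Proof.
have h0 : t <= 0 -> clamp t = 0 by move=> h; rewrite /clamp max_l// ge_min h orbT.
have h1 : 0 <= t <= 1 -> clamp t = t by move=> /andP[a b]; rewrite /clamp min_r// max_r.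
have h2 : 1 <= t -> clamp t = 1 by move=> h; rewrite /clamp min_l// max_r.
have [h|h] := lerP t 0; first by apply: Or31; split => //; exact: h0.
have [h'|h'] := lerP t 1; last by apply: Or33; split; [|apply: h2]; exact: ltW.
have h3 : 0 <= t <= 1 by rewrite (ltW h).
by apply: Or32; rewrite (h1 h3) (ltW h).
Qed.

Lemma clamp_dist s t : `|clamp s - clamp t| <= `|s - t|.
Proof.
wlog st : s t / s <= t => [wl|].
  have [h|h] := leP s t; first exact: wl.
  by rewrite distrC [leRHS]distrC; apply: wl; exact: ltW.
rewrite distrC [leRHS]distrC [leRHS]ger0_norm ?subr_ge0// ger0_norm.
all: by case: (clamp_spec s) => -[a ->]; case: (clamp_spec t) => -[b ->]; lra.
Qed.

Lemma clamp_mono s t : s <= t -> clamp s <= clamp t.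
Proof. by move=> st; case: (clamp_spec s) => -[a ->]; case: (clamp_spec t) => -[b ->]; lra. Qed.

Variables (M : R) (N : nat).
Hypotheses (M0 : 0 < M) (N0 : (0 < N)%N).
Let D := 2 * M.
Let h := D / N%:R.
Let D0 : 0 < D. Proof. by rewrite mulr_gt0. Qed.
Let NR : 0 < N%:R :> R. Proof. by rewrite ltr0n. Qed.
Let h0 : 0 < h. Proof. by rewrite divr_gt0// ?D0 ?NR. Qed.

Definition grid (a : nat) : R := - M + a%:R * h.
Definition ramp (a : nat) (x : R) : R := clamp ((x - grid a) / h + 1).
(** The piecewise linear bump of height 1 at [grid a], written as a difference of consecutive ramps
    so that the hats telescope to a partition of unity. *)
Definition hat (a : nat) (x : R) : R := ramp a x - ramp a.+1 x.

Let gridS a : grid a.+1 = grid a + h.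
Proof. by rewrite /grid -natr1; ring. Qed.

Let ramp_succ a x : ramp a.+1 x = clamp ((x - grid a) / h).
Proof. by rewrite /ramp gridS; congr clamp; field; rewrite gt_eqF// h0. Qed.

Lemma lip_hat a : lip (hat a).
Proof.
have lr b : lip (ramp b).
  exists h^-1 => x y; apply: (le_trans (clamp_dist _ _)).
  have -> : (x - grid b) / h + 1 - ((y - grid b) / h + 1) = h^-1 * (x - y) by ring.
  by rewrite normrM gtr0_norm// invr_gt0 h0.
by have := lipD (-1) (lr a.+1) (lr a); under [X in lip X -> _]eq_fun do rewrite mulN1r addrC.
Qed.

Lemma hat_ge0 a x : 0 <= hat a x.
Proof. by rewrite subr_ge0 ramp_succ; apply: clamp_mono; lra. Qed.

Lemma hat_far a x : h < `|x - grid a| -> hat a x = 0.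
Proof.
rewrite /hat ramp_succ /ramp; set t := (x - grid a) / h.
have -> : x - grid a = t * h by rewrite /t divfK// gt_eqF// h0.
rewrite normrM (gtr0_norm h0) -[X in X < _]mul1r ltr_pM2r ?h0// ltr_normr => ht.
by case: (clamp_spec t) => -[a1 ->]; case: (clamp_spec (t + 1)) => -[a2 ->]; case/orP: ht; lra.
Qed.

Lemma sum_hat x : `|x| <= M -> \sum_(a < N.+1) hat a x = 1.
Proof.
rewrite ler_norml => /andP[x1 x2].
have -> : \sum_(a < N.+1) hat a x = ramp 0 x - ramp N.+1 x.
  rewrite -(big_mkord xpredT (fun a => hat a x)) /hat.
  rewrite (eq_bigr (fun a => - ramp a.+1 x - - ramp a x)) => [|a _]; last by ring.
  by rewrite (telescope_sumr (fun a => - ramp a x))//; ring.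
have NhD : N%:R * h = D by rewrite /h mulrC divfK// gt_eqF// NR.
have -> : ramp 0 x = 1.
  rewrite /ramp /grid mul0r addr0 opprK.
  have : 0 <= (x + M) / h by rewrite divr_ge0 ?(ltW h0)//; lra.
  by case: (clamp_spec ((x + M) / h + 1)) => -[a ->]; lra.
have -> : ramp N.+1 x = 0.
  rewrite ramp_succ /grid NhD.
  have : (x - (- M + D)) / h <= 0 by rewrite ler_pdivrMr ?h0// mul0r /D; lra.
  by case: (clamp_spec ((x - (- M + D)) / h)) => -[a ->]; lra.
by rewrite subr0.
Qed.

Lemma interpolation_error (g : R -> R) e x :
  (forall y, `|x - y| <= h -> `|g x - g y| <= e) -> `|x| <= M ->
  `|g x - \sum_(a < N.+1) g (grid a) * hat a x| <= e.
Proof.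
move=> hg hx; rewrite -[g x]mulr1 -(sum_hat hx) mulr_sumr -sumrB.
apply: (le_trans (ler_norm_sum _ _ _)).
rewrite -[leRHS]mulr1 -(sum_hat hx) mulr_sumr; apply: ler_sum => a _.
rewrite -mulrBl normrM [X in _ * X]ger0_norm ?hat_ge0//.
have [hl|hl] := leP `|x - grid a| h; last by rewrite hat_far// !mulr0.
by rewrite ler_wpM2r ?hat_ge0//; exact: hg.
Qed.

Section MeanHats.
Variables (X : set R).
Hypothesis XM : X `<=` [set x | `|x| <= M].

Lemma mean_hat_ge0 Lam a : mean X Lam -> 0 <= Lam (hat a).
Proof. by move=> [_ _ h3]; apply: h3; [exact: lip_hat|move=> x _; exact: hat_ge0]. Qed.

Lemma sum_mean_hat Lam : mean X Lam -> \sum_(a < N.+1) Lam (hat a) = 1.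
Proof.
move=> mL; rewrite -(mean_sum mL); last by move=> a; exact: lip_hat.
apply/eqP; rewrite -subr_eq0 -normr_le0 -{1}(mean_cst mL 1).
apply: (mean_dist_le mL); first by apply: lip_sum => a; exact: lip_hat.
  exact: lip_cst.
by move=> x /XM hx; rewrite sum_hat// subrr normr0.
Qed.

Lemma mean_interpolation Lam (g : R -> R) L : mean X Lam -> 0 <= L ->
  (forall x y, `|g x - g y| <= L * `|x - y|) ->
  `|Lam g - \sum_(a < N.+1) g (grid a) * Lam (hat a)| <= L * h.
Proof.
move=> mL L0 hg; have lg : lip g by exists L.
have lh a : lip (fun x => g (grid a) * hat a x) by apply: lipZ; exact: lip_hat.
have -> : \sum_(a < N.+1) g (grid a) * Lam (hat a) =
   Lam (fun x => \sum_(a < N.+1) g (grid a) * hat a x).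
  rewrite (mean_sum mL)//; apply: eq_bigr => a _; rewrite (meanZ mL)//; exact: lip_hat.
apply: (mean_dist_le mL) => //; first by apply: lip_sum => a; exact: lh.
move=> x /XM hx; apply: interpolation_error => // y xy.
by apply: (le_trans (hg _ _)); rewrite ler_wpM2l.
Qed.

Lemma energy_discretization Lam Lam' d : mean X Lam -> mean X Lam' -> 0 < d ->
  `|energy M d Lam Lam' - \sum_(a < N.+1) \sum_(b < N.+1)
     kernel M d (grid a) (grid b) * (Lam (hat a) * Lam' (hat b))| <= 2 * (d^-1 * h).
Proof.
move=> mL mL' d0; have i0 : 0 <= d^-1 by rewrite invr_ge0 ltW.
have h1 := mean_interpolation mL i0 (fun x y => potential_lipschitz M0 x y mL' d0).
have h2 : `|\sum_(a < N.+1) Lam' (kernel M d (grid a)) * Lam (hat a) -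
   \sum_(a < N.+1) \sum_(b < N.+1) kernel M d (grid a) (grid b) * (Lam (hat a) * Lam' (hat b))|
   <= d^-1 * h.
  rewrite -sumrB; apply: (le_trans (ler_norm_sum _ _ _)).
  rewrite -[leRHS]mulr1 -(sum_mean_hat mL) mulr_sumr; apply: ler_sum => a _.
  have -> : \sum_(b < N.+1) kernel M d (grid a) (grid b) * (Lam (hat a) * Lam' (hat b)) =
     (\sum_(b < N.+1) kernel M d (grid a) (grid b) * Lam' (hat b)) * Lam (hat a).
    by rewrite mulr_suml; apply: eq_bigr => b _; ring.
  rewrite -mulrBl normrM [X in _ * X]ger0_norm ?(mean_hat_ge0 a mL)//.
  rewrite ler_wpM2r ?(mean_hat_ge0 a mL)//.
  by apply: mean_interpolation => // x y; exact: kernel_lipschitz.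
rewrite [leRHS](_ : _ = d^-1 * h + d^-1 * h); last by ring.
exact: (le_trans (ler_distD _ _ _) (lerD h1 h2)).
Qed.

(** The sequence [tlog D d (l * h)] is convex and vanishes at [l = N] because [N * h = D]; its value
    at [N - 1] is at least [1 / N] by the tangent at [D], which is the constant on the left. *)
Lemma discrete_form_ge d (m : nat -> R) : 0 < d -> d <= D ->
  N%:R^-1 * \sum_(c < N) (\sum_(a < c.+1) m a) ^+ 2 <=
  \sum_(a < N.+1) \sum_(b < N.+1) kernel M d (grid a) (grid b) * (m a * m b).
Proof.
move=> d0 dD; pose phi (l : nat) := tlog D d (l%:R * h).
have NhD : N%:R * h = D by rewrite /h mulrC divfK// gt_eqF// NR.
have E (a b : 'I_N.+1) : kernel M d (grid a) (grid b) = phi (maxn a b - minn a b)%N.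
  rewrite /kernel /phi; congr tlog.
  have -> : grid a - grid b = (a%:R - b%:R) * h by rewrite /grid; ring.
  rewrite normrM (gtr0_norm h0); congr (_ * _).
  case: (leqP a b) => ab; first by rewrite distrC -natrB// ger0_norm.
  by rewrite -natrB ?(ltnW ab)// ger0_norm.
rewrite [leRHS](_ : _ = \sum_(a < N.+1) \sum_(b < N.+1) phi (maxn a b - minn a b)%N * (m a * m b)); last first.
  by apply: eq_bigr => a _; apply: eq_bigr => b _; rewrite E.
apply: (@convex_form_ge _ N phi).
- by rewrite /phi NhD tlog_far// divff ?ln1// gt_eqF.
- by rewrite invr_ge0 ltW.
- rewrite /phi; have l0 : 0 <= N.-1%:R * h by rewrite mulr_ge0// ltW.
  apply: le_trans (tlog_lb D0 d0 dD l0).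
  have -> : N.-1%:R = N%:R - 1 :> R by rewrite -[in RHS](prednK N0) -natr1 addrK.
  rewrite mulrBl mul1r NhD mulrBl divff ?gt_eqF// /h.
  by rewrite -mulrA mulrC -mulrA mulVf ?gt_eqF//; lra.
- move=> l _; rewrite /phi.
  have l1 : 0 <= l.+1%:R * h - h by rewrite -natr1 mulrDl mul1r addrK mulr_ge0// ltW.
  have := tlog_convex D0 d0 l1 (ltW h0).
  have -> : l.+1%:R * h - h = l%:R * h by rewrite -natr1; ring.
  by have -> : l.+1%:R * h + h = l.+2%:R * h by rewrite -[l.+2%:R]natr1; ring.
Qed.

End MeanHats.
End Hats.

(** On the grid, summation by parts writes the difference of the integrals through increments of
    [f], at most [L * h], and partial sums of the masses. By Cauchy-Schwarz its square is at most
    [(D * L) ^+ 2] times [1 / N] times the sum of the squared partial sums, and [discrete_form_ge]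
    bounds this by the energy. Refining the grid removes the errors. *)
Lemma energy_controls (R : realType) (M : R) (X : set R) Lam Lam' (f : R -> R) L d :
  0 < M -> X `<=` [set x | `|x| <= M] -> mean X Lam -> mean X Lam' ->
  0 <= L -> (forall x y, `|f x - f y| <= L * `|x - y|) -> 0 < d -> d <= 2 * M ->
  (Lam f - Lam' f) ^+ 2 <= (2 * M * L) ^+ 2 *
    (energy M d Lam Lam - energy M d Lam Lam' - energy M d Lam' Lam + energy M d Lam' Lam').
Proof.
move=> M0 XM mL mL' L0 hf d0 dD; set D := 2 * M; set Q := _ - _ - _ + _.
have D0 : 0 < D by rewrite /D mulr_gt0.
set s := Lam f - Lam' f.
(* Collects the errors of order [h = D / N]: the first summand stems from replacing [s] by its grid
   version [S], the second from four energies, each off by at most [2 * h / d]. *)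
pose C := 2 * L * (2 * `|s| + 2 * L * D) + (D * L) ^+ 2 * (8 / d).
have C0 : 0 <= C.
  rewrite addr_ge0//; first by rewrite !mulr_ge0// addr_ge0// !mulr_ge0// ltW.
  by rewrite mulr_ge0 ?sqr_ge0// divr_ge0// ltW.
suff key N : (0 < N)%N -> s ^+ 2 <= (D * L) ^+ 2 * Q + D / N%:R * C.
  apply/ler_addgt0Pr => e e0.
  pose N := (Num.truncn (D * C / e)).+1.
  have NR : 0 < N%:R :> R by rewrite ltr0n.
  apply: (le_trans (key N _)) => //; rewrite lerD2l mulrAC ler_pdivrMr//.
  by rewrite -ler_pdivrMl// mulrC; exact: ltW (truncnS_gt _).
move=> N0; set h := D / N%:R; have NR : 0 < N%:R :> R by rewrite ltr0n.
have h0 : 0 < h by rewrite divr_gt0.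
have hD : h <= D by rewrite ler_pdivrMr// ler_peMr ?(ltW D0)// ler1n.
pose x := grid M N; pose w := hat M N.
pose m (a : nat) : R := Lam (w a) - Lam' (w a).
set S := \sum_(a < N.+1) f (x a) * m a.
have hS : `|s - S| <= 2 * (L * h).
  have := mean_interpolation M0 N0 XM mL L0 hf; have := mean_interpolation M0 N0 XM mL' L0 hf.
  rewrite -/D -/h -/x -/w => h1 h2.
  have -> : s - S = (Lam f - \sum_(a < N.+1) f (x a) * Lam (w a)) -
     (Lam' f - \sum_(a < N.+1) f (x a) * Lam' (w a)).
    rewrite /S /m; under eq_bigr do rewrite mulrBr.
    by rewrite sumrB /s; ring.
  by apply: (le_trans (ler_normB _ _)); move: h1 h2; lra.
set T := \sum_(a < N.+1) \sum_(b < N.+1) kernel M d (x a) (x b) * (m a * m b).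
have hT : T <= Q + 8 * (d^-1 * h).
  have e1 := energy_discretization M0 N0 XM mL mL d0.
  have e2 := energy_discretization M0 N0 XM mL mL' d0.
  have e3 := energy_discretization M0 N0 XM mL' mL d0.
  have e4 := energy_discretization M0 N0 XM mL' mL' d0.
  move: e1 e2 e3 e4; rewrite -/D -/h -/x -/w.
  set T1 := \sum_(a < N.+1) _; set T2 := \sum_(a < N.+1) _.
  set T3 := \sum_(a < N.+1) _; set T4 := \sum_(a < N.+1) _ => e1 e2 e3 e4.
  have -> : T = T1 - T2 - T3 + T4.
    rewrite /T /T1 /T2 /T3 /T4 -!sumrB -big_split /=; apply: eq_bigr => a _.
    by rewrite -!sumrB -big_split /=; apply: eq_bigr => b _; rewrite /m; ring.
  move: e1 e2 e3 e4; rewrite !ler_distl /Q.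
  by move=> /andP[? ?] /andP[? ?] /andP[? ?] /andP[? ?]; lra.
(* Both functionals have total mass 1, so the boundary term of the summation by parts vanishes. *)
have sm : \sum_(a < N.+1) m a = 0.
  by rewrite /m sumrB !(sum_mean_hat M0 N0 XM)// subrr.
have S2 : S ^+ 2 <= (D * L) ^+ 2 * T.
  have -> : S = - \sum_(c < N) (f (x c.+1) - f (x c)) * \sum_(a < c.+1) m a.
    by rewrite /S (abel_sum N (fun a => f (x a)) m) sm mulr0 sub0r.
  rewrite sqrrN.
  apply: (@le_trans _ _ (N%:R * \sum_(c < N) ((f (x c.+1) - f (x c)) * \sum_(a < c.+1) m a) ^+ 2)).
    exact: sqr_sum_le.
  apply: (@le_trans _ _ (N%:R * \sum_(c < N) (L * h) ^+ 2 * (\sum_(a < c.+1) m a) ^+ 2)).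
    rewrite ler_pM2l//; apply: ler_sum => c _; rewrite exprMn ler_wpM2r ?sqr_ge0//.
    have hc : `|f (x c.+1) - f (x c)| <= L * h.
      apply: (le_trans (hf _ _)); rewrite ler_wpM2l//.
      have -> : x c.+1 - x c = h by rewrite /x /grid -natr1 -/D -/h; ring.
      by rewrite gtr0_norm.
    rewrite -[leLHS]real_normK ?num_real//.
    by apply: lerXn2r hc; rewrite nnegrE// mulr_ge0// ltW.
  rewrite -mulr_sumr.
  have := discrete_form_ge M0 N0 m d0 dD; rewrite -/x -/T.
  set V := \sum_(c < N) _ => hV.
  have -> : N%:R * ((L * h) ^+ 2 * V) = (D * L) ^+ 2 * (N%:R^-1 * V).
    by rewrite /h; field; rewrite gt_eqF.
  by rewrite ler_wpM2l// sqr_ge0.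
have h1 : s ^+ 2 - S ^+ 2 <= h * (2 * L * (2 * `|s| + 2 * L * D)).
  have -> : s ^+ 2 - S ^+ 2 = (s - S) * (2 * s - (s - S)) by ring.
  apply: (le_trans (ler_norm _)); rewrite normrM.
  have -> : h * (2 * L * (2 * `|s| + 2 * L * D)) = 2 * (L * h) * (2 * `|s| + 2 * L * D) by ring.
  apply: ler_pM => //; apply: (le_trans (ler_normB _ _)); apply: lerD.
    by rewrite normrM ger0_norm.
  by apply: (le_trans hS); rewrite mulrA ler_wpM2l// mulr_ge0.
have h2 : (D * L) ^+ 2 * T <= (D * L) ^+ 2 * (Q + 8 * (d^-1 * h)) by rewrite ler_wpM2l// sqr_ge0.
have -> : h * C = h * (2 * L * (2 * `|s| + 2 * L * D)) + (D * L) ^+ 2 * (8 * (d^-1 * h)).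
  by rewrite /C; ring.
by move: h1 h2 S2; rewrite mulrDr; lra.
Qed.

(** * Existence of measures of low energy *)

Section Quantile.
Variables (R : realType) (M : R) (X : set R).
Hypotheses (M0 : 0 < M) (XM : X `<=` [set x | `|x| <= M]).
Let mu := @lebesgue_measure R.
Implicit Types (Q : R -> R) (f : R -> R).

Let mu01 : mu `[0, 1] = 1%:E.
Proof. by rewrite /mu lebesgue_measure_itv /= lte_fin ltr01 -EFinD subr0. Qed.

(** A probability measure on [X] encoded by a monotone function whose image of Lebesgue measure on
    [[0, 1]] it is. *)
Definition quantile Q : Prop := {homo Q : s t / s <= t} /\ forall t, X (Q t).

Definition quantile_mean Q f : R := \int[mu]_(t in `[0, 1]) f (Q t).

Lemma lip_measurable f : lip f -> measurable_fun setT f.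
Proof.
move=> [L hL]; apply: continuous_measurable_fun => x; apply/cvgrPdist_lt => e e0.
exists (e / (`|L| + 1)); first by rewrite /= divr_gt0// ltr_wpDl.
move=> y /= xy; apply: (le_lt_trans (hL x y)).
have L1 : 0 < `|L| + 1 by rewrite ltr_wpDl.
rewrite ltr_pdivlMr// in xy; apply: le_lt_trans xy; rewrite mulrC ler_wpM2l//.
by apply: (le_trans (ler_norm _)); rewrite lerDl.
Qed.

Lemma lip_bounded f : lip f -> exists B, forall x, X x -> `|f x| <= B.
Proof.
move=> [L hL]; exists (`|f 0| + `|L| * M) => x /XM hx.
rewrite -[f x](subrK (f 0)) addrC; apply: (le_trans (ler_normD _ _)); rewrite lerD2l.
apply: (le_trans (hL x 0)); rewrite subr0; apply: (@le_trans _ _ (`|L| * `|x|)).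
  by rewrite ler_wpM2r// ler_norm.
by rewrite ler_wpM2l.
Qed.

Lemma quantile_measurable Q : quantile Q -> measurable_fun setT Q.
Proof. by move=> [ndQ _]; apply: nondecreasing_measurable. Qed.

Lemma quantile_integrable Q f : quantile Q -> lip f -> mu.-integrable `[0, 1] (EFin \o (f \o Q)).
Proof.
move=> qQ lf; apply: measurable_bounded_integrable => //.
- by apply: (@le_lt_trans _ _ 1%:E); rewrite ?ltry// -mu01.
- apply: measurable_funTS; apply: measurableT_comp; first exact: lip_measurable.
  exact: quantile_measurable.
- have [B hB] := lip_bounded lf.
  by exists B; split => [|r Br t _]; [exact: num_real|apply: (le_trans (hB _ (qQ.2 t))); exact: ltW].
Qed.

Lemma quantile_mean_mean Q : quantile Q -> mean X (quantile_mean Q).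
Proof.
move=> qQ; split.
- move=> a f g lf lg; rewrite /quantile_mean RintegralD//; last 2 first.
  + exact: (quantile_integrable qQ (lipZ a lf)).
  + exact: (quantile_integrable qQ lg).
  by rewrite RintegralZl//; exact: (quantile_integrable qQ lf).
- rewrite /quantile_mean Rintegral_cst// mul1r; exact: (congr1 fine mu01).
- by move=> f lf h; apply: Rintegral_ge0 => t _; apply: h; exact: qQ.2.
Qed.

Lemma quantile_bounds Q s t : quantile Q -> Q s - Q t <= 2 * M.
Proof.
move=> qQ; apply: (le_trans (ler_norm _)); apply: (le_trans (ler_normB _ _)).
by have := XM (qQ.2 s); have := XM (qQ.2 t); rewrite /=; lra.
Qed.

(* The oscillations of the monotone function [Q] on the cells of a partition add up to at most [2 * M]. *)
Lemma quantile_mean_riemann Q f L (K : nat) : quantile Q -> 0 <= L -> (0 < K)%N ->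
  (forall x y, `|f x - f y| <= L * `|x - y|) ->
  `|quantile_mean Q f - K%:R^-1 * \sum_(j < K) f (Q (j%:R / K%:R))| <= K%:R^-1 * (L * (2 * M)).
Proof.
move=> qQ L0 K0 hf; have KR : 0 < K%:R :> R by rewrite ltr0n.
have lf : lip f by exists L.
apply: (le_trans (step_integral (c := fun j => f (Q (j%:R / K%:R)))
   (e := fun j => L * (Q (j.+1%:R / K%:R) - Q (j%:R / K%:R))) K0 (quantile_integrable qQ lf) _)).
  move=> j t jK /andP[t1 t2]; apply: (le_trans (hf _ _)); rewrite ler_wpM2l//.
  by rewrite ger0_norm ?subr_ge0 ?qQ.1// lerD2r qQ.1// ltW.
rewrite ler_pM2l ?invr_gt0// -mulr_sumr ler_wpM2l//.
rewrite -(big_mkord xpredT (fun j => Q (j.+1%:R / K%:R) - Q (j%:R / K%:R))).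
by rewrite (telescope_sumr (fun j => Q (j%:R / K%:R)))//; exact: quantile_bounds.
Qed.

Lemma quantile_energy_riemann Q d (K : nat) : quantile Q -> 0 < d -> (0 < K)%N ->
  `|energy M d (quantile_mean Q) (quantile_mean Q) -
    K%:R^-1 * \sum_(i < K) (K%:R^-1 * \sum_(j < K) kernel M d (Q (i%:R / K%:R)) (Q (j%:R / K%:R)))|
  <= 2 * (K%:R^-1 * (d^-1 * (2 * M))).
Proof.
move=> qQ d0 K0; have i0 : 0 <= d^-1 by rewrite invr_ge0 ltW.
have KR : 0 < K%:R :> R by rewrite ltr0n.
have mQ := quantile_mean_mean qQ.
have h1 := quantile_mean_riemann qQ i0 K0 (fun x y => potential_lipschitz M0 x y mQ d0).
have h2 : `|K%:R^-1 * \sum_(i < K) quantile_mean Q (kernel M d (Q (i%:R / K%:R))) -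
   K%:R^-1 * \sum_(i < K) (K%:R^-1 * \sum_(j < K) kernel M d (Q (i%:R / K%:R)) (Q (j%:R / K%:R)))|
   <= K%:R^-1 * (d^-1 * (2 * M)).
  rewrite -mulrBr -sumrB normrM gtr0_norm ?invr_gt0//.
  apply: (@le_trans _ _ (K%:R^-1 * \sum_(i < K) (K%:R^-1 * (d^-1 * (2 * M))))).
    rewrite ler_pM2l ?invr_gt0//; apply: (le_trans (ler_norm_sum _ _ _)); apply: ler_sum => i _.
    by apply: quantile_mean_riemann => // x y; exact: kernel_lipschitz.
  by rewrite sumr_const card_ord -[X in _ * X]mulr_natl mulKf ?gt_eqF.
rewrite [leRHS](_ : _ = K%:R^-1 * (d^-1 * (2 * M)) + K%:R^-1 * (d^-1 * (2 * M))); last by ring.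
exact: (le_trans (ler_distD _ _ _) (lerD h1 h2)).
Qed.

(** The uniform distribution on the sorted list [s]: each entry is taken on a cell of length
    [1 / size s]. The minimum keeps the index in range from [t = 1] on. *)
Definition config_quantile (s : seq R) (t : R) : R :=
  nth 0 s (minn (size s).-1 (Num.truncn (t * (size s)%:R))).

Lemma config_quantile_quantile (s : seq R) : (0 < size s)%N -> sorted <=%R s ->
  (forall x, x \in s -> X x) -> quantile (config_quantile s).
Proof.
move=> s0 ss Xs; split => [t t' tt'|t]; rewrite /config_quantile; last first.
  by apply/Xs/mem_nth; rewrite (leq_ltn_trans (geq_minl _ _))// prednK.
apply: (sorted_leq_nth le_trans lexx 0 ss).
- by rewrite inE (leq_ltn_trans (geq_minl _ _))// prednK.
- by rewrite inE (leq_ltn_trans (geq_minl _ _))// prednK.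
have : (Num.truncn (t * (size s)%:R) <= Num.truncn (t' * (size s)%:R))%N.
  by apply: le_truncn; rewrite ler_wpM2r.
by lia.
Qed.

Lemma config_quantile_mean (s : seq R) f : (0 < size s)%N -> sorted <=%R s ->
  (forall x, x \in s -> X x) -> lip f ->
  quantile_mean (config_quantile s) f = (size s)%:R^-1 * \sum_(x <- s) f x.
Proof.
move=> s0 ss Xs lf; have qQ := config_quantile_quantile s0 ss Xs.
have sR : 0 < (size s)%:R :> R by rewrite ltr0n.
apply/eqP; rewrite -subr_eq0 -normr_le0 (big_nth 0) big_mkord.
apply: (@le_trans _ _ ((size s)%:R^-1 * \sum_(j < size s) 0)); last by rewrite big1 ?mulr0.
apply: (step_integral (c := fun j => f (nth 0 s j)) (e := fun=> 0) s0 (quantile_integrable qQ lf)).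
move=> j t js /andP[t1 t2].
rewrite /= /config_quantile.
have -> : Num.truncn (t * (size s)%:R) = j.
  by apply: truncn_def; rewrite -ler_pdivrMr// -ltr_pdivlMr// t1.
by rewrite (minn_idPr _) ?subrr ?normr0//; lia.
Qed.

Lemma config_energy (s : seq R) d : (0 < size s)%N -> sorted <=%R s ->
  (forall x, x \in s -> X x) -> 0 < d ->
  energy M d (quantile_mean (config_quantile s)) (quantile_mean (config_quantile s)) =
  (size s)%:R^-1 ^+ 2 * \sum_(x <- s) \sum_(y <- s) kernel M d x y.
Proof.
move=> s0 ss Xs d0; have mQ := quantile_mean_mean (config_quantile_quantile s0 ss Xs).
rewrite /energy config_quantile_mean//; last exact: lip_potential mQ d0.
rewrite expr2 -mulrA; congr (_ * _); rewrite mulr_sumr; apply: eq_bigr => x _.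
by rewrite config_quantile_mean//; exact: lip_kernel.
Qed.

(** The diagonal terms are finite thanks to the truncation and linear in the number of points, so
    after division by the squared size they disappear. *)
Lemma double_sum_pair_sum (s : seq R) d : 0 < d ->
  \sum_(x <- s) \sum_(y <- s) kernel M d x y =
  2 * pair_sum (kernel M d) s + (size s)%:R * (ln (2 * M / d) + 1).
Proof.
move=> d0; elim: s => [|x s IH]; first by rewrite big_nil /=; ring.
have k0 : kernel M d x x = ln (2 * M / d) + 1.
  by rewrite /kernel subrr normr0 tlog_at0.
rewrite big_cons /= big_cons k0.
have -> : \sum_(y <- s) \sum_(z <- x :: s) kernel M d y z =
    \sum_(y <- s) (kernel M d y x + \sum_(z <- s) kernel M d y z).
  by apply: eq_bigr => y _; rewrite big_cons.
rewrite [X in _ + X = _]big_split /= IH -[(size s).+1%:R]natr1.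
have -> : \sum_(y <- s) kernel M d y x = \sum_(y <- s) kernel M d x y.
  by apply: eq_bigr => y _; rewrite kernelC.
by ring.
Qed.

(* A pointwise limit along an ultrafilter exists by compactness of [X]; being monotone, the
   quantile functions need no further regularity to pass to the limit in Riemann sums. *)
Lemma quantile_limit (Q : nat -> R -> R) (c : R) : compact X -> (forall n, quantile (Q n)) ->
  (forall d e, 0 < d -> d <= 2 * M -> 0 < e -> exists n0, forall n, (n0 <= n)%N ->
     energy M d (quantile_mean (Q n)) (quantile_mean (Q n)) <= c + e) ->
  exists Q0, quantile Q0 /\ forall d, 0 < d -> d <= 2 * M ->
    energy M d (quantile_mean Q0) (quantile_mean Q0) <= c.
Proof.
move=> cX qQ hE.
have [U [UU sU]] := ultraFilterLemma (F := \oo) _.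
have PU : ProperFilter U by exact: ultra_proper.
have lim_ex t : exists l, X l /\ Q n t @[n --> U] --> l.
  have UX : (Q ^~ t @ U) X by rewrite /fmap /=; apply: filterS filterT => n _; exact: (qQ n).2.
  have [l [Xl cl]] := cX _ (fmap_proper_filter (Q ^~ t) PU) UX.
  (* A cluster point of an ultrafilter is a limit: for a neighbourhood [B] of [l], either its
     preimage or the complement belongs to [U], and the second case contradicts clustering. *)
  exists l; split => // B nB; rewrite /nbhs /= /fmap /=.
  have [//|UC] := in_ultra_setVsetC ((Q ^~ t) @^-1` B) UU.
  have [x [Bx nBx]] : (~` B `&` B) !=set0.
    by apply: cl => //; rewrite /fmap /=; exact: UC.
  by [].
have [Q0 hQ0] := choice lim_ex.
have qQ0 : quantile Q0.
  split=> [s t st|t]; last exact: (hQ0 t).1.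
  apply: (ler_cvg_to (hQ0 s).2 (hQ0 t).2).
  by apply: filterS filterT => n _; exact: (qQ n).1.
exists Q0; split => // d d0 dD; apply/ler_addgt0Pr => e e0.
have kcvg s t : kernel M d (Q n s) (Q n t) @[n --> U] --> kernel M d (Q0 s) (Q0 t).
  apply/cvgrPdist_le => r r0; have rd : 0 < r * d / 2 by rewrite divr_gt0// mulr_gt0.
  have /cvgrPdist_le /(_ _ rd) h1 := (hQ0 s).2.
  have /cvgrPdist_le /(_ _ rd) h2 := (hQ0 t).2.
  apply: filterS2 h1 h2 => n a b.
  have := kernel_lipschitz M0 (Q0 s) (Q0 t) (Q n t) d0.
  have := kernel_lipschitz M0 (Q n t) (Q0 s) (Q n s) d0.
  rewrite !(kernelC _ _ (Q n t)) => k1 k2.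
  have -> : kernel M d (Q0 s) (Q0 t) - kernel M d (Q n s) (Q n t) =
    (kernel M d (Q0 s) (Q0 t) - kernel M d (Q0 s) (Q n t)) +
    (kernel M d (Q0 s) (Q n t) - kernel M d (Q n s) (Q n t)) by ring.
  apply: (le_trans (ler_normD _ _)); rewrite [leRHS](splitr r).
  have E : r / 2 = d^-1 * (r * d / 2) by field; rewrite gt_eqF.
  rewrite {1}E {1}E; apply: lerD.
    by apply: (le_trans k2); rewrite ler_pM2l ?invr_gt0//.
  by apply: (le_trans k1); rewrite ler_pM2l ?invr_gt0//.
pose E := 2 * (d^-1 * (2 * M)).
(* The Riemann error of the energy is the same for all quantile functions, so [K] is fixed before
   the limit, and only finitely many kernel values have to converge. *)
pose K := (Num.truncn (E / (e / 4))).+1.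
have KR : 0 < K%:R :> R by rewrite ltr0n.
have e4 : 0 < e / 4 by rewrite divr_gt0.
have errE : 2 * (K%:R^-1 * (d^-1 * (2 * M))) <= e / 4.
  rewrite mulrCA -/E ler_pdivrMl// -ler_pdivrMr//; exact: ltW (truncnS_gt _).
pose S (q : R -> R) : R := K%:R^-1 * \sum_(i < K) (K%:R^-1 * \sum_(j < K) kernel M d (q (i%:R / K%:R)) (q (j%:R / K%:R))).
have Scvg : S (Q n) @[n --> U] --> S Q0.
  apply: cvgMl_tmp; apply: cvg_big => [|i _]; first exact: add_continuous.
  apply: cvgMl_tmp; apply: cvg_big => [|j _]; first exact: add_continuous.
  exact: kcvg.
have [n0 hn0] := hE _ _ d0 dD e4.
have S0 : S Q0 <= c + e / 4 + e / 4.
  apply: (cvgr_to_le Scvg); apply: sU; exists n0 => //= n /hn0.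
  have := quantile_energy_riemann (qQ n) d0 (isT : (0 < K)%N).
  by rewrite -/(S _) ler_distl => /andP[]; move: errE; lra.
have := quantile_energy_riemann qQ0 d0 (isT : (0 < K)%N).
by rewrite -/(S _) ler_distl => /andP[]; move: errE S0; lra.
Qed.

End Quantile.

(** * From point configurations to measures of low energy *)

Section LowEnergy.
Variables (R : realType) (M : R) (X : set R).
Hypotheses (M0 : 0 < M) (XM : X `<=` [set x | `|x| <= M]).
Let D0 : 0 < 2 * M. Proof. by rewrite mulr_gt0. Qed.

Lemma energy_mono Lam d d' : mean X Lam -> 0 < d' -> d' <= d ->
  energy M d Lam Lam <= energy M d' Lam Lam.
Proof.
move=> mL d0' dd; have d0 : 0 < d by exact: lt_le_trans dd.
apply: (mean_le mL).
- exact: lip_potential mL d0.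
- exact: lip_potential mL d0'.
move=> x _; apply: (mean_le mL); [exact: lip_kernel|exact: lip_kernel|].
by move=> y _; exact: tlog_mono.
Qed.

Lemma kernel_ge0 d x y : 0 < d -> d <= 2 * M -> X x -> X y -> 0 <= kernel M d x y.
Proof.
move=> d0 dD /XM hx /XM hy; apply: tlog_ge0 => //.
by apply: (le_trans (ler_normB _ _)); rewrite /= in hx hy; lra.
Qed.

Lemma energy_ge0 Lam d : mean X Lam -> 0 < d -> d <= 2 * M -> 0 <= energy M d Lam Lam.
Proof.
move=> mL d0 dD; case: (mL) => _ _ pos; apply: (pos); first exact: lip_potential mL d0.
by move=> x Xx; apply: (pos); [exact: lip_kernel|move=> y Xy; exact: kernel_ge0].
Qed.

Lemma pair_sum_perm (s t : seq R) d : 0 < d -> perm_eq s t ->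
  pair_sum (kernel M d) s = pair_sum (kernel M d) t.
Proof.
move=> d0 st; have E : \sum_(x <- s) \sum_(y <- s) kernel M d x y =
    \sum_(x <- t) \sum_(y <- t) kernel M d x y.
  by rewrite (perm_big _ st); apply: eq_bigr => x _; exact: perm_big.
by move: E; rewrite !double_sum_pair_sum// (perm_size st) => /addIr /mulfI; apply.
Qed.

Lemma config_energy_le (s : seq R) d c : (0 < size s)%N ->
  (forall x, x \in s -> X x) -> 0 < d -> 0 <= c ->
  pair_sum (kernel M d) s <= 'C(size s, 2)%:R * c ->
  exists Q, quantile X Q /\
    energy M d (quantile_mean Q) (quantile_mean Q) <= c + (ln (2 * M / d) + 1) / (size s)%:R.
Proof.
move=> s0 Xs d0 c0 hs; pose t := sort <=%R s.
have ps : perm_eq t s by rewrite perm_sort.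
have st : size t = size s by exact: perm_size.
have Xt x : x \in t -> X x by rewrite (perm_mem ps); exact: Xs.
have t0 : (0 < size t)%N by rewrite st.
have tsort : sorted <=%R t by exact: sort_sorted le_total _.
exists (config_quantile t); split; first exact: config_quantile_quantile.
rewrite (config_energy M0 XM t0 tsort Xt d0) double_sum_pair_sum// (pair_sum_perm d0 ps) st.
have nR : 0 < (size s)%:R :> R by rewrite ltr0n.
set n := (size s)%:R in nR *; set k := ln _ + 1.
have bE : 2 * 'C(size s, 2)%:R = n * (n - 1) :> R.
  have -> : n - 1 = (size s).-1%:R by rewrite /n -(prednK s0) -natr1 addrK.
  rewrite /n -!natrM; congr (_%:R); rewrite bin2 -[RHS]odd_double_half.
  have -> : odd (size s * (size s).-1) = false.
    by rewrite oddM; case: (size s) s0 => // m _ /=; case: odd.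
  by rewrite add0n -muln2 mulnC.
have h1 : 2 * pair_sum (kernel M d) s <= n * (n - 1) * c.
  by rewrite -bE -mulrA ler_pM2l.
have -> : c + k / n = n^-1 ^+ 2 * (n ^+ 2 * c + n * k) by field; rewrite gt_eqF.
rewrite ler_wpM2l ?sqr_ge0// lerD2r; apply: (le_trans h1).
rewrite expr2 ler_wpM2r// ler_pM2l//; lra.
Qed.

(** A diagonal argument: the [n]-th quantile function comes from a configuration for the truncation
    [2 * M / n.+1]. Energies grow as the truncation shrinks, so late members of the sequence satisfy
    the bound at every fixed [d], and [quantile_limit] applies. *)
Lemma low_energy_quantile c : compact X ->
  (forall d e, 0 < d -> d <= 2 * M -> 0 < e -> exists n0, forall n, (n0 <= n)%N ->
     exists s : seq R, [/\ size s = n, forall x, x \in s -> X x &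
       pair_sum (kernel M d) s <= 'C(n, 2)%:R * (c + e)]) ->
  exists Q, quantile X Q /\ forall d, 0 < d -> d <= 2 * M ->
    energy M d (quantile_mean Q) (quantile_mean Q) <= c.
Proof.
move=> cX hP.
have step (n : nat) : exists Q, quantile X Q /\
    energy M (2 * M / n.+1%:R) (quantile_mean Q) (quantile_mean Q) <= c + 2 / n.+1%:R.
  have nR : 0 < n.+1%:R :> R by rewrite ltr0n.
  have i0 : 0 < n.+1%:R^-1 :> R by rewrite invr_gt0.
  set d := 2 * M / n.+1%:R; have d0 : 0 < d by rewrite divr_gt0.
  have dD : d <= 2 * M by rewrite ler_pdivrMr// ler_peMr ?(ltW D0)// ler1n.
  have [n0 hn0] := hP _ _ d0 dD i0.
  pose k := ln (2 * M / d) + 1.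
  (* So many points that the diagonal contribution, at most [k / m], drops below [1 / n.+1]. *)
  pose m := (maxn n0 (maxn 2 (Num.truncn (k * n.+1%:R)).+1)).
  have [|s [ss Xs hs]] := hn0 m; first exact: leq_maxl.
  have m2 : (2 <= m)%N by rewrite !leq_max leqnn orbT.
  have m0 : (0 < m)%N by exact: ltnW.
  have hk : k / m%:R <= n.+1%:R^-1.
    rewrite ler_pdivrMr ?ltr0n// mulrC ler_pdivlMr//.
    apply: ltW; apply: (lt_le_trans (truncnS_gt _)); rewrite ler_nat.
    by rewrite !leq_max leqnn !orbT.
  (* [config_energy_le] replaces [m * (m - 1)] by [m ^+ 2], which takes a nonnegative constant;
     positivity of the kernel yields it. *)
  have ce : 0 <= c + n.+1%:R^-1.
    have p0 : 0 <= pair_sum (kernel M d) s.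
      elim: s {ss hs} Xs => [|x s IH] Xs //=; apply: addr_ge0; last first.
        by apply: IH => y ys; apply: Xs; rewrite inE ys orbT.
      rewrite big_seq sumr_ge0// => y ys; apply: kernel_ge0 => //; apply: Xs.
        by rewrite mem_head.
      by rewrite inE ys orbT.
    by have := le_trans p0 hs; rewrite pmulr_rge0// ltr0n bin_gt0.
  rewrite -ss in hs; have s0 : (0 < size s)%N by rewrite ss.
  have [Q [qQ hQ]] := config_energy_le s0 Xs d0 ce hs.
  exists Q; split => //; apply: (le_trans hQ); rewrite ss -/k.
  have -> : c + 2 / n.+1%:R = c + n.+1%:R^-1 + n.+1%:R^-1 by ring.
  by rewrite lerD2l.
have [Q hQ] := choice step.
apply: (quantile_limit M0 XM (Q := Q) cX) => [n|d e d0 dD e0]; first exact: (hQ n).1.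
pose n0 := maxn (Num.truncn (2 * M / d)).+1 (Num.truncn (2 / e)).+1.
exists n0 => n; rewrite geq_max => /andP[h1 h2].
have nR : 0 < n.+1%:R :> R by rewrite ltr0n.
have a1 : 2 * M / n.+1%:R <= d.
  rewrite ler_pdivrMr// -ler_pdivrMl// mulrC; apply: ltW; apply: (lt_le_trans (truncnS_gt _)).
  by rewrite ler_nat (leq_trans h1).
have a2 : 2 / n.+1%:R <= e.
  rewrite ler_pdivrMr// -ler_pdivrMl// mulrC; apply: ltW; apply: (lt_le_trans (truncnS_gt _)).
  by rewrite ler_nat (leq_trans h2).
have [q1 q2] := hQ n; apply: (le_trans (energy_mono (quantile_mean_mean XM q1) _ a1)).
  by rewrite divr_gt0.
by apply: (le_trans q2); rewrite lerD2l.
Qed.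

(** An arbitrary functional is replaced by greedy points of nearly its energy, hence by a quantile
    function. Near-minimizers thereby acquire a limit. *)
Lemma low_energy_of_means c : compact X ->
  (forall e, 0 < e -> exists2 Lam, mean X Lam &
     forall d, 0 < d -> d <= 2 * M -> energy M d Lam Lam <= c + e) ->
  exists Q, quantile X Q /\ forall d, 0 < d -> d <= 2 * M ->
    energy M d (quantile_mean Q) (quantile_mean Q) <= c.
Proof.
move=> cX hP; apply: low_energy_quantile => // d e d0 dD e0.
have e4 : 0 < e / 4 by rewrite divr_gt0.
have [Lam mL hL] := hP _ e4.
exists 2 => n n2.
(* Absorbs the loss [n * (e / 4)] of the greedy choice into the term proportional to the number of
   pairs. *)
have nb : n%:R <= 2 * 'C(n, 2)%:R :> R.
  by rewrite -natrM ler_nat; case: n n2 => [|[|n]]// _; rewrite binS bin1; lia.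
have [s [ss Xs hs]] := low_energy_points M0 n [::] mL d0 e4.
exists s; split => //; move: hs; rewrite cats0 /= big_nil mulr0 addr0 add0r => /le_trans; apply.
have b0 : 0 < 'C(n, 2)%:R :> R by rewrite ltr0n bin_gt0.
have h1 : 'C(n, 2)%:R * energy M d Lam Lam <= 'C(n, 2)%:R * (c + e / 4).
  by rewrite ler_pM2l// hL.
have h2 : n%:R * (e / 4) <= 2 * 'C(n, 2)%:R * (e / 4) by rewrite ler_pM2r.
have h3 : 0 <= 'C(n, 2)%:R * e by rewrite mulr_ge0// ltW.
by move: h1 h2 h3; lra.
Qed.

(* Leja points: the next point maximizes the product of the distances to the previous ones. *)
Lemma leja_points d n : 0 < d ->
  (forall p : {poly R}, p \is monic -> exists x, X x /\ 1 <= `|p.[x]|) ->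
  exists s : seq R, [/\ size s = n, forall x, x \in s -> X x &
       pair_sum (kernel M d) s <= 'C(n, 2)%:R * ln (2 * M)].
Proof.
move=> d0 hX; elim: n => [|n [s [ss Xs hs]]].
  by exists [::]; split => //=; rewrite mul0r.
pose p : {poly R} := \prod_(y <- s) ('X - y%:P).
have [x [Xx px]] := hX p (monic_prod_XsubC _ _ _).
exists (x :: s); split => [|y|/=]; first by rewrite /= ss.
  by rewrite inE => /predU1P[->|/Xs].
have pE : `|p.[x]| = \prod_(y <- s) `|x - y|.
  rewrite /p horner_prod normr_prod; apply: eq_bigr => y _.
  by rewrite hornerXsubC.
have nz y : y \in s -> 0 < `|x - y|.
  move=> ys; rewrite normr_gt0; apply/eqP => xy; move: px; rewrite pE (big_rem y)//= xy.
  by rewrite normr0 mul0r ler10.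
have h : \sum_(y <- s) kernel M d x y <= n%:R * ln (2 * M).
  apply: (@le_trans _ _ (\sum_(y <- s) (ln (2 * M) - ln `|x - y|))).
    rewrite big_seq [leRHS]big_seq; apply: ler_sum => y ys.
    by rewrite -ln_div ?posrE//; [exact: tlog_le (nz _ ys)|exact: nz].
  rewrite sumrB big_const_seq count_predT iter_addr_0 ss -[ln _ *+ n]mulr_natl.
  rewrite gerBl; suff -> : \sum_(y <- s) ln `|x - y| = ln `|p.[x]| by rewrite ln_ge0.
  rewrite pE; elim: s {ss Xs hs p px pE} nz => [|y s IH] nz; first by rewrite !big_nil ln1.
  rewrite !big_cons lnM ?posrE ?nz ?mem_head//; last first.
    by rewrite big_seq prodr_gt0// => z zs; apply: nz; rewrite inE zs orbT.
  by rewrite IH// => z zs; apply: nz; rewrite inE zs orbT.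
by rewrite binS bin1 natrD mulrDl addrC lerD.
Qed.

Lemma leja_quantile : 1 <= M -> compact X ->
  (forall p : {poly R}, p \is monic -> exists x, X x /\ 1 <= `|p.[x]|) ->
  exists Q, quantile X Q /\ forall d, 0 < d -> d <= 2 * M ->
    energy M d (quantile_mean Q) (quantile_mean Q) <= ln (2 * M).
Proof.
move=> M1 cX hX; apply: low_energy_quantile => // d e d0 dD e0; exists 0%N => n _.
have [s [ss Xs hs]] := leja_points n d0 hX; exists s; split => //.
by apply: (le_trans hs); rewrite ler_wpM2l// lerDl ltW.
Qed.

End LowEnergy.

(** * Probability measures on the line *)

Section ComplexLine.
Variable R : realType.

Lemma normr_normc (z : R[i]) : `|z| = (normc z)%:C.
Proof. by []. Qed.

Lemma ball_normc (z w : R[i]) (e : R) : ball (z : (R[i])^o) e%:C w <-> normc (z - w) < e.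
Proof. by rewrite /ball/= /ball_ normr_normc ltcR. Qed.

Lemma Re_le_normc (z : R[i]) : `|complex.Re z| <= normc z.
Proof. by have := normc_ge_Re z; rewrite normr_normc lecR. Qed.

Lemma Im_le_normc (z : R[i]) : `|complex.Im z| <= normc z.
Proof.
by case: z => a b /=; rewrite -sqrtr_sqr ler_wsqrtr// lerDr sqr_ge0.
Qed.

Lemma nbhs_complex (z : (R[i])^o) (A : set R[i]) (e : R) : 0 < e ->
  (forall w, normc (z - w) < e -> A w) -> nbhs z A.
Proof.
move=> e0 h; apply/nbhs_ballP; exists e%:C => /=; first by rewrite ltcR.
by move=> w /ball_normc /h.
Qed.

Lemma continuous_Re : continuous (fun z : (R[i])^o => complex.Re z : R).
Proof.
move=> z; apply/(@cvgrPdist_lt _ _ _ _ (nbhs_filter (z : (R[i])^o))) => e e0; apply: (nbhs_complex e0) => w h.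
by apply: le_lt_trans h; apply: le_trans (Re_le_normc _); rewrite raddfB.
Qed.

Lemma continuous_Im : continuous (fun z : (R[i])^o => complex.Im z : R).
Proof.
move=> z; apply/(@cvgrPdist_lt _ _ _ _ (nbhs_filter (z : (R[i])^o))) => e e0; apply: (nbhs_complex e0) => w h.
by apply: le_lt_trans h; apply: le_trans (Im_le_normc _); rewrite raddfB.
Qed.

Lemma normc_realB (x y : R) : normc (x%:C - y%:C) = `|x - y|.
Proof. by rewrite -rmorphB /normc /= expr0n /= addr0 sqrtr_sqr. Qed.

Lemma continuous_real_complex : continuous (fun x : R => x%:C : (R[i])^o).
Proof.
move=> x A /nbhs_ballP[[a b]] /= e0 hA.
have [a0 b0] : 0 < a /\ b = 0.
  by move: e0; rewrite ltcE /= => /andP[/eqP -> ->].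
rewrite b0 in hA.
apply/nbhs_ballP; exists a => //= y xy; apply: hA; apply/ball_normc.
by rewrite normc_realB.
Qed.

Lemma measurable_open_complex (A : set R[i]) : open (A : set (R[i])^o) ->
  measurable (A : set (borelC R)).
Proof. exact: sub_sigma_algebra. Qed.

Lemma measurable_closed_complex (A : set R[i]) : closed (A : set (R[i])^o) ->
  measurable (A : set (borelC R)).
Proof.
move=> cA; rewrite -(setCK A); apply: measurableC.
by apply: measurable_open_complex; exact: closed_openC.
Qed.

Lemma measurable_Re : measurable_fun setT (fun z : borelC R => complex.Re (z : R[i]) : R).
Proof.
apply: (measurability _ (RGenOpens.measurableE R)) => _ [_ [a [b ->] <-]].
rewrite setTI; apply: measurable_open_complex.
by move/continuousP: continuous_Re; apply; exact: interval_open.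
Qed.

Lemma measurable_real_complex : measurable_fun setT (fun x : R => x%:C : borelC R).
Proof.
apply: (@measurability _ _ (measurableTypeR R) (borelC R) setT (fun x : R => x%:C : borelC R) (@open (R[i])^o) erefl) => _ [A oA <-].
rewrite setTI; apply: open_measurable.
by move/continuousP: continuous_real_complex; apply.
Qed.

Definition line_set (X : set R) : set R[i] := [set x%:C | x in X].

Lemma line_setE X : line_set X = [set z : R[i] | complex.Im z = 0 /\ X (complex.Re z)].
Proof.
apply/seteqP; split=> [_ [x Xx <-]//|[a b] [/= -> Xa]]; by exists a.
Qed.

Lemma closed_line_set X : closed X -> closed (line_set X : set (R[i])^o).
Proof.
move=> cX; rewrite line_setE.
have -> : [set z : R[i] | complex.Im z = 0 /\ X (complex.Re z)] =
   (fun z : (R[i])^o => complex.Im z : R) @^-1` [set 0] `&` (fun z : (R[i])^o => complex.Re z : R) @^-1` X.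
  by apply/seteqP; split.
apply: closedI.
  apply: (@closed_comp _ _ _ [set 0 : R]); first by move=> z _; exact: continuous_Im.
  exact: closed_eq.
by apply: (@closed_comp _ _ _ X) => // z _; exact: continuous_Re.
Qed.

End ComplexLine.

(** * Integration over a set of full measure *)

Section FullSet.
Context d (T : measurableType d) (R : realType).
Variables (nu : probability T R) (K : set T).
Hypotheses (mK : measurable K) (nuK : nu K = 1%E).
Import HBNNSimple.

Lemma full_set_compl : nu (~` K) = 0%E.
Proof. by rewrite probability_setC// nuK -EFinB subrr. Qed.

(** No measurability of [f] is assumed: the integral is a supremum over simple functions below [f],
    and cutting these off outside [K] does not change their integrals. This permits passing to the
    line before the measurability of the logarithmic potential is known. *)
Lemma ge0_integral_full_set (f : T -> \bar R) : (forall x, 0 <= f x)%E ->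
  (\int[nu]_z f z = \int[nu]_(z in K) f z)%E.
Proof.
move=> f0; rewrite [RHS]integral_mkcond.
have fK0 x : (0 <= (f \_ K) x)%E by rewrite /patch; case: ifP.
apply/eqP; rewrite eq_le !ge0_integralTE//; apply/andP; split; last first.
  apply: le_ereal_sup => _ [h /= hg <-]; exists h => //= x.
  by apply: (le_trans (hg x)); rewrite /patch; case: ifP.
apply: ge_ereal_sup => _ [h /= hg <-].
apply: ereal_sup_ubound; exists (proj_nnsfun h mK).
  move=> x; have := hg x; rewrite /= mindicE /patch; case: ifP => _; first by rewrite mulr1.
  by rewrite mulr0.
rewrite -!integralT_nnsfun.
have mN := measurableC mK.
rewrite [RHS](@ge0_negligible_integral _ _ _ _ setT (~` K))//; last 3 first.
- by apply/measurable_EFinP; exact: measurable_funP.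
- by move=> x _; rewrite lee_fin.
- exact: full_set_compl.
rewrite setTD setCK [RHS]integral_mkcond; apply: eq_integral => x _.
by rewrite /= mindicE /patch; case: ifP => _; rewrite ?mulr1 ?mulr0.
Qed.

Lemma integral_full_set (f : T -> \bar R) : (\int[nu]_z f z = \int[nu]_(z in K) f z)%E.
Proof. by rewrite integralE [RHS]integralE !ge0_integral_full_set. Qed.

End FullSet.

Section SubConstant.
Context d (T : measurableType d) (R : realType).
Variables (mu : {measure set T -> \bar R}) (K : set T).
Hypotheses (mK : measurable K) (muK : mu K = 1%E).

(** The integral of [H] may be infinite. In that case the negative part of [H - c] still has
    integral at most [c], so both sides are [+oo]. *)
Lemma integral_subc (H : T -> \bar R) (c : R) : measurable_fun K H ->
  (forall x, K x -> 0 <= H x)%E -> 0 <= c ->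
  (\int[mu]_(x in K) (H x - c%:E) = \int[mu]_(x in K) H x - c%:E)%E.
Proof.
move=> mH H0 c0.
have Ic : (\int[mu]_(x in K) (cst c%:E x) = c%:E)%E by rewrite integral_cst// muK mule1.
have mc : measurable_fun K (fun x => H x - c%:E)%E.
  by apply: emeasurable_funB => //; exact: measurable_cst.
have [HI|] := ltP (\int[mu]_(x in K) H x)%E +oo%E.
  rewrite integralB//= ?Ic//.
  - apply/integrableP; split => //.
    by rewrite (eq_integral H)// => x; rewrite inE => Kx; rewrite gee0_abs// H0.
  - apply/integrableP; split; first exact: measurable_cst.
    rewrite (eq_integral (cst c%:E)); last by move=> x _ /=; rewrite ger0_norm.
    by rewrite Ic ltry.
rewrite leye_eq => /eqP HI; rewrite HI addye//.
set G := (fun x => H x - c%:E)%E.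
rewrite integralE.
have Gp : (\int[mu]_(x in K) G^\+ x = +oo)%E.
  apply/eqP; rewrite -leye_eq -HI.
  have h : (\int[mu]_(x in K) H x <= \int[mu]_(x in K) (G^\+ x + cst c%:E x))%E.
    apply: ge0_le_integral => //.
    - by apply: emeasurable_funD; [exact: measurable_funepos|exact: measurable_cst].
    - by move=> x Kx; rewrite /= -leeBlDr// funeposE /G le_max lexx.
  move: h; rewrite ge0_integralD//; last exact: measurable_funepos.
  rewrite Ic HI => h; move: h.
  by case: (\int[mu]_(x in K) G^\+ x)%E => //=.
have Gn : (\int[mu]_(x in K) G^\- x <= c%:E)%E.
  rewrite -Ic; apply: ge0_le_integral => //; first exact: measurable_funeneg.
  move=> x Kx; rewrite funenegE /G ge_max; apply/andP; split => //.
  by rewrite leeNl leeDr// H0.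
rewrite Gp.
have : (0 <= \int[mu]_(x in K) G^\- x)%E by apply: integral_ge0.
by move: Gn; case: (\int[mu]_(x in K) G^\- x)%E.
Qed.

End SubConstant.

(** * Probability measures on a compact subset of the line and their logarithmic energy *)

Section LineMeasure.
Variables (R : realType) (M : R) (X : set R).
Hypotheses (M0 : 1 <= M) (XM : X `<=` [set x | `|x| <= M]) (cX : closed X).
Variable nu : probability (borelC R) R.
Hypothesis nuX : nu (line_set X) = 1%E.
Let K : set (borelC R) := line_set X.
Let D := 2 * M.

Definition line_mean (f : R -> R) : R := \int[nu]_(z in K) f (complex.Re (z : R[i])).

Let Mp : 0 < M. Proof. exact: lt_le_trans M0. Qed.

Let mK : measurable K.
Proof. by apply: measurable_closed_complex; exact: closed_line_set. Qed.

Lemma line_measurable (f : R -> R) : lip f ->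
  measurable_fun K (fun z : borelC R => f (complex.Re (z : R[i]))).
Proof.
move=> lf; apply: measurable_funTS; apply: measurableT_comp; first exact: lip_measurable.
exact: measurable_Re.
Qed.

Lemma line_integrable (f : R -> R) : lip f ->
  nu.-integrable K (EFin \o (fun z : borelC R => f (complex.Re (z : R[i])))).
Proof.
move=> lf; apply: measurable_bounded_integrable => //.
- by apply: (@le_lt_trans _ _ 1%:E); rewrite ?ltry// -nuX.
- exact: line_measurable.
- have [B hB] := lip_bounded XM lf.
  exists B; split => [|r Br z [x Xx <-]]; first exact: num_real.
  by apply: (le_trans (hB x Xx)); exact: ltW.
Qed.

Lemma line_meanE (f : R -> R) : lip f ->
  (\int[nu]_(z in K) (f (complex.Re (z : R[i])))%:E)%E = (line_mean f)%:E.
Proof. by move=> lf; rewrite fineK//; exact: integrable_fin_num (line_integrable lf). Qed.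

Lemma line_mean_mean : mean X line_mean.
Proof.
split.
- move=> a f g lf lg; rewrite /line_mean RintegralD//; last 2 first.
  + exact: (line_integrable (lipZ a lf)).
  + exact: (line_integrable lg).
  by rewrite RintegralZl//; exact: (line_integrable lf).
- by rewrite /line_mean Rintegral_cst// mul1r; exact: (congr1 fine nuX).
- by move=> f lf h; apply: Rintegral_ge0 => _ [x Xx <-]; exact: h.
Qed.

Lemma line_integral_close (f : R[i] -> R) (g : R -> R) (e : R) :
  continuous (fun x : R => f x%:C) -> lip g -> (forall x, X x -> `|f x%:C - g x| <= e) ->
  `|\int[nu]_z f z - line_mean g| <= e.
Proof.
move=> cf lg fg.
have mL := line_mean_mean.
have lD s : lip (fun x => g x + s).
  by have := lipD 1 lg (lip_cst s); under [X in lip X]eq_fun do rewrite mul1r.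
have fE : \int[nu]_z f z = \int[nu]_(z in K) f (complex.Re (z : R[i]))%:C.
  rewrite /Rintegral (integral_full_set mK nuX); congr fine.
  by apply: eq_integral => z; rewrite inE => -[x _ <-].
have [B hB] := lip_bounded XM lg.
have iF : nu.-integrable K (EFin \o (fun z : borelC R => f (complex.Re (z : R[i]))%:C)).
  apply: measurable_bounded_integrable => //.
  - by apply: (@le_lt_trans _ _ 1%:E); rewrite ?ltry// -nuX.
  - apply: measurable_funTS.
    apply: (@measurableT_comp _ _ _ _ _ _ (fun x : R => f x%:C)); last exact: measurable_Re.
    exact: continuous_measurable_fun.
  - exists (e + B); split => [|r Br z [x Xx <-]]; first exact: num_real.
    apply: le_trans (ltW Br); rewrite -[f _](subrK (g x)).
    by apply: (le_trans (ler_normD _ _)); rewrite lerD ?fg ?hB.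
have gD s : line_mean (fun x => g x + s) = line_mean g + s.
  by rewrite (meanD mL lg (lip_cst s)) (mean_cst mL).
rewrite fE ler_distl -gD; apply/andP; split.
  apply: le_Rintegral => //; first exact: (line_integrable (lD (- e))).
  by move=> _ [x Xx <-]; have := fg x Xx; rewrite ler_distl => /andP[].
rewrite -gD; apply: le_Rintegral => //; first exact: (line_integrable (lD e)).
by move=> _ [x Xx <-]; have := fg x Xx; rewrite ler_distl => /andP[].
Qed.

(** Truncations decreasing from [D] to 0: never above [D], where the kernel is nonnegative on [X],
    and monotone, so that the kernels increase. *)
Let dn (n : nat) : R := D / n.+1%:R.

Let dn0 n : 0 < dn n. Proof. by rewrite divr_gt0// mulr_gt0. Qed.

Let dnD n : dn n <= D.
Proof. by rewrite ler_pdivrMr// ler_peMr ?ler1n// mulr_ge0// ltW. Qed.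

Let dn_mono : {homo dn : m n / (m <= n)%N >-> n <= m}.
Proof.
move=> m n mn; rewrite /dn ler_pM2l; last by rewrite mulr_gt0.
by rewrite lef_pV2 ?posrE ?ltr0n// ler_nat ltnS.
Qed.

Let dn_small (r : R) : 0 < r -> exists n0, forall n, (n0 <= n)%N -> dn n <= r.
Proof.
move=> r0; exists (Num.truncn (D / r)) => n hn.
rewrite /dn ler_pdivrMr// mulrC -ler_pdivrMr//; apply: ltW.
apply: lt_le_trans (truncnS_gt _) _; by rewrite ler_nat.
Qed.

Lemma log_kernel_limit (x y : R) : X x -> X y ->
  ((kernel M (dn n) x y)%:E @[n --> \oo] --> - lne `|x - y|%:E + (ln D)%:E)%E.
Proof.
move=> Xx Xy; have [xy|xy] := eqVneq x y.
  rewrite xy subrr normr0 le0_lneNy// /= addye//.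
  apply/cvgeyPge => A; have e0 : 0 < D / expR A by rewrite divr_gt0 ?expR_gt0// mulr_gt0.
  have [n0 hn0] := dn_small e0.
  exists n0 => // n /= /hn0 h; rewrite lee_fin /kernel subrr normr0 tlog_at0//.
  rewrite -[leLHS]addr0 lerD// -{1}[A]expRK ler_ln ?posrE ?expR_gt0 ?divr_gt0 ?mulr_gt0//.
  by rewrite ler_pdivlMr// mulrC -ler_pdivlMr// expR_gt0.
have r0 : 0 < `|x - y| by rewrite normr_gt0 subr_eq0.
rewrite lne_EFin// -EFinN -EFinD.
have [n0 hn0] := dn_small r0.
apply: cvg_near_cst; exists n0 => // n /= /hn0 h.
by rewrite /kernel tlog_far// ln_div ?posrE ?mulr_gt0// addrC.
Qed.

(** After adding [ln D] the truncated kernels are nonnegative and increase to the logarithmic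
    kernel, so monotone convergence applies first in [w], then in [z]; [integral_subc] takes the
    constant out of possibly infinite integrals. *)
Lemma log_energyE :
  (log_energy nu = limn (fun n => (energy M (dn n) line_mean line_mean)%:E) - (ln D)%:E)%E.
Proof.
have mL := line_mean_mean.
have lnD : 0 <= ln D by rewrite ln_ge0// (le_trans M0)// ler_peMl ?ler1n// ltW.
have inner z : K z -> (\int[nu]_(w in K) - lne (normc ((z : R[i]) - (w : R[i])))%:E =
    limn (fun n => (line_mean (kernel M (dn n) (complex.Re (z : R[i]))))%:E) - (ln D)%:E)%E.
  move=> [x Xx <-].
  pose g n (w : borelC R) := (kernel M (dn n) x (complex.Re (w : R[i])))%:E.
  have mg n : measurable_fun K (g n).
    by apply/measurable_EFinP; apply: line_measurable; exact: lip_kernel.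
  have g0 n w : K w -> (0 <= g n w)%E.
    by move=> [y Xy <-]; rewrite lee_fin (kernel_ge0 Mp XM).
  have gnd w : K w -> {homo g^~ w : m n / (m <= n)%N >-> (m <= n)%E}.
    by move=> _ m n mn; rewrite lee_fin tlog_mono// ?mulr_gt0// dn_mono.
  rewrite (eq_integral (fun w => limn (g^~ w) - (ln D)%:E)%E); last first.
    move=> w; rewrite inE => -[y Xy <-].
    rewrite normc_realB (cvg_lim _ (log_kernel_limit Xx Xy))//.
    by rewrite addeK.
  rewrite integral_subc//; last 2 first.
  - apply: emeasurable_fun_cvg mg _ => w Kw.
    by apply: ereal_nondecreasing_is_cvgn; exact: gnd.
  - move=> w Kw; apply: lime_ge; first by apply: ereal_nondecreasing_is_cvgn; exact: gnd.
    by apply: nearW => n; exact: g0.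
  rewrite monotone_convergence//.
  congr (limn _ - _)%E; apply: funext => n.
  by rewrite (line_meanE (lip_kernel Mp x (dn0 n))).
rewrite /log_energy (integral_full_set mK nuX).
pose g n (z : borelC R) := (line_mean (kernel M (dn n) (complex.Re (z : R[i]))))%:E.
have lg n : lip (fun x => line_mean (kernel M (dn n) x)) by exact: lip_potential mL (dn0 n).
have mg n : measurable_fun K (g n).
  by apply/measurable_EFinP; apply: (line_measurable (lg n)).
have g0 n w : K w -> (0 <= g n w)%E.
  move=> [x Xx <-]; rewrite lee_fin; case: mL => _ _; apply; first exact: lip_kernel.
  by move=> y Xy; rewrite (kernel_ge0 Mp XM).
have gnd w : K w -> {homo g^~ w : m n / (m <= n)%N >-> (m <= n)%E}.
  move=> _ m n mn; rewrite lee_fin; apply: (mean_le mL); try exact: lip_kernel.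
  by move=> y _; rewrite tlog_mono// ?mulr_gt0// dn_mono.
rewrite (eq_integral (fun z => limn (g^~ z) - (ln D)%:E)%E); last first.
  by move=> z; rewrite inE => Kz; rewrite (integral_full_set mK nuX) inner.
rewrite integral_subc//; last 2 first.
- apply: emeasurable_fun_cvg mg _ => w Kw.
  by apply: ereal_nondecreasing_is_cvgn; exact: gnd.
- move=> w Kw; apply: lime_ge; first by apply: ereal_nondecreasing_is_cvgn; exact: gnd.
  by apply: nearW => n; exact: g0.
rewrite monotone_convergence//.
congr (limn _ - _)%E; apply: funext => n.
exact: (line_meanE (lg n)).
Qed.

Lemma log_energy_le (c : R) : (log_energy nu <= c%:E)%E <->
  forall d, 0 < d -> d <= D -> energy M d line_mean line_mean <= c + ln D.
Proof.
have mL := line_mean_mean.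
have nd : {homo (fun n => (energy M (dn n) line_mean line_mean)%:E) : m n / (m <= n)%N >-> (m <= n)%E}.
  by move=> m n mn; rewrite lee_fin; apply: (energy_mono Mp mL) => //; exact: dn_mono.
rewrite log_energyE leeBlDr// -EFinD; split => h.
  move=> d d0 dD; have [n0 hn0] := dn_small d0.
  rewrite -lee_fin; apply: le_trans h; apply: (@le_trans _ _ (energy M (dn n0) line_mean line_mean)%:E).
    by rewrite lee_fin; apply: (energy_mono Mp mL) => //; exact: hn0.
  apply: lime_ge; first exact: ereal_nondecreasing_is_cvgn.
  exists n0; [exact: I|move=> n; exact: nd].
apply: lime_le; first exact: ereal_nondecreasing_is_cvgn.
by apply: nearW => n; rewrite lee_fin h.
Qed.

End LineMeasure.

(** * Existence of a minimizer of the logarithmic energy *)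

Section EquilibriumExistence.
Variables (R : realType) (M : R) (X : set R).
Hypotheses (M1 : 1 <= M) (XM : X `<=` [set x | `|x| <= M]) (kX : compact X).
Let M0 : 0 < M. Proof. exact: lt_le_trans M1. Qed.
Let cX : closed X. Proof. exact: compact_closed. Qed.

Lemma quantile_law Q : quantile X Q -> exists nu : probability (borelC R) R,
  nu (line_set X) = 1%E /\ forall f, lip f -> line_mean X nu f = quantile_mean Q f.
Proof.
move=> qQ.
have mF : @measurable_fun _ _ (measurableTypeR R) (borelC R) setT (fun t : R => (Q t)%:C).
  have := measurableT_comp (@measurable_real_complex R) (quantile_measurable qQ).
  exact.
pose F := MeasurableFun.Pack (MeasurableFun.Class (isMeasurableFun.Build _ _ _ _ _ mF)).
have nuX : distribution (uniform_prob (@ltr01 R)) F (line_set X) = 1%E.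
  rewrite /distribution /pushforward (_ : _ @^-1` _ = setT); first exact: probability_setT.
  by apply/seteqP; split=> // t _ /=; exists (Q t) => //; exact: qQ.2.
exists (distribution (uniform_prob (@ltr01 R)) F); split => // f lf.
have mL := line_mean_mean XM cX nuX.
have mQ := quantile_mean_mean XM qQ.
(* The change of variables is done for integrands nonnegative on [X]; a general [f] is reduced to
   this by adding a bound [B], since both functionals send constants to themselves. *)
suff pos g : lip g -> (forall x, X x -> 0 <= g x) ->
    line_mean X (distribution (uniform_prob (@ltr01 R)) F) g = quantile_mean Q g.
  have [B hB] := lip_bounded XM lf.
  have lB := lip_cst B.
  have lfB : lip (fun x => f x + B).
    by have := lipD 1 lf lB; under [X in lip X]eq_fun do rewrite mul1r.
  have := pos _ lfB; rewrite (meanD mL)// (meanD mQ)// (mean_cst mL) (mean_cst mQ).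
  move=> h; apply: (addIr B); apply: h => x /hB; rewrite ler_norml => /andP[+ _].
  by rewrite -subr_ge0 opprK.
move=> lg g0.
rewrite /line_mean /Rintegral -(integral_full_set _ nuX); last first.
  by apply: measurable_closed_complex; exact: closed_line_set.
have mg : measurable_fun setT (fun z : borelC R => (g (complex.Re (z : R[i])))%:E).
  apply/measurable_EFinP; apply: measurableT_comp; first exact: lip_measurable.
  exact: measurable_Re.
have mgQ : measurable_fun setT (fun t : measurableTypeR R => (g (Q t))%:E).
  exact: (measurableT_comp mg mF).
have iQ : (uniform_prob (@ltr01 R)).-integrable setT (fun t => (g (Q t))%:E).
  have [B hB] := lip_bounded XM lg.
  apply/integrableP; split; first exact: mgQ.
  apply: (@le_lt_trans _ _ (\int[uniform_prob (@ltr01 R)]_t (cst B%:E t))%E).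
    apply: ge0_le_integral => //; first by apply: measurableT_comp.
    by move=> t _; rewrite lee_fin hB//; exact: qQ.2.
  rewrite integral_cst//.
  apply: (@eq_ind_r _ 1%E (fun m => (B%:E * m < +oo)%E)); last exact: probability_setT.
  by rewrite mule1 ltry.
rewrite (integral_distribution (X := F) mg iQ).
rewrite integral_uniform//; last by move=> t; rewrite lee_fin g0//; exact: qQ.2.
by rewrite subr0 invr1 mul1e.
Qed.

Let lnD := ln (2 * M).

(** The infimum of energies is at most 0 by Leja points and at least [- lnD] by positivity of the
    kernel. Measures close to it are traded for quantile functions by [low_energy_of_means], and the
    law of the resulting one attains it. *)
Lemma equilibrium_exists :
  (forall p : {poly R}, p \is monic -> exists x, X x /\ 1 <= `|p.[x]|) ->
  exists nu : probability (borelC R) R,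
    is_equilibrium (line_set X) nu /\ (log_energy nu <= 0)%E.
Proof.
move=> hX.
have of_quantile c Q : quantile X Q ->
   (forall d, 0 < d -> d <= 2 * M -> energy M d (quantile_mean Q) (quantile_mean Q) <= c + lnD) ->
   exists nu : probability (borelC R) R, nu (line_set X) = 1%E /\ (log_energy nu <= c%:E)%E.
  move=> qQ hQ; have [nu [nuX hnu]] := quantile_law qQ.
  exists nu; split => //; apply/(log_energy_le M1 XM cX nuX) => d d0 dD.
  have mQ := quantile_mean_mean XM qQ.
  rewrite (_ : energy _ _ _ _ = energy M d (quantile_mean Q) (quantile_mean Q)); first exact: hQ.
  rewrite /energy (_ : (fun x => line_mean X nu _) = fun x => quantile_mean Q (kernel M d x)).
    by rewrite hnu//; exact: lip_potential mQ d0.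
  by apply: funext => x; rewrite hnu//; exact: lip_kernel.
pose S := [set c : R | exists nu : probability (borelC R) R,
   nu (line_set X) = 1%E /\ (log_energy nu <= c%:E)%E].
have S0 : S 0.
  have [Q [qQ hQ]] := leja_quantile M0 XM M1 kX hX.
  by apply: (of_quantile _ _ qQ) => d d0 dD; rewrite add0r hQ.
have Sb c : S c -> - lnD <= c.
  move=> [nu [nuX /(log_energy_le M1 XM cX nuX) h]].
  have D0 : 0 < 2 * M by rewrite mulr_gt0.
  have := le_trans (energy_ge0 M0 XM (line_mean_mean XM cX nuX) D0 (lexx _)) (h _ D0 (lexx _)).
  by rewrite -/lnD; lra.
have hS : has_inf S by split; [exists 0|exists (- lnD)].
have [Q [qQ hQ]] : exists Q, quantile X Q /\ forall d, 0 < d -> d <= 2 * M ->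
    energy M d (quantile_mean Q) (quantile_mean Q) <= inf S + lnD.
  apply: (low_energy_of_means M0 XM kX) => e e0.
  have [c [nu [nuX /(log_energy_le M1 XM cX nuX) h]] hc] := inf_adherent e0 hS.
  exists (line_mean X nu); first exact: (line_mean_mean XM cX nuX).
  by move=> d d0 dD; have := h d d0 dD; rewrite -/lnD; lra.
have [nu [nuX hnu]] := of_quantile _ _ qQ hQ.
exists nu; split; last first.
  apply: (le_trans hnu); rewrite lee_fin; apply: ge_inf => //; exact: hS.2.
split => // nu' nuX'; apply: (le_trans hnu).
(* Energy [-oo] would put [- lnD - 1] into [S], against the lower bound [Sb]. *)
case E : (log_energy nu') => [r| |]; first 1 last.
- exact: leey.
- have /Sb : S (- lnD - 1) by exists nu'; split; rewrite // E leNye.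
  by rewrite leNgt gtrBl ltr01.
rewrite lee_fin; apply: ge_inf; first exact: hS.2.
by exists nu'; split; rewrite // E.
Qed.

(** The last clause is [log_energy nu <= 0] after the shift of the kernel by [ln (2 * M)]. *)
Definition low_energy (nu : probability (borelC R) R) : Prop :=
  [/\ nu (line_set X) = 1%E, mean X (line_mean X nu) &
      forall d, 0 < d -> d <= 2 * M ->
        energy M d (line_mean X nu) (line_mean X nu) <= ln (2 * M)].

Lemma equilibrium_low_energy :
  (forall p : {poly R}, p \is monic -> exists x, X x /\ 1 <= `|p.[x]|) ->
  low_energy (equilibrium_measure (line_set X)).
Proof.
move=> hX; have [nu [hnu nu0]] := equilibrium_exists hX.
have [mK hmin] : is_equilibrium (line_set X) (equilibrium_measure (line_set X)).
  by apply: (@getPex _ (is_equilibrium (line_set X))); exists nu.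
split => // [|d d0 dD]; first exact: (line_mean_mean XM cX mK).
have /(log_energy_le M1 XM cX mK) h : (log_energy (equilibrium_measure (line_set X)) <= 0%:E)%E.
  by apply: le_trans nu0; apply: hmin; exact: hnu.1.
by have := h d d0 dD; rewrite add0r.
Qed.

End EquilibriumExistence.

(** * Convergence of the equilibrium measures *)

Section CloseMeans.
Variable R : realType.

Lemma lipschitz_approximation (M e : R) (g : R -> R) : 0 < M -> 0 < e -> continuous g ->
  exists f, lip f /\ forall x, `|x| <= M -> `|g x - f x| <= e.
Proof.
move=> M0 e0 cg; have [d d0 hd] := @unif_continuous_segment _ g (- M) M e cg e0.
pose N := (Num.truncn (2 * M / d)).+1.
have hN : 2 * M / N%:R < d.
  by rewrite ltr_pdivrMr ?ltr0n// [d * _]mulrC -ltr_pdivrMr//; exact: truncnS_gt.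
exists (fun x => \sum_(a < N.+1) g (grid M N a) * hat M N a x); split.
  by apply: lip_sum => a; apply: lipZ; exact: lip_hat.
move=> x xM; apply: interpolation_error => // y xy; apply: ltW.
by apply: hd; [rewrite -ler_norml|exact: le_lt_trans hN].
Qed.

Lemma energy_avg (M d : R) (X : set R) Lam Lam' : 0 < M -> mean X Lam -> mean X Lam' -> 0 < d ->
  let A f := (Lam f + Lam' f) / 2 in
  4 * energy M d A A = energy M d Lam Lam + energy M d Lam Lam' + energy M d Lam' Lam
    + energy M d Lam' Lam'.
Proof.
move=> M0 mL mL' d0 A.
have l1 := lip_potential M0 mL d0; have l2 := lip_potential M0 mL' d0.
have E Lam0 : mean X Lam0 -> Lam0 (fun x => A (kernel M d x)) =
    2^-1 * (energy M d Lam0 Lam + energy M d Lam0 Lam').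
  move=> m0; rewrite /A; under [X in Lam0 X]eq_fun do rewrite mulrC.
  rewrite (meanZ m0); first by rewrite (meanD m0).
  by have := lipD 1 l1 l2; under [X in lip X]eq_fun do rewrite mul1r.
by rewrite {1}/energy {1}/A !E//; field.
Qed.

Lemma low_energy_means_close (M : R) (Y : set R) (Q : {poly R}) (e e' L : R) Lam Lam' (f : R -> R) :
  0 < M -> Y `<=` [set x | `|x| <= M] -> Q \is monic -> (1 < size Q)%N -> 0 <= e -> e < e' ->
  (forall x, Y x -> `|Q.[x]| <= expR ((size Q).-1%:R * e)) ->
  mean Y Lam -> mean Y Lam' ->
  (forall d, 0 < d -> d <= 2 * M -> energy M d Lam Lam <= ln (2 * M)) ->
  (forall d, 0 < d -> d <= 2 * M -> energy M d Lam' Lam' <= ln (2 * M)) ->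
  0 <= L -> (forall x y, `|f x - f y| <= L * `|x - y|) ->
  (Lam f - Lam' f) ^+ 2 <= (2 * M * L) ^+ 2 * (4 * e').
Proof.
move=> M0 YM mQ sQ e0 ee' hQ mL mL' hE hE' L0 hf.
have mA := mean_avg mL mL'; set A := (fun _ => _) in mA.
(* The lower bound for the average, used by contradiction, yields one truncation [d], at the price
   of passing from [e] to [e']. The same [d] then serves in the two upper bounds, and the energy of
   the difference is at most [4 * e']. *)
have [d [d0 dD hd]] : exists d, [/\ 0 < d, d <= 2 * M & ln (2 * M) - e' < energy M d A A].
  apply: contrapT => h.
  suff : - e <= - e' by rewrite lerN2 leNgt ee'.
  apply: (energy_lower_bound M0 YM mA mQ sQ e0 hQ) => d d0 dD.
  rewrite leNgt; apply/negP => hd; apply: h; exists d; split => //.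
  by move: hd; rewrite addrC.
apply: (le_trans (energy_controls M0 YM mL mL' L0 hf d0 dD)).
rewrite ler_wpM2l ?sqr_ge0//.
have hA : 4 * energy M d A A = _ := energy_avg M0 mL mL' d0.
by have := hE d d0 dD; have := hE' d d0 dD; lra.
Qed.

End CloseMeans.

(** * Low-energy functionals on nearby spectra *)

Section SpectralMeans.
Variables (R : realType) (v : R -> R) (alpha M : R).
Hypotheses (hv : circle_continuous v) (irr : irrational alpha) (M0 : 0 < M).
Hypothesis hM : forall beta theta x, spec v beta theta x -> `|x| <= M.
Hypothesis hL : forall x, spec v alpha 0 x -> lyapunov v alpha x%:C = 0.

Lemma small_polynomial_near e : 0 < e -> exists Q : {poly R}, exists2 d, 0 < d &
  [/\ Q \is monic, (1 < size Q)%N & forall beta theta (m : int) x,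
      `|beta - alpha - m%:~R| < d -> spec v beta theta x ->
      `|Q.[x]| <= expR ((size Q).-1%:R * e)].
Proof.
move=> e0; have e20 : 0 < e / 2 by rewrite divr_gt0.
have [Q [mQ sQ hQ]] := small_polynomial hv hL e20; exists Q.
set n := (size Q).-1.
have n0 : 0 < n%:R :> R by rewrite ltr0n /n; case: (size Q) sQ => [|[|]].
have gap : 0 < expR (n%:R * e) - expR (n%:R * (e / 2)).
  by rewrite subr_gt0 ltr_expR ltr_pM2l//; lra.
have [r r0 hr] := @unif_continuous_segment _ (fun x => Q.[x]) (- M) M _
  (@continuous_horner _ Q) gap.
have r20 : 0 < (r / 2) ^+ 2 by rewrite exprn_gt0// divr_gt0.
have [d d0 hd] := spec_near_irrational hv irr r20.
exists d => //; split => // beta theta m x hb hx.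
have [y [hy yx]] := hd _ _ _ _ hb hx.
have yx' : `|y - x| < r.
  rewrite -real_normK ?num_real// ler_pXn2r ?nnegrE ?normr_ge0 ?divr_ge0 ?(ltW r0)// in yx.
  by apply: (le_lt_trans yx); rewrite ltr_pdivrMr// ltr_pMr//; lra.
have yM : - M <= y <= M by rewrite -ler_norml; exact: hM hy.
have h1 := hr y x yM yx'; have h2 := hQ y hy.
rewrite -[Q.[x]](subrK Q.[y]); apply: (le_trans (ler_normD _ _)).
by rewrite distrC in h1; rewrite -/n in h2; lra.
Qed.

Lemma spectral_means_close f e : lip f -> 0 < e -> exists2 d, 0 < d &
  forall beta (m : int) Lam Lam', `|beta - alpha - m%:~R| < d ->
    mean (union_spec v beta) Lam -> mean (spec v alpha 0) Lam' ->
    (forall d, 0 < d -> d <= 2 * M -> energy M d Lam Lam <= ln (2 * M)) ->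
    (forall d, 0 < d -> d <= 2 * M -> energy M d Lam' Lam' <= ln (2 * M)) ->
    `|Lam f - Lam' f| <= e.
Proof.
move=> [L0 hL0] e0; pose L := `|L0| + 1.
have Lp : 0 < L by rewrite ltr_wpDl.
have hf x y : `|f x - f y| <= L * `|x - y|.
  apply: (le_trans (hL0 x y)); rewrite ler_wpM2r//.
  by apply: (le_trans (ler_norm _)); rewrite lerDl.
(* Solves [(2 * M * L) ^+ 2 * (4 * e1) = e ^+ 2]. *)
pose e1 := (e / (2 * M * L)) ^+ 2 / 4.
have ML : 0 < 2 * M * L by rewrite !mulr_gt0.
have e10 : 0 < e1 by rewrite divr_gt0// exprn_gt0// divr_gt0.
have e120 : 0 < e1 / 2 by rewrite divr_gt0.
have [Q [d d0 [mQ sQ hQ]]] := small_polynomial_near e120.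
exists d => // beta m Lam Lam' hb mL mL' hE hE'.
(* Both functionals are viewed on the union of the two spectra, where a single polynomial is small,
   so that their average is covered too. *)
have mLY : mean (union_spec v beta `|` spec v alpha 0) Lam by apply: mean_sub mL => x; left.
have mLY' : mean (union_spec v beta `|` spec v alpha 0) Lam' by apply: mean_sub mL' => x; right.
have e1e : e1 / 2 < e1 by lra.
have YM : union_spec v beta `|` spec v alpha 0 `<=` [set x | `|x| <= M].
  by move=> x [[t]|] /hM.
have hQY x : (union_spec v beta `|` spec v alpha 0) x -> `|Q.[x]| <= expR ((size Q).-1%:R * (e1 / 2)).
  move=> [[t]|] hx; first exact: (hQ beta t m).
  by apply: (hQ alpha 0 0) => //; rewrite subrr sub0r normrN normr0.
have := low_energy_means_close M0 YM mQ sQ (ltW e120) e1e hQY mLY mLY' hE hE' (ltW Lp) hf.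
rewrite (_ : _ * (4 * e1) = e ^+ 2); last by rewrite /e1; field; rewrite gt_eqF//= gt_eqF.
by rewrite -real_normK ?num_real// ler_pXn2r ?nnegrE ?normr_ge0// ltW.
Qed.

End SpectralMeans.

Section SpectralEquilibrium.
Variables (R : realType) (v : R -> R) (M : R).
Hypotheses (hv : circle_continuous v) (M1 : 1 <= M).
Hypothesis hM : forall beta theta x, spec v beta theta x -> `|x| <= M.

Lemma union_spec_compact beta : compact (union_spec v beta).
Proof.
apply: (@subclosed_compact _ _ `[- M, M]); first exact: union_spec_closed.
  exact: segment_compact.
by move=> x [t /hM]; rewrite /= in_itv /= ler_norml.
Qed.

Lemma SigmaE alpha : Sigma v alpha = line_set (spec v alpha 0).
Proof. exact: sigma_spec. Qed.

Lemma SplusE beta : Splus v beta = line_set (union_spec v beta).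
Proof.
apply/seteqP; split => [z [t _]|_ [x [t hx] <-]].
  by rewrite sigma_spec// => -[x hx <-]; exists x => //; exists t.
by exists t => //; rewrite sigma_spec//; exists x.
Qed.

Lemma Splus_equilibrium beta :
  low_energy M (union_spec v beta) (equilibrium_measure (Splus v beta)).
Proof.
rewrite SplusE; apply: equilibrium_low_energy => //; first by move=> x [t /hM].
  exact: union_spec_compact.
by move=> p hp; have [x [hx px]] := spec_large hv beta 0 hp; exists x; split => //; exists 0.
Qed.

Lemma Sigma_equilibrium alpha :
  low_energy M (spec v alpha 0) (equilibrium_measure (Sigma v alpha)).
Proof.
rewrite SigmaE; apply: equilibrium_low_energy => //; first exact: hM.
  exact: spec_compact.
by move=> p hp; exact: spec_large.
Qed.

End SpectralEquilibrium.

Lemma circle_dist_lt (R : realType) (x y d : R) : circle_dist x y < d ->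
  exists m : int, `|x - y - m%:~R| < d.
Proof.
move=> h; have hS : has_inf [set `|x - y - m%:~R| | m in [set: int]].
  by split; [exists `|x - y - 0%:~R|, 0|exists 0 => _ [m _ <-]].
have e0 : 0 < d - circle_dist x y by rewrite subr_gt0.
have [_ [m _ <-] hm] := inf_adherent e0 hS.
by exists m; move: hm; rewrite -/(circle_dist x y) [ltRHS]addrC subrK.
Qed.

Theorem theorem5p3 (R : realType) (v : R -> R) (alpha : R)
    (p : nat -> int) (q : nat -> nat)
    (hv : circle_continuous v)
    (halpha : irrational alpha)
    (hq : forall n, (0 < q n)%N)
    (hpq : forall n, coprime (absz (p n)) (q n))
    (hlim : (fun n => circle_dist ((p n)%:~R / (q n)%:R) alpha) @ \oo --> (0 : R))
    (hL : forall E : R[i], Sigma v alpha E -> lyapunov v alpha E = 0) :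
  weak_star_cvg (fun n => equilibrium_measure (Splus v ((p n)%:~R / (q n)%:R)))
    (equilibrium_measure (Sigma v alpha)).
Proof.
have [M M1 hM] := spec_bounded hv.
have M0 : 0 < M by exact: lt_le_trans M1.
have hL' x : spec v alpha 0 x -> lyapunov v alpha x%:C = 0.
  by move=> hx; apply: hL; rewrite SigmaE//; exists x.
move=> f cf _.
have cg : continuous (fun x : R => f x%:C).
  by move=> x; apply: (@continuous_comp _ _ _ (fun x : R => x%:C : (R[i])^o) f x);
    [exact: continuous_real_complex|exact: cf].
apply/cvgrPdist_le => e e0.
(* One third for replacing [f] by the Lipschitz function [g] under each of the two measures, and one
   third for the difference of the means of [g]. *)
have e30 : 0 < e / 3 by rewrite divr_gt0.
have [g [lg fg]] := lipschitz_approximation M0 e30 cg.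
have [d d0 hd] := spectral_means_close hv halpha M0 hM hL' lg e30.
have /cvgrPdist_lt /(_ d d0) := hlim.
apply: filterS => n; rewrite sub0r normrN => hn.
have [m hm] := circle_dist_lt (le_lt_trans (ler_norm _) hn).
have [nuX mL hE] := Splus_equilibrium hv M1 hM ((p n)%:~R / (q n)%:R).
have [nuX' mL' hE'] := Sigma_equilibrium hv M1 hM alpha.
have XM x : spec v alpha 0 x -> `|x| <= M by exact: hM.
have XM' x : union_spec v ((p n)%:~R / (q n)%:R) x -> `|x| <= M by case=> t /hM.
have h1 := line_integral_close XM (@spec_closed _ v alpha 0) nuX' cg lg (fun x h => fg x (XM x h)).
have h2 := line_integral_close XM' (@union_spec_closed _ _ hv _) nuX cg lg (fun x h => fg x (XM' x h)).
have h3 := hd _ _ _ _ hm mL mL' hE hE'.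
move: h1 h2 h3; rewrite !ler_norml.
set I1 := Rintegral _ _ _; set I2 := Rintegral _ _ _.
set L1 := line_mean _ _ _; set L2 := line_mean _ _ _.
move=> /andP[h1 h2] /andP[h3 h4] /andP[h5 h6]; apply/andP; split; lra.
Qed.
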